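(* There is an algorithm which, given a $C_{ab}$ code $\mathcal{C}_H(\mathcal{P},m)\subseteq\mathbb{F}^n$ with $a<b$ and $\mathcal{P}=\{P_1,\dots,P_n\}$ distinct finite rational places, the reduced Gröbner basis with respect to $\preceq_{a,b}$ of the ideal $\mathcal{G}=\{h\in\mathbb{F}[X,Y]\mid h(P)=0\text{ for all }P\in\mathcal{P}\}$ (where $a=\deg_Y(H)$, $b=\deg_X(H)$), and a codeword $\mathbf{c}=(c_1,\dots,c_n)\in\mathcal{C}_H(\mathcal{P},m)$, outputs $f_H\in\mathcal{L}(mP_\infty)$ in standard form, with monomial support contained in $\hat B$, such that $f_H(P_i)=c_i$ for $i=1,\dots,n$, and which has the following complexity: let $q=|\mathbb{F}|$, assume $n\ge q$, and assume that the genus $g$ of the $C_{ab}$ curve satisfies $g\le n$; then the algorithm uses $\tilde{O}(qn)\subset\tilde{O}(n^2)$ operations in $\mathbb{F}$.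
   Context: Let $\mathbb{F}$ be a finite field, $a,b$ coprime positive integers, and $\deg_{a,b}(X^iY^j)=ai+bj$. Let $\operatorname{supp}(H)$ be the set of monomials with non-zero coefficient in $H$. $H\in\mathbb{F}[X,Y]$ is a $C_{ab}$ polynomial if: (i) $X^b,Y^a\in\operatorname{supp}(H)$; (ii) $X^iY^j\in\operatorname{supp}(H)$ implies $ai+bj\le ab$; (iii) $\langle H,\partial H/\partial X,\partial H/\partial Y\rangle=\mathbb{F}[X,Y]$. Such $H$ is absolutely irreducible; its function field $\mathbb{F}(x,y)$, $H(x,y)=0$, has genus $g=(a-1)(b-1)/2$ and a unique rational place $P_\infty$ that is the only pole of $x$ and of $y$; $x^iy^j$ has pole order $ai+bj$ there. The other rational places (finite rational places) are identified with the points $(\alpha,\beta)\in\mathbb{F}^2$ with $H(\alpha,\beta)=0$. Each $f\in\mathbb{F}[x,y]=\mathbb{F}[X,Y]/\langle H\rangle$ has a unique representation with $y$-degree at most $a-1$, its standard form. The Riemann–Roch space $\mathcal{L}(mP_\infty)$ is the $\mathbb{F}$-span of $B=\{x^iy^j\mid ai+bj\le m,\ 0\le j\le a-1\}$. For distinct finite rational places $P_1,\dots,P_n$ and an integer $m\ge0$, $\mathcal{C}_H(\mathcal{P},m)=\{\operatorname{ev}_{\mathcal{P}}(f)\mid f\in\mathcal{L}(mP_\infty)\}$ with $\operatorname{ev}_{\mathcal{P}}(f)=(f(P_1),\dots,f(P_n))$. It is always assumed that $m\le n+2g-1$. $\preceq_{a,b}$ is the monomial order comparing first by $\deg_{a,b}$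 and breaking ties so that $X^b\preceq_{a,b}Y^a$ (among monomials of equal weighted degree, larger $Y$-exponent is larger). The set $\hat B\subseteq B$: go through the monomials of $B$ in order of increasing $(a,b)$-weighted degree, starting with $\hat B=\emptyset$, and add $x^uy^v$ to $\hat B$ whenever $\operatorname{ev}_{\mathcal{P}}(x^uy^v)$ is linearly independent of $\{\operatorname{ev}_{\mathcal{P}}(x^iy^j)\}_{x^iy^j\in\hat B}$. Then $|\hat B|=\dim\mathcal{C}_H(\mathcal{P},m)$, and $\hat B=B$ when $m<n$. Complexity is the number of arithmetic operations in $\mathbb{F}$ in an algebraic RAM model (table lookup and insertion cost $O(1)$); implied constants are absolute; the Gröbner basis is precomputed. $\tilde{O}(h)=\bigcup_{c\ge0}O(h\log^c h)$, and $\log t$ is read as $\max(1,\log t)$. *)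

(* Defs.v *)
From HB Require Import structures.
From mathcomp Require Import all_boot all_order all_algebra.

Set Implicit Arguments.
Unset Strict Implicit.
Unset Printing Implicit Defensive.

Import GRing.Theory.
Local Open Scope ring_scope.

(* F[X,Y] is {poly {poly F}} with the conventions of polyXY: the outer variable
   is X, the inner one is Y, so that the coefficient of X^i Y^j in p is p`_i`_j,
   the value at (x, y) is p.[x, y], and deg_Y p <= a - 1 reads sizeY p <= a.
   The monomial X^i Y^j is the pair (i, j). *)

Definition coefXY (F : fieldType) (p : {poly {poly F}}) (u : nat * nat) : F :=
  p`_u.1`_u.2.

Definition monXY (F : fieldType) (c : F) (u : nat * nat) : {poly {poly F}} :=
  (c *: 'X^(u.2)) *: 'X^(u.1).

Definition supp (F : fieldType) (p : {poly {poly F}}) : seq (nat * nat) :=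
  [seq u <- [seq (i, j) | i <- iota 0 (size p), j <- iota 0 (sizeY p)]
     | coefXY p u != 0].

Definition wdeg (a b : nat) (u : nat * nat) : nat := (a * u.1 + b * u.2)%N.

Definition mon_le (a b : nat) (u v : nat * nat) : bool :=
  (wdeg a b u < wdeg a b v)%N
  || ((wdeg a b u == wdeg a b v) && (u.2 <= v.2)%N).

Definition mon_dvd (u v : nat * nat) : bool := (u.1 <= v.1)%N && (u.2 <= v.2)%N.

Definition dX (F : fieldType) (p : {poly {poly F}}) : {poly {poly F}} := p^`().
Definition dY (F : fieldType) (p : {poly {poly F}}) : {poly {poly F}} :=
  map_poly (@deriv F) p.

Definition Cab_poly (F : fieldType) (a b : nat) (H : {poly {poly F}}) : Prop :=
  [/\ (0 < a)%N /\ (0 < b)%N, coprime a b,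
      (b, 0%N) \in supp H /\ (0%N, a) \in supp H,
      forall u, u \in supp H -> (wdeg a b u <= a * b)%N
    & exists r s t : {poly {poly F}}, r * H + s * dX H + t * dY H = 1].

Definition genus (a b : nat) : nat := (a.-1 * b.-1)./2.

(* The set B, listed by increasing weighted degree; a * i <= m bounds i by m. *)
Definition Bmon (a b m : nat) : seq (nat * nat) :=
  sort (fun u v => (wdeg a b u <= wdeg a b v)%N)
    [seq u <- [seq (i, j) | i <- iota 0 m.+1, j <- iota 0 a]
       | (wdeg a b u <= m)%N].

(* Elements of F[x,y] = F[X,Y]/<H> are represented by their standard form;
   L(m P_oo) is the F-span of B. *)
Definition in_RR (F : fieldType) (a b m : nat) (f : {poly {poly F}}) : Prop :=
  exists lam : nat * nat -> F, f = \sum_(u <- Bmon a b m) monXY (lam u) u.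

Definition standard_form (F : fieldType) (a : nat) (f : {poly {poly F}}) : Prop :=
  (sizeY f <= a)%N.

Definition ev (F : fieldType) (n : nat) (P : 'I_n -> F * F)
    (f : {poly {poly F}}) : 'rV[F]_n :=
  \row_(i < n) f.[(P i).1, (P i).2].

Definition Cab_code (F : fieldType) (a b n m : nat) (P : 'I_n -> F * F)
    (c : 'rV[F]_n) : Prop :=
  exists2 f, in_RR a b m f & c = ev P f.

Definition Bhat (F : fieldType) (a b n m : nat) (P : 'I_n -> F * F) :
    seq (nat * nat) :=
  foldl (fun acc u =>
           if ev P (monXY 1 u) \in <<[seq ev P (monXY 1 v) | v <- acc]>>%VS
           then acc else rcons acc u)
        [::] (Bmon a b m).

Definition vanishing_ideal (F : fieldType) (n : nat) (P : 'I_n -> F * F)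
    (h : {poly {poly F}}) : Prop :=
  forall i, h.[(P i).1, (P i).2] = 0.

Definition is_LM (F : fieldType) (a b : nat) (p : {poly {poly F}})
    (u : nat * nat) : Prop :=
  u \in supp p /\ forall v, v \in supp p -> mon_le a b v u.

Definition Groebner_basis (F : fieldType) (a b : nat)
    (J : {poly {poly F}} -> Prop) (G : seq {poly {poly F}}) : Prop :=
  (forall g, g \in G -> J g) /\
  (forall h u, J h -> is_LM a b h u ->
     exists g v, [/\ g \in G, is_LM a b g v & mon_dvd v u]).

(* A reduced basis is a set: it is given by a duplicate-free list, in any order. *)
Definition reduced_Groebner_basis (F : fieldType) (a b : nat)
    (J : {poly {poly F}} -> Prop) (G : seq {poly {poly F}}) : Prop :=
  [/\ uniq G, Groebner_basis a b J G,
      forall g, g \in G -> exists2 u, is_LM a b g u & coefXY g u = 1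
    & forall g g' u v, g \in G -> g' \in G -> g != g' ->
        u \in supp g -> is_LM a b g' v -> ~~ mon_dvd v u].

(* Algebraic RAM over F.  The memory consists of tables of machine words
   (addresses, exponents, counters) and tables of field elements, both indexed
   by words.  There are no conversions between words and field elements: a field
   element can only be moved, combined by field operations, or tested for zero.
   The only field constants are 0 and 1, so a program makes sense over every F. *)

Inductive wexpr : Type :=
| WConst of nat
| WGet of nat & wexpr            (* WGet t e: entry e of word table t *)
| WAdd of wexpr & wexpr
| WSub of wexpr & wexpr          (* truncated *)
| WMul of wexpr & wexpr
| WDiv of wexpr & wexpr.

Inductive fexpr : Type :=
| FZero
| FOne
| FGet of nat & wexpr            (* FGet t e: entry e of field table t *)
| FAdd of fexpr & fexpr
| FSub of fexpr & fexpr
| FMul of fexpr & fexpr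
| FDiv of fexpr & fexpr.

Inductive test : Type :=
| TEq of wexpr & wexpr
| TLt of wexpr & wexpr
| TZero of fexpr.

Inductive cmd : Type :=
| Skip
| WSet of nat & wexpr & wexpr    (* WSet t e v: insert v at entry e of table t *)
| FSet of nat & wexpr & fexpr
| Seq of cmd & cmd
| If of test & cmd & cmd
| While of test & cmd.

Record store (F : fieldType) := Store {
  wtab : nat -> nat -> nat;
  ftab : nat -> nat -> F
}.

Definition upd (T : Type) (tab : nat -> nat -> T) (t i : nat) (v : T) :
    nat -> nat -> T :=
  fun t' i' => if (t' == t) && (i' == i) then v else tab t' i'.

(* Unit cost: every operation on words or on field elements, every lookup,
   insertion and branch costs 1.  Word operations must be charged: with free
   word arithmetic, tabulating the operations of F would make all further
   computation free. *)

Fixpoint wcost (e : wexpr) : nat :=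
  match e with
  | WConst _ => 1
  | WGet _ e1 => (wcost e1).+1
  | WAdd e1 e2 | WSub e1 e2 | WMul e1 e2 | WDiv e1 e2 =>
      (wcost e1 + wcost e2).+1
  end%N.

Fixpoint fcost (e : fexpr) : nat :=
  match e with
  | FZero | FOne => 1
  | FGet _ e1 => (wcost e1).+1
  | FAdd e1 e2 | FSub e1 e2 | FMul e1 e2 | FDiv e1 e2 =>
      (fcost e1 + fcost e2).+1
  end%N.

Definition tcost (b : test) : nat :=
  match b with
  | TEq e1 e2 | TLt e1 e2 => (wcost e1 + wcost e2).+1
  | TZero e => (fcost e).+1
  end%N.

(* Words are bounded by W.  A program producing a larger word, or dividing by
   the field element 0, gets stuck (value None); x %/ 0 = 0 on words. *)

Definition guard (W v : nat) : option nat := if (v <= W)%N then Some v else None.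

Fixpoint weval (F : fieldType) (W : nat) (s : store F) (e : wexpr) :
    option nat :=
  let bin op e1 e2 :=
    if weval W s e1 is Some v1 then
      if weval W s e2 is Some v2 then guard W (op v1 v2) else None
    else None in
  match e with
  | WConst v => guard W v
  | WGet t e1 => omap (wtab s t) (weval W s e1)
  | WAdd e1 e2 => bin addn e1 e2
  | WSub e1 e2 => bin subn e1 e2
  | WMul e1 e2 => bin muln e1 e2
  | WDiv e1 e2 => bin divn e1 e2
  end.

Fixpoint feval (F : fieldType) (W : nat) (s : store F) (e : fexpr) : option F :=
  let bin op e1 e2 :=
    if feval W s e1 is Some v1 then
      if feval W s e2 is Some v2 then op v1 v2 else None
    else None in
  match e with
  | FZero => Some 0
  | FOne => Some 1
  | FGet t e1 => omap (ftab s t) (weval W s e1)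
  | FAdd e1 e2 => bin (fun x y => Some (x + y)) e1 e2
  | FSub e1 e2 => bin (fun x y => Some (x - y)) e1 e2
  | FMul e1 e2 => bin (fun x y => Some (x * y)) e1 e2
  | FDiv e1 e2 => bin (fun x y => if y == 0 then None else Some (x / y)) e1 e2
  end.

Definition teval (F : fieldType) (W : nat) (s : store F) (b : test) :
    option bool :=
  match b with
  | TEq e1 e2 =>
      if weval W s e1 is Some v1 then omap (eqn v1) (weval W s e2) else None
  | TLt e1 e2 =>
      if weval W s e1 is Some v1 then omap (leq v1.+1) (weval W s e2) else None
  | TZero e => omap (fun x : F => x == 0) (feval W s e)
  end.

(* exec W p s t s': started in s, the program p halts in s' at total cost t. *)
Inductive exec (F : fieldType) (W : nat) :
    cmd -> store F -> nat -> store F -> Prop :=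
| ExecSkip s : exec W Skip s 1 s
| ExecWSet t e e' s i v :
    weval W s e = Some i -> weval W s e' = Some v ->
    exec W (WSet t e e') s (wcost e + wcost e').+1
      (Store (upd (wtab s) t i v) (ftab s))
| ExecFSet t e e' s i v :
    weval W s e = Some i -> feval W s e' = Some v ->
    exec W (FSet t e e') s (wcost e + fcost e').+1
      (Store (wtab s) (upd (ftab s) t i v))
| ExecSeq p1 p2 s1 s2 s3 t1 t2 :
    exec W p1 s1 t1 s2 -> exec W p2 s2 t2 s3 ->
    exec W (Seq p1 p2) s1 (t1 + t2) s3
| ExecIf b p1 p2 s s' v t :
    teval W s b = Some v -> exec W (if v then p1 else p2) s t s' ->
    exec W (If b p1 p2) s (tcost b + t).+1 s'
| ExecWhileF b p s :
    teval W s b = Some false ->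
    exec W (While b p) s (tcost b).+1 s
| ExecWhileT b p s1 s2 s3 t1 t2 :
    teval W s1 b = Some true ->
    exec W p s1 t1 s2 -> exec W (While b p) s2 t2 s3 ->
    exec W (While b p) s1 (tcost b + t1 + t2).+1 s3.

Record cab_input := CabInput {
  fld : finFieldType;
  pa : nat;
  pb : nat;
  len : nat;                             (* n *)
  deg : nat;                             (* m *)
  curve : {poly {poly fld}};             (* H *)
  pts : 'I_len -> fld * fld;             (* P_1, ..., P_n *)
  gb : seq {poly {poly fld}};
  cw : 'rV[fld]_len                      (* c *)
}.

Definition valid_input (I : cab_input) : Prop :=
  [/\ Cab_poly (pa I) (pb I) (curve I) /\ (pa I < pb I)%N,
      injective (@pts I) /\ (forall i, (curve I).[(@pts I i).1, (@pts I i).2] = 0),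
      (deg I < len I + 2 * genus (pa I) (pb I))%N,
      reduced_Groebner_basis (pa I) (pb I) (vanishing_ideal (@pts I)) (gb I)
    & Cab_code (pa I) (pb I) (deg I) (@pts I) (cw I)].

(* Polynomials are given to the machine sparsely, by decreasing monomials. *)
Definition terms (F : fieldType) (a b : nat) (p : {poly {poly F}}) :
    seq (nat * nat * F) :=
  [seq (u, coefXY p u) | u <- sort (fun u v => mon_le a b v u) (supp p)].

(* Word table 0: q, a, b, m, n, number of terms of H, number of basis elements;
   word tables 1 and 2, field table 0: exponents and coefficients of H;
   field tables 1, 2 and 3: the coordinates of the points, and the codeword;
   word tables 4 and 5, field table 4: exponents and coefficients of the basis
   elements, one after the other; the g-th one occupies the entries from
   (table 3, entry g) inclusive to (table 3, entry g + 1) exclusive.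
   Everything else is 0. *)
Definition load (I : cab_input) : store (fld I) :=
  let tH := terms (pa I) (pb I) (curve I) in
  let tG := [seq terms (pa I) (pb I) g | g <- gb I] in
  let G := flatten tG in
  let wt := [::
    [:: #|fld I|; pa I; pb I; deg I; len I; size tH; size tG];
    [seq x.1.1 | x <- tH];
    [seq x.1.2 | x <- tH];
    0%N :: scanl addn 0%N (map size tG);
    [seq x.1.1 | x <- G];
    [seq x.1.2 | x <- G]] in
  let ft := [::
    [seq x.2 | x <- tH];
    [seq (@pts I i).1 | i <- enum 'I_(len I)];
    [seq (@pts I i).2 | i <- enum 'I_(len I)];
    [seq cw I ord0 i | i <- enum 'I_(len I)];
    [seq x.2 | x <- G]] in
  Store (fun t i => nth 0%N (nth [::] wt t) i) (fun t i => nth 0 (nth [::] ft t) i).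

(* The output is read as a list of terms: their number is entry 0 of word
   table 0, the exponents are in word tables 1 and 2, the coefficients in field
   table 0. *)
Definition out_terms (F : fieldType) (s : store F) : seq (nat * nat * F) :=
  [seq (wtab s 1 k, wtab s 2 k, ftab s 0 k) | k <- iota 0 (wtab s 0 0)].

Definition outputs (F : fieldType) (s : store F) (f : {poly {poly F}}) : Prop :=
  uniq [seq x.1 | x <- out_terms s] /\
  f = \sum_(x <- out_terms s) monXY x.2 x.1.

(* Words have O(log N) bits, N being the sum of the numerical parameters. *)
Definition word_bound (k : nat) (I : cab_input) : nat :=
  ((#|fld I| + pa I + pb I + deg I + len I) ^ k)%N.

Definition lg (h : nat) : nat := maxn 1 (trunc_log 2 h).

(* T is in soft-O of h, uniformly over the instances in D. *)
Definition softO (A : Type) (D : A -> Prop) (h T : A -> nat) : Prop :=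
  exists C d : nat, forall x, D x -> (T x <= C * (h x * lg (h x) ^ d))%N.

(* Main.v *)
Require Import Defs.
From mathcomp Require Import all_boot all_order all_algebra.
From mathcomp Require Import finfield zify ring.
From Stdlib Require Import ClassicalEpsilon.

Set Implicit Arguments.
Unset Strict Implicit.
Unset Printing Implicit Defensive.

Import GRing.Theory.
Local Open Scope ring_scope.

(** The codeword determines a function on the points, and the function sought is
    its normal form modulo the vanishing ideal.  Write q for the size of the
    field.

    Correctness does not depend on how the normal form is found.  Let fhat be any
    polynomial through the points and f its remainder, so that no monomial of f
    is divisible by a leading monomial of the basis.  The codeword is the
    evaluation of some h in the Riemann-Roch space, and f - h vanishes at the
    points.  Were the leading monomial of f not among those allowed for h, it
    would lead f - h, hence be divisible by a leading monomial of the basis: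
    so f lies in the same space.  The same argument shows that a monomial that is
    reduced with respect to the basis is not, on the points, a combination of
    smaller ones, so the greedy choice of Bhat keeps it (normal_form_correct).

    For fhat the points are grouped by their x-coordinate.  Newton interpolation
    gives in each group a polynomial in Y of degree below a, because the curve
    meets a vertical line in at most a points; it is multiplied by the polynomial
    1 - (X^q - al^q) / (X - al), which is 1 at al and 0 at the other elements of
    the field (fhat_eval, interp_spec).  This costs O(q n).

    The division handles Y by columns, one for each of the J = 2 a - 1 exponents
    k of Y that can occur, and X by fast arithmetic.  For each j < J there is one
    row: the basis element whose leading monomial has the largest Y-exponent at
    most j, times a power of Y, so that its leading monomial is X^d Y^j for the
    least d possible.  Giving X^i Y^k the time i + floor(b k / a) turns the
    weighted order into the order of times, up to ties inside one time slot,
    which are resolved by b k mod a and then by k (row_later).  Each column, read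
    by decreasing time, is thus a power series, and the quotients are computed
    digit by digit: a digit of the quotient of row j is the current entry of
    column j, and it affects only later entries (division_spec).  The remainder is
    what is left in the columns (remainder_coef, remainder_standard).

    The products with the rows are deferred: when c digits are known and L is the
    largest power of 2 dividing c, the last L digits are multiplied at once by a
    window of 2 L row entries, and the next L digits are updated (bs_block,
    block_spec).  The lengths add up to T log T for T digits (sum_v2).  With about
    a^2 pairs of a row and a column and T = O(q + b), the total is a^2 T up to
    logarithms, and a^2 T = O(q n) because a b = O(n) by the bound on the genus
    and n <= q^2 (aaT_le).

    A product of length r^nu is computed in O(r^nu nu^6) operations over every
    field, with r = 2, or r = 3 in characteristic 2, since a transform needs r to
    be invertible.  As in the algorithm of Schoenhage and Strassen, a cyclic
    product is turned into about r^(nu/2) products in a ring F[x] / Phi(x^M),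
    where the powers of x are roots of unity and multiplying by them is a rotation
    (level_conv); the recursion is run level by level on one array (cyc_spec).

    Programs are treated by a weakest-precondition calculus that carries the
    cost, the set of tables that may change, and a bound V on all words
    (wp_for). *)



(** * Programs: weakest preconditions with cost *)

Section Logic.

Context (F : fieldType) (W V : nat).
Implicit Types (s : store F) (e : wexpr).

Fixpoint wden s e : nat :=
  match e with
  | WConst v => v
  | WGet t e1 => wtab s t (wden s e1)
  | WAdd e1 e2 => wden s e1 + wden s e2
  | WSub e1 e2 => wden s e1 - wden s e2
  | WMul e1 e2 => wden s e1 * wden s e2
  | WDiv e1 e2 => wden s e1 %/ wden s e2
  end%N.

Fixpoint fden s (e : fexpr) : F :=
  match e with
  | FZero => 0
  | FOne => 1
  | FGet t e1 => ftab s t (wden s e1)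
  | FAdd e1 e2 => fden s e1 + fden s e2
  | FSub e1 e2 => fden s e1 - fden s e2
  | FMul e1 e2 => fden s e1 * fden s e2
  | FDiv e1 e2 => fden s e1 / fden s e2
  end.

Fixpoint fsafe s (e : fexpr) : Prop :=
  match e with
  | FZero | FOne | FGet _ _ => True
  | FAdd e1 e2 | FSub e1 e2 | FMul e1 e2 => fsafe s e1 /\ fsafe s e2
  | FDiv e1 e2 => [/\ fsafe s e1, fsafe s e2 & fden s e2 != 0]
  end.

Definition tden s (b : test) : bool :=
  match b with
  | TEq e1 e2 => wden s e1 == wden s e2
  | TLt e1 e2 => (wden s e1 < wden s e2)%N
  | TZero e => fden s e == 0
  end.

Definition tsafe s (b : test) : Prop :=
  if b is TZero e then fsafe s e else True.

Fixpoint wconsts (c : nat) e : bool :=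
  match e with
  | WConst v => (v <= c)%N
  | WGet _ e1 => wconsts c e1
  | WAdd e1 e2 | WSub e1 e2 | WMul e1 e2 | WDiv e1 e2 =>
      wconsts c e1 && wconsts c e2
  end.

Definition wlim : nat := 90.

(** With at most wlim nodes and constants at most 250, an expression over words
    bounded by V evaluates to at most V ^ wlim. *)
Definition wok e := wconsts 250 e && (wcost e <= wlim)%N.

Fixpoint fok (e : fexpr) : bool :=
  match e with
  | FZero | FOne => true
  | FGet _ e1 => wok e1
  | FAdd e1 e2 | FSub e1 e2 | FMul e1 e2 | FDiv e1 e2 => fok e1 && fok e2
  end.

Definition tok (b : test) : bool :=
  match b with
  | TEq e1 e2 | TLt e1 e2 => wok e1 && wok e2
  | TZero e => fok e
  end.

Definition bounded s : Prop := forall t i, (wtab s t i <= V)%N.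

Hypothesis V_ge : (250 <= V)%N.
Hypothesis W_ge : (V ^ wlim <= W)%N.

(** Each operation at most multiplies the bounds of its arguments; the additional
    factor V that a node contributes covers the 2 that a sum needs. *)
Lemma wden_bound s e : bounded s -> wconsts 250 e -> (wden s e <= V ^ wcost e)%N.
Proof.
move=> bs; have V0 : (0 < V)%N by lia.
have mono m n : (m <= n)%N -> (V ^ m <= V ^ n)%N by move=> h; rewrite leq_pexp2l.
elim: e => [v|t e _|e1 IH1 e2 IH2|e1 IH1 e2 IH2|e1 IH1 e2 IH2|e1 IH1 e2 IH2] /=.
- by move=> hv; rewrite expn1; lia.
- by move=> _; apply: leq_trans (bs t _) _; rewrite -[X in (X <= _)%N]expn1 mono.
- case/andP=> /IH1 h1 /IH2 h2; rewrite expnS.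
  have m1 : (V ^ wcost e1 <= V ^ (wcost e1 + wcost e2))%N by apply: mono; lia.
  have m2 : (V ^ wcost e2 <= V ^ (wcost e1 + wcost e2))%N by apply: mono; lia.
  apply: leq_trans (leq_add (leq_trans h1 m1) (leq_trans h2 m2)) _.
  by rewrite addnn -mul2n leq_mul2r; apply/orP; right; lia.
- case/andP=> /IH1 h1 _.
  have m1 : (V ^ wcost e1 <= V ^ (wcost e1 + wcost e2).+1)%N by apply: mono; lia.
  by lia.
- case/andP=> /IH1 h1 /IH2 h2; rewrite expnS expnD.
  by apply: leq_trans (leq_mul h1 h2) _; rewrite leq_pmull.
- case/andP=> /IH1 h1 _; apply: leq_trans (leq_div _ _) _.
  by apply: leq_trans h1 _; apply: mono; lia.
Qed.

Lemma weval_wden s e : bounded s -> wok e -> weval W s e = Some (wden s e).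
Proof.
move=> bs /andP[]; have V0 : (0 < V)%N by lia.
have bd e' : wconsts 250 e' -> (wcost e' <= wlim)%N -> guard W (wden s e') = Some (wden s e').
  move=> h1 h2; rewrite /guard ifT //; apply: leq_trans (wden_bound bs h1) _.
  by apply: leq_trans W_ge; rewrite leq_pexp2l.
elim: e => [v|t e IH|e1 IH1 e2 IH2|e1 IH1 e2 IH2|e1 IH1 e2 IH2|e1 IH1 e2 IH2] h1 h2.
- exact: bd (WConst v) _ _.
- by rewrite /= IH //; apply: leq_trans h2 => /=.
- move: (h1) (h2) => /= /andP[k1 k2] k3; rewrite IH1 ?IH2 //; try lia.
  exact: bd (WAdd e1 e2) _ _.
- move: (h1) (h2) => /= /andP[k1 k2] k3; rewrite IH1 ?IH2 //; try lia.
  exact: bd (WSub e1 e2) _ _.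
- move: (h1) (h2) => /= /andP[k1 k2] k3; rewrite IH1 ?IH2 //; try lia.
  exact: bd (WMul e1 e2) _ _.
- move: (h1) (h2) => /= /andP[k1 k2] k3; rewrite IH1 ?IH2 //; try lia.
  exact: bd (WDiv e1 e2) _ _.
Qed.

Lemma feval_fden s (e : fexpr) : bounded s -> fok e -> fsafe s e ->
  feval W s e = Some (fden s e).
Proof.
move=> bs; elim: e => [||t e|e1 IH1 e2 IH2|e1 IH1 e2 IH2|e1 IH1 e2 IH2|e1 IH1 e2 IH2] //=.
- by move=> h _; rewrite weval_wden.
- by case/andP=> h1 h2 [k1 k2]; rewrite IH1 ?IH2.
- by case/andP=> h1 h2 [k1 k2]; rewrite IH1 ?IH2.
- by case/andP=> h1 h2 [k1 k2]; rewrite IH1 ?IH2.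
- by case/andP=> h1 h2 [k1 k2 /negbTE k3]; rewrite IH1 ?IH2 //= k3.
Qed.

Lemma teval_tden s b : bounded s -> tok b -> tsafe s b ->
  teval W s b = Some (tden s b).
Proof.
move=> bs; case: b => [e1 e2|e1 e2|e] /=.
- by case/andP=> h1 h2 _; rewrite !weval_wden.
- by case/andP=> h1 h2 _; rewrite !weval_wden.
- by move=> h1 h2; rewrite feval_fden.
Qed.

Definition setw s t i v : store F := Store (upd (wtab s) t i v) (ftab s).
Definition setf s t i (v : F) : store F := Store (wtab s) (upd (ftab s) t i v).

Lemma setw_wE s t i v t' i' :
  wtab (setw s t i v) t' i' = if (t' == t) && (i' == i) then v else wtab s t' i'.
Proof. by []. Qed.

Lemma bounded_setw s t i v : bounded s -> (v <= V)%N -> bounded (setw s t i v).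
Proof. by move=> bs hv t' i'; rewrite setw_wE; case: ifP. Qed.

(** Total correctness with cost: from a bounded store the program halts in a bounded
    store, and the cost and the store satisfy Q. *)
Definition wp (p : cmd) s (Q : nat -> store F -> Prop) : Prop :=
  bounded s -> exists t s', [/\ exec W p s t s', bounded s' & Q t s'].

Lemma wp_conseq p s (Q Q' : nat -> store F -> Prop) :
  wp p s Q -> (forall t s', bounded s' -> Q t s' -> Q' t s') -> wp p s Q'.
Proof.
by move=> h hQ /h[t [s' [h1 h2 h3]]]; exists t, s'; split=> //; apply: hQ.
Qed.

Lemma wp_bounded p s Q : (bounded s -> wp p s Q) -> wp p s Q.
Proof. by move=> h bs; apply: h. Qed.

Lemma wp_skip s (Q : nat -> store F -> Prop) : Q 1%N s -> wp Skip s Q.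
Proof. by move=> h bs; exists 1%N, s; split=> //; constructor. Qed.

Lemma wp_seq p1 p2 s (Q : nat -> store F -> Prop) :
  wp p1 s (fun t1 s1 => wp p2 s1 (fun t2 s2 => Q (t1 + t2)%N s2)) ->
  wp (Seq p1 p2) s Q.
Proof.
move=> h bs; have [t1 [s1 [e1 bs1 h1]]] := h bs.
have [t2 [s2 [e2 bs2 h2]]] := h1 bs1.
by exists (t1 + t2)%N, s2; split=> //; apply: ExecSeq e1 e2.
Qed.

Lemma wp_wset t e e' s (Q : nat -> store F -> Prop) :
  wok e -> wok e' -> (bounded s -> (wden s e' <= V)%N) ->
  Q (wcost e + wcost e').+1 (setw s t (wden s e) (wden s e')) ->
  wp (WSet t e e') s Q.
Proof.
move=> h1 h2 h3 h bs; eexists; eexists; split; last exact: h.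
  by apply: ExecWSet; apply: weval_wden.
exact: bounded_setw bs (h3 bs).
Qed.

Lemma wp_fset t e (e' : fexpr) s (Q : nat -> store F -> Prop) :
  wok e -> fok e' -> fsafe s e' ->
  Q (wcost e + fcost e').+1 (setf s t (wden s e) (fden s e')) ->
  wp (FSet t e e') s Q.
Proof.
move=> h1 h2 h3 h bs; eexists; eexists; split; last exact: h.
  by apply: ExecFSet; [apply: weval_wden|apply: feval_fden].
exact: bs.
Qed.

Lemma wp_if b p1 p2 s (Q : nat -> store F -> Prop) :
  tok b -> tsafe s b ->
  (if tden s b then wp p1 s (fun t s' => Q (tcost b + t).+1 s')
   else wp p2 s (fun t s' => Q (tcost b + t).+1 s')) ->
  wp (If b p1 p2) s Q.
Proof.
move=> h1 h2 h bs.
have {h}: wp (if tden s b then p1 else p2) s (fun t s' => Q (tcost b + t).+1 s').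
  by case: (tden s b) h.
move=> /(_ bs)[t [s' [e bs' q]]]; exists (tcost b + t).+1, s'; split=> //.
by apply: ExecIf e; apply: teval_tden.
Qed.

(** The number k of turns is known in advance, which replaces a termination measure. *)
Lemma wp_while b p s k (B : nat -> nat) (Inv : nat -> store F -> Prop) Q :
  tok b -> Inv 0%N s ->
  (forall i s1, (i <= k)%N -> Inv i s1 -> tsafe s1 b /\ tden s1 b = (i < k)%N) ->
  (forall i s1, (i < k)%N -> Inv i s1 ->
     wp p s1 (fun t s2 => (t <= B i)%N /\ Inv i.+1 s2)) ->
  (forall t s2, (t <= (tcost b).+1 * k.+1 + \sum_(i < k) B i)%N -> Inv k s2 -> Q t s2) ->
  wp (While b p) s Q.
Proof.
move=> okb I0 hb hp hQ.
suff: forall m i s1, (i + m = k)%N -> Inv i s1 -> wp (While b p) s1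
   (fun t s2 => (t <= (tcost b).+1 * m.+1 + \sum_(i <= j < k) B j)%N /\ Inv k s2).
  move=> /(_ k 0%N s (add0n k) I0) h; apply: wp_conseq h _ => t s' _ [h1 h2].
  by apply: hQ => //; rewrite -(big_mkord xpredT).
elim=> [|m IH] i s1 him Ii bs.
  have [h1 h2] := hb i s1 ltac:(lia) Ii; exists (tcost b).+1, s1; split=> //.
    by apply: ExecWhileF; rewrite teval_tden // h2; congr Some; lia.
  by split; [rewrite muln1; lia | move: Ii; have -> : i = k by lia].
have ik : (i < k)%N by lia.
have [h1 h2] := hb i s1 (ltnW ik) Ii.
have [t1 [s2 [e1 bs2 [c1 I2]]]] := hp i s1 ik Ii bs.
have [t2 [s3 [e2 bs3 [c2 I3]]]] := IH i.+1 s2 ltac:(lia) I2 bs2.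
exists (tcost b + t1 + t2).+1, s3; split=> //.
  by apply: ExecWhileT e1 e2; rewrite teval_tden // h2 ik.
split=> //; rewrite big_ltn //.
by rewrite [((tcost b).+1 * m.+2)%N]mulnS; lia.
Qed.

(** Only the word tables ws and the field tables fs may differ. *)
Definition frame (ws fs : seq nat) s s' : Prop :=
  (forall t i, t \notin ws -> wtab s' t i = wtab s t i) /\
  (forall t i, t \notin fs -> ftab s' t i = ftab s t i).

Lemma frame_refl ws fs s : frame ws fs s s. Proof. by []. Qed.

Lemma frame_trans ws fs s1 s2 s3 :
  frame ws fs s1 s2 -> frame ws fs s2 s3 -> frame ws fs s1 s3.
Proof.
move=> [a1 b1] [a2 b2]; split=> t i h; first by rewrite a2 // a1.
by rewrite b2 // b1.
Qed.

Lemma frame_sub ws fs ws' fs' s1 s2 : all (mem ws') ws -> all (mem fs') fs ->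
  frame ws fs s1 s2 -> frame ws' fs' s1 s2.
Proof.
move=> /allP h1 /allP h2 [a b]; split=> t i h.
  by apply: a; apply: contra h; apply: h1.
by apply: b; apply: contra h; apply: h2.
Qed.

Lemma frame_setw ws fs s s' t i v :
  t \in ws -> frame ws fs s s' -> frame ws fs s (setw s' t i v).
Proof.
move=> ht [a b]; split=> // t' i' h; rewrite setw_wE a //.
by case: eqP => // ett; rewrite -ett (negbTE h) in ht.
Qed.

Lemma frame_setf ws fs s s' t i v :
  t \in fs -> frame ws fs s s' -> frame ws fs s (setf s' t i v).
Proof.
move=> ht [a b]; split=> // t' i' h; rewrite /setf /= /upd b //.
by case: eqP => // ett; rewrite -ett (negbTE h) in ht.
Qed.

Fixpoint wfresh (ws : seq nat) e : bool :=
  match e with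
  | WConst v => true
  | WGet t e1 => (t \notin ws) && wfresh ws e1
  | WAdd e1 e2 | WSub e1 e2 | WMul e1 e2 | WDiv e1 e2 =>
      wfresh ws e1 && wfresh ws e2
  end.

Lemma wden_frame ws fs s s' e : frame ws fs s s' -> wfresh ws e ->
  wden s' e = wden s e.
Proof.
move=> [a _].
elim: e => [v|t e IH|e1 IH1 e2 IH2|e1 IH1 e2 IH2|e1 IH1 e2 IH2|e1 IH1 e2 IH2] //=.
- by case/andP=> h1 /IH ->; rewrite a.
- by case/andP=> /IH1 -> /IH2 ->.
- by case/andP=> /IH1 -> /IH2 ->.
- by case/andP=> /IH1 -> /IH2 ->.
- by case/andP=> /IH1 -> /IH2 ->.
Qed.

(** Scalar variables are entry 0 of a table of their own, so that a frame lists
    variables and arrays uniformly. *)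
Definition X (x : nat) : wexpr := WGet x (WConst 0).
Definition Z (x : nat) : fexpr := FGet x (WConst 0).
Definition wasg x e : cmd := WSet x (WConst 0) e.
Definition fasg x (e : fexpr) : cmd := FSet x (WConst 0) e.

Lemma wp_wput t e e' i v s (Q : nat -> store F -> Prop) :
  wok e -> wok e' -> wden s e = i -> wden s e' = v -> (v <= V)%N ->
  Q (wcost e + wcost e').+1 (setw s t i v) -> wp (WSet t e e') s Q.
Proof. by move=> h1 h2 <- <- h3 hQ; apply: wp_wset. Qed.

Lemma wp_wasg x e v s (Q : nat -> store F -> Prop) :
  wok e -> wden s e = v -> (v <= V)%N ->
  Q (wcost e).+2 (setw s x 0 v) -> wp (wasg x e) s Q.
Proof. by move=> h1 h2 h3 hQ; apply: wp_wput h2 h3 hQ. Qed.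

Lemma wp_fput t e (e' : fexpr) i v s (Q : nat -> store F -> Prop) :
  wok e -> fok e' -> fsafe s e' -> wden s e = i -> fden s e' = v ->
  Q (wcost e + fcost e').+1 (setf s t i v) -> wp (FSet t e e') s Q.
Proof. by move=> h1 h2 h3 <- <- hQ; apply: wp_fset. Qed.

Lemma wp_fasg x (e : fexpr) v s (Q : nat -> store F -> Prop) :
  fok e -> fsafe s e -> fden s e = v ->
  Q (fcost e).+2 (setf s x 0 v) -> wp (fasg x e) s Q.
Proof. by move=> h1 h2 h3 hQ; apply: wp_fput h2 _ h3 hQ. Qed.

Definition For (x : nat) (e : wexpr) (body : cmd) : cmd :=
  Seq (wasg x (WConst 0))
      (While (TLt (X x) e) (Seq body (wasg x (WAdd (X x) (WConst 1))))).

Lemma wp_for x e body ws fs n (B : nat -> nat) (P : nat -> store F -> Prop) s Q :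
  wok e -> x \in ws -> wfresh ws e -> wden s e = n -> (n <= V)%N ->
  (forall i s1 v, P i s1 -> P i (setw s1 x 0 v)) -> P 0%N s ->
  (forall i s1, (i < n)%N -> frame ws fs s s1 -> wtab s1 x 0 = i -> P i s1 ->
     wp body s1 (fun t s2 =>
       [/\ (t <= B i)%N, frame ws fs s1 s2, wtab s2 x 0 = i & P i.+1 s2])) ->
  (forall t s2, (t <= (wcost e + 20) * n.+1 + \sum_(i < n) B i)%N ->
     frame ws fs s s2 -> P n s2 -> Q t s2) ->
  wp (For x e body) s Q.
Proof.
move=> oke xw fr en nV Px P0 hb hQ; apply: wp_seq; apply: wp_wset => //=.
pose Inv i s1 := [/\ frame ws fs s s1, wtab s1 x 0 = i & P i s1].
apply: (@wp_while _ _ _ n (fun i => B i + 8)%N Inv).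
- by rewrite /tok /= oke.
- by split; [apply: frame_setw|rewrite setw_wE !eqxx|apply: Px].
- by move=> i s1 _ [h1 h2 h3]; split=> //=; rewrite h2 (wden_frame h1 fr) en.
- move=> i s1 ik [h1 h2 h3]; apply: wp_seq.
  apply: wp_conseq (hb i s1 ik h1 h2 h3) _ => t s2 _ [c2 f2 x2 p2].
  apply: wp_wset => //=; first by rewrite x2; lia.
  split; first by lia.
  split; last exact: Px.
    by apply: frame_setw => //; apply: frame_trans f2.
  by rewrite setw_wE !eqxx x2 addn1.
- move=> t s2 ht [h1 h2 h3]; apply: hQ => //.
  move: ht; rewrite big_split /= sum_nat_const card_ord /=; nia.
Qed.

(** A loop whose i-th turn writes f i into entry o + i of one field table. *)
Lemma wp_map x e body ws fs tt n C o (f : nat -> F) s Q :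
  wok e -> x \in ws -> wfresh ws e -> wden s e = n -> (n <= V)%N ->
  (forall i s1, (i < n)%N -> frame ws fs s s1 -> wtab s1 x 0 = i ->
     (forall p, ~~ (o <= p < o + i)%N -> ftab s1 tt p = ftab s tt p) ->
     wp body s1 (fun t s2 =>
       [/\ (t <= C)%N, frame ws fs s1 s2, wtab s2 x 0 = i &
           forall p, ftab s2 tt p = if p == (o + i)%N then f i else ftab s1 tt p])) ->
  (forall t s2, (t <= (wcost e + 20 + C) * n.+1)%N ->
     frame ws fs s s2 ->
     (forall p, ftab s2 tt p = if (o <= p < o + n)%N then f (p - o)%N else ftab s tt p) ->
     Q t s2) ->
  wp (For x e body) s Q.
Proof.
move=> oke xw fr en nV hb hQ.
pose P i s1 := forall p, ftab s1 tt p =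
  if (o <= p < o + i)%N then f (p - o)%N else ftab s tt p.
apply: (@wp_for _ _ _ ws fs n (fun=> C) P) => //.
- by move=> p; rewrite ifF //; lia.
- move=> i s1 ik f1 x1 p1.
  have hp p : ~~ (o <= p < o + i)%N -> ftab s1 tt p = ftab s tt p.
    by move=> h; rewrite p1 (negbTE h).
  apply: wp_conseq (hb i s1 ik f1 x1 hp) _ => t s2 _ [c2 f2 x2 p2]; split=> //.
  move=> p; rewrite p2 p1; case: eqP => [->|h]; first by rewrite ifT ?addKn //; lia.
  by congr (if _ then _ else _); lia.
- move=> t s2 ht f2 p2; apply: hQ => //; apply: leq_trans ht _.
  by rewrite sum_nat_const card_ord; nia.
Qed.

End Logic.

(** * Cyclic convolutions and transforms on coefficient arrays *)

Lemma sum_ord_mul (A : nmodType) (m n : nat) (f : nat -> A) :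
  \sum_(i < m * n) f i = \sum_(i < m) \sum_(j < n) f (i * n + j)%N.
Proof.
elim: m => [|m IH]; first by rewrite mul0n !big_ord0.
rewrite big_ord_recr /= -IH mulSnr big_split_ord /=; congr (_ + _).
Qed.

Lemma sum_ord_shift (A : nmodType) (n z : nat) (f : nat -> A) :
  \sum_(i < n) f i = \sum_(i < n) f ((i + z) %% n)%N.
Proof.
case: n => [|n]; first by rewrite !big_ord0.
rewrite (reindex_inj (h := fun i : 'I_n.+1 => inord ((i + z) %% n.+1))) /=.
  by apply: eq_bigr => i _; rewrite inordK // ltn_mod.
move=> i j /(congr1 val); rewrite /= !inordK ?ltn_mod // => /eqP.
by rewrite eqn_modDr !modn_small // => /eqP/val_inj.
Qed.

Section Value.

Context (F : fieldType) (E : comAlgType F).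
Implicit Types (a b : nat -> F) (x : E).

(** An array is compared with its values in commutative algebras, where it stands for
    a polynomial. *)
Definition value x n a : E := \sum_(l < n) a l *: x ^+ l.

(** As x ^ g and x ^ h are inverse to each other, a rotation by h z multiplies the
    value by x ^ (g z). *)
Lemma value_rot x n a g h z : x ^+ n = 1 -> x ^+ (g + h) = 1 ->
  value x n (fun l => a ((l + h * z) %% n)%N) = x ^+ (g * z) * value x n a.
Proof.
move=> xn gh; rewrite [in RHS]/value (sum_ord_shift n (h * z) (fun l => a l *: x ^+ l)).
rewrite big_distrr /=; apply: eq_bigr => l _; rewrite -scalerAr; congr (_ *: _).
rewrite expr_mod // -exprD addnCA -mulnDl exprD exprM gh expr1n mulr1 //.
Qed.

(** The blocks of N consecutive entries are convolved cyclically, each by itself. *)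
Definition conv N a b : nat -> F := fun p =>
  \sum_(i < N) a (p %/ N * N + i)%N * b (p %/ N * N + (p %% N + N - i) %% N)%N.

Lemma conv_value x N it a b : x ^+ N = 1 ->
  value x N (fun l => conv N a b (it * N + l)%N) =
  value x N (fun l => a (it * N + l)%N) * value x N (fun l => b (it * N + l)%N).
Proof.
move=> xN; case: N => [|N] in xN *; first by rewrite /value !big_ord0 mul0r.
rewrite /value big_distrl /=.
under eq_bigr => l _.
  rewrite /conv divnMDl // divn_small // addn0 modnMDl modn_small // scaler_suml.
  over.
rewrite exchange_big /=; apply: eq_bigr => i _.
rewrite (sum_ord_shift _ i (fun l => (_ * b (it * N.+1 + (l + N.+1 - i) %% N.+1)%N) *: x ^+ l)).
rewrite big_distrr /=; apply: eq_bigr => l _.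
rewrite expr_mod // -scalerAl -scalerAr scalerA exprD mulrC; congr (_ *: _).
  rewrite mulrC; congr (_ * b (_ + _)%N); have := ltn_ord i; have := ltn_ord l.
  move=> h1 h2; case: (ltnP (l + i) N.+1) => h3.
    rewrite (modn_small h3) (_ : l + i + N.+1 - i = l + N.+1)%N; last by lia.
    by rewrite modnDr modn_small.
  rewrite (_ : (l + i) %% N.+1 = l + i - N.+1)%N; last first.
    by rewrite -{1}(subnK h3) modnDr modn_small //; lia.
  by rewrite subnK // addnK modn_small.
by rewrite mulrC.
Qed.

Lemma value_poly x n a :
  value x n a = horner_alg x (\poly_(i < n) a i).
Proof.
rewrite poly_def rmorph_sum /=; apply: eq_bigr => i _.
by rewrite -mul_polyC rmorphM rmorphXn /= horner_algC horner_algX mulr_algl.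
Qed.

End Value.

Arguments conv {F} N a b _.

Section Transform.

Context (F : fieldType) (E : comAlgType F).
Implicit Types (a b : nat -> F).
Variables (r K R : nat).

Definition rowv (x : E) a y : E := value x R (fun l => a (y * R + l)%N).

(** One pass of the self-sorting radix-r transform on rows of length R, a row
    being an element of a ring where x ^+ R = 1: multiplication by a power of x
    is a rotation of the row. *)
Definition stage h rs m' a : nat -> F := fun p =>
  let l := (p %% R)%N in
  let y := (p %/ R %% K)%N in
  let it := (p %/ R %/ K)%N in
  let e := (y %/ m')%N in
  \sum_(v < r)
     a ((it * K + (e %% rs) * (r * m') + v * m' + y %% m') * R
         + (l + h * (m' * e * v)) %% R)%N.

Fixpoint stages h k s a : nat -> F :=
  if s is s'.+1 then stage h (r ^ s')%N (r ^ (k - s))%N (stages h k s' a) else a.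

Variables (x : E) (g h : nat).
Hypothesis xR : x ^+ R = 1.
Hypothesis gh : x ^+ (g + h) = 1.
Hypothesis R_gt0 : (0 < R)%N.

Lemma stage_row rs m' a it y : (y < K)%N ->
  rowv x (stage h rs m' a) (it * K + y) =
  \sum_(v < r) x ^+ (g * (m' * (y %/ m') * v)) *
     rowv x a (it * K + (y %/ m' %% rs) * (r * m') + v * m' + y %% m').
Proof.
move=> yK; rewrite /rowv /stage.
transitivity (\sum_(v < r) value x R (fun l =>
  a ((it * K + y %/ m' %% rs * (r * m') + v * m' + y %% m') * R +
     (l + h * (m' * (y %/ m') * v)) %% R)%N)).
  rewrite /value exchange_big /=; apply: eq_bigr => l _.
  rewrite scaler_suml; apply: eq_bigr => v _; congr (a _ *: _).
  have K0 : (0 < K)%N by lia.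
  have -> : (((it * K + y) * R + l) %/ R = it * K + y)%N.
    by rewrite divnMDl // divn_small ?addn0 ?ltn_ord.
  have -> : (((it * K + y) * R + l) %% R = l)%N.
    by rewrite modnMDl modn_small ?ltn_ord.
  by rewrite modnMDl [(y %% K)%N]modn_small // divnMDl // [(y %/ K)%N]divn_small ?addn0.
apply: eq_bigr => v _.
rewrite -(@value_rot _ _ _ _ (fun l => a (_ * R + l)%N) g h) //.
Qed.

(** After s passes the s leading digits of a row number, in base r, are those of a
    frequency, and the remaining digits are still those of an input row. *)
Lemma stages_row k s a it e i : (0 < r)%N -> K = (r ^ k)%N -> x ^+ (g * K) = 1 ->
  (s <= k)%N -> (e < r ^ s)%N -> (i < r ^ (k - s))%N ->
  rowv x (stages h k s a) (it * K + e * r ^ (k - s) + i) =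
  \sum_(u < r ^ s) x ^+ (g * (r ^ (k - s) * e * u)) *
     rowv x a (it * K + u * r ^ (k - s) + i).
Proof.
move=> r0 Kk gK; elim: s e i => [|s IH] e i sk es ik.
  rewrite expn0 in es *; rewrite big_ord_recl big_ord0 addr0 /= muln0 muln0 expr0 mul1r.
  by rewrite (_ : e = 0)%N ?mul0n ?addn0 //; lia.
set m' := (r ^ (k - s.+1))%N in ik *; set m := (r ^ (k - s))%N.
have m'0 : (0 < m')%N by rewrite expn_gt0 r0.
have mE : m = (r * m')%N by rewrite /m /m' -expnS; congr (_ ^ _)%N; lia.
have KE : K = (r ^ s * m)%N by rewrite Kk /m -expnD; congr (_ ^ _)%N; lia.
have KE' : K = (r ^ s.+1 * m')%N by rewrite expnS KE mE; lia.
have yK : (e * m' + i < K)%N by rewrite KE'; nia.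
rewrite -addnA /= -/m' stage_row // divnMDl // [(i %/ m')%N]divn_small // addn0.
rewrite modnMDl [(i %% m')%N]modn_small //.
rewrite [in RHS]expnSr (sum_ord_mul _ _ (fun u => x ^+ (g * (m' * e * u)) *
  rowv x a (it * K + u * m' + i))) exchange_big /=; apply: eq_bigr => v _.
have er : (e %% r ^ s < r ^ s)%N by rewrite ltn_mod expn_gt0 r0.
have vi : (v * m' + i < r ^ (k - s))%N.
  by rewrite -/m mE; have := ltn_ord v; nia.
have -> : (it * K + e %% r ^ s * (r * m') + v * m' + i =
           it * K + e %% r ^ s * r ^ (k - s) + (v * m' + i))%N.
  by rewrite -/m mE addnA.
rewrite IH //; last lia.
rewrite big_distrr /=; apply: eq_bigr => u _; rewrite mulrA -exprD -/m.
congr (_ * rowv x a _); last by rewrite mE; lia.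
have gK' : (x ^+ g) ^+ K = 1 by rewrite -exprM.
rewrite -mulnDr !(exprM x g); move: (x ^+ g) gK' => w gK'.
transitivity ((w ^+ K) ^+ (e %/ r ^ s * u) *
   w ^+ (m' * e * v + m * (e %% r ^ s) * u)).
  by rewrite gK' expr1n mul1r.
rewrite -exprM -exprD; congr (_ ^+ _).
rewrite KE mE [in RHS](divn_eq e (r ^ s)) {2}(divn_eq e (r ^ s)). ring.
Qed.

Lemma transform_row k a it e : (0 < r)%N -> K = (r ^ k)%N -> x ^+ (g * K) = 1 ->
  (e < K)%N ->
  rowv x (stages h k k a) (it * K + e) =
  \sum_(u < K) x ^+ (g * (e * u)) * rowv x a (it * K + u).
Proof.
move=> r0 Kk gK eK; have := @stages_row k k a it e 0 r0 Kk gK (leqnn _).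
rewrite subnn expn0 muln1 addn0 -Kk => -> //.
by apply: eq_bigr => u _; rewrite muln1 addn0 mul1n.
Qed.

End Transform.

(** * Roots of unity in quotients of polynomial rings *)

(** Splitting e along its digits in base r factors the geometric sum, and one of the
    factors vanishes. *)
Lemma geom_factor (E : comNzRingType) (r k s : nat) (z : E) : (s < k)%N ->
  \sum_(u < r) z ^+ (r ^ s * u) = 0 -> \sum_(e < r ^ k) z ^+ e = 0.
Proof.
move=> sk h; have -> : (r ^ k = r ^ (k - s.+1) * (r * r ^ s))%N.
  by rewrite -expnS -expnD; congr (_ ^ _)%N; lia.
rewrite sum_ord_mul big1 // => i _.
rewrite (sum_ord_mul _ _ (fun j => z ^+ (i * (r * r ^ s) + j))).
transitivity (z ^+ (i * (r * r ^ s)) *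
   (\sum_(u < r) z ^+ (r ^ s * u)) * \sum_(j < r ^ s) z ^+ j).
  rewrite -mulrA mulr_suml big_distrr /=; apply: eq_bigr => u _.
  rewrite !big_distrr /=; apply: eq_bigr => j _.
  by rewrite -!exprD; congr (_ ^+ _); ring.
by rewrite h mulr0 mul0r.
Qed.

(** Distinct powers of x ^+ (R / K) are orthogonal as soon as x is a root of the
    r-th cyclotomic polynomial in X ^ M; for r = 2, 3 every exponent prime to r
    permutes the terms of that polynomial. *)
Lemma root_sum0 (E : comNzRingType) (r k M g d : nat) (x : E) :
  (r == 2)%N || (r == 3)%N -> x ^+ (r * M) = 1 -> \sum_(u < r) x ^+ (M * u) = 0 ->
  (g * r ^ k = r * M)%N -> ~~ (r ^ k %| d)%N ->
  \sum_(e < r ^ k) x ^+ (g * (e * d)) = 0.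
Proof.
move=> r23 xR x0 gk kd.
have r1 : (1 < r)%N by case/orP: r23 => /eqP ->.
have pr : prime r by case/orP: r23 => /eqP ->.
have d0 : (0 < d)%N by case: d kd => //; rewrite dvdn0.
have ck : (logn r d < k)%N by rewrite ltnNge -pfactor_dvdn.
under eq_bigr => e _ do rewrite mulnCA mulnC exprM.
have sk : (k - (logn r d).+1 < k)%N by lia.
apply: (geom_factor sk).
have [d' cd' dE] := pfactor_coprime pr d0.
have E1 : (r ^ (k - (logn r d).+1) * (g * d) = M * d')%N.
  apply/eqP; rewrite -(eqn_pmul2l (ltnW r1)); apply/eqP.
  rewrite [in RHS]mulnA -gk [X in (g * r ^ X)%N](_ : _ = (k - (logn r d).+1) + (logn r d).+1)%N; last by lia.
  by rewrite {2}dE expnD expnS; ring.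
under eq_bigr => u _ do rewrite -exprM mulnC -mulnA mulnCA E1 mulnC -mulnA exprM.
have y3 : (x ^+ M) ^+ r = 1 by rewrite -exprM mulnC.
have {x0} : \sum_(u < r) (x ^+ M) ^+ u = 0.
  by rewrite -[RHS]x0; apply: eq_bigr => u _; rewrite exprM.
move: (x ^+ M) y3 => y y3 y0.
have red u : y ^+ (d' * u) = y ^+ (d' %% r * u).
  by rewrite exprM -(expr_mod d' y3) -exprM.
under eq_bigr => u _ do rewrite red.
have : (d' %% r)%N \in [:: 1; 2]%N.
  have : (d' %% r < r)%N by rewrite ltn_mod; lia.
  have : (d' %% r != 0)%N.
    by move: cd'; rewrite prime_coprime.
  rewrite !inE; case/orP: r23 => /eqP -> ; lia.
rewrite !inE => /orP[/eqP ->|/eqP h].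
  by rewrite -[RHS]y0; apply: eq_bigr => u _; rewrite mul1n.
rewrite h; move: y0 y3; case/orP: r23 => /eqP re.
  by move: h; rewrite re modn2; case: odd.
rewrite re !big_ord_recr !big_ord0 /= => y0 y3; rewrite -[RHS]y0.
rewrite (_ : y ^+ (2 * 2) = y ^+ 3 * y); last by rewrite -exprSr.
by rewrite y3 !expr1 mul1r expr0 add0r; ring.
Qed.

Section Quotient.
Context (F : fieldType).

Lemma in_qpoly_alg (P p : {poly F}) : horner_alg (in_qpoly P 'X) p = in_qpoly P p.
Proof.
elim/poly_ind: p => [|p c IH]; first by rewrite !rmorph0.
rewrite !rmorphD !rmorphM /= IH horner_algX horner_algC; congr (_ + _).
by rewrite -in_qpoly1 -in_qpolyZ alg_polyC.
Qed.

Lemma in_qpoly_eq (P p q : {poly F}) : P \is monic -> (1 < size P)%N ->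
  in_qpoly P p = in_qpoly P q -> exists S, p - q = S * P.
Proof.
move=> Pm Ps h; have : in_qpoly P (p - q) = 0 by rewrite rmorphB /= h subrr.
move/(congr1 val); rewrite /= /mk_monic Pm Ps /= => h0.
exists (Pdiv.CommonRing.rdivp (p - q) P).
by rewrite {1}(Pdiv.RingMonic.rdivp_eq Pm (p - q)) h0 addr0.
Qed.

Lemma in_qpoly_self (P : {poly F}) : P \is monic -> (1 < size P)%N -> in_qpoly P P = 0.
Proof.
move=> Pm Ps; apply/val_inj; rewrite /= /mk_monic Pm Ps /=.
by rewrite Pdiv.RingMonic.rmodpp.
Qed.

End Quotient.

(** * The cyclotomic modulus *)

Section Cyclotomic.
Context (F : fieldType) (r M : nat).
Hypotheses (r_gt1 : (1 < r)%N) (M_gt0 : (0 < M)%N).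

(** For prime r this is the r-th cyclotomic polynomial at X^M. *)
Definition cyclo : {poly F} := \sum_(u < r) 'X^(M * u).

Lemma cycloE : 'X^(r * M) - 1 = ('X^M - 1) * cyclo.
Proof.
rewrite mulnC exprM subrX1; congr (_ * _).
by apply: eq_bigr => u _; rewrite exprM.
Qed.

Lemma cyclo_monic : cyclo \is monic.
Proof.
have XnM n : (0 < n)%N -> 'X^n - 1 \is @monic F.
  by move=> n0; rewrite -[1]/(1%:P) monicXnsubC.
rewrite -(monicMl cyclo (XnM M M_gt0)) -cycloE; apply: XnM.
by rewrite muln_gt0 M_gt0 ltnW.
Qed.

Lemma size_cyclo : size cyclo = (r.-1 * M).+1.
Proof.
have XnS n : (0 < n)%N -> size ('X^n - 1 : {poly F}) = n.+1.
  by move=> n0; rewrite -[1]/(1%:P) size_XnsubC.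
have := XnS (r * M)%N; rewrite cycloE size_monicM ?monic_neq0 ?cyclo_monic //; last first.
  by rewrite -[1]/(1%:P) monicXnsubC.
rewrite XnS // addSn /= => h; have := h ltac:(lia); nia.
Qed.

Let E := {poly %/ cyclo}.
Let x : E := in_qpoly cyclo 'X.

Let size_gt1 : (1 < size cyclo)%N.
Proof. by rewrite size_cyclo; nia. Qed.

Lemma cyclo_root : \sum_(u < r) x ^+ (M * u) = 0.
Proof.
have := in_qpoly_self cyclo_monic size_gt1; rewrite {2}/cyclo rmorph_sum /= => h.
by rewrite -[RHS]h; apply: eq_bigr => u _; rewrite rmorphXn.
Qed.

Lemma cyclo_order : x ^+ (r * M) = 1.
Proof.
apply/eqP; rewrite -subr_eq0 /x -rmorphXn -(rmorph1 (in_qpoly cyclo)) -rmorphB /=.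
by rewrite cycloE rmorphM /= (in_qpoly_self cyclo_monic size_gt1) mulr0.
Qed.

(** The array and C differ by S * cyclo with S of degree below M, where S appears both
    in the first M entries and in the last M entries, without overlap. *)
Lemma cyclo_coef (w : nat -> F) (C : {poly F}) i : (size C <= M)%N ->
  value x (r * M) w = horner_alg x C -> (i < M)%N ->
  w i - w (i + (r * M - M))%N = C`_i.
Proof.
move=> sC; rewrite value_poly !in_qpoly_alg => h iM.
have [S DS] := in_qpoly_eq cyclo_monic size_gt1 h.
have sS : (size S <= M)%N.
  have rM : (r * M = r.-1 * M + M)%N by rewrite -mulSnr; congr (_ * _)%N; lia.
  have [-> | S0] := eqVneq S 0; first by rewrite size_poly0.
  have sD : (size (S * cyclo)%R <= r * M)%N.
    rewrite -DS; apply: leq_trans (size_polyD _ _) _.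
    by rewrite size_polyN geq_max size_poly /= (leq_trans sC) // rM leq_addl.
  move: sD; rewrite size_Mmonic ?cyclo_monic // size_cyclo; lia.
have cS n : (S * cyclo)`_n = \sum_(u < r) if (n < M * u)%N then 0 else S`_(n - M * u).
  by rewrite /cyclo big_distrr coef_sum; apply: eq_bigr => u _; rewrite coefMXn.
have c n : (n < r * M)%N -> w n - C`_n = (S * cyclo)`_n.
  by move=> nR; rewrite -DS coefB coef_poly nR.
have i1 : (i < r * M)%N by nia.
have i2 : (i + (r * M - M) < r * M)%N by nia.
have := c _ i1; have := c _ i2; rewrite [C`_(_ + _)]nth_default ?subr0 => [e2 e1|]; last first.
  by apply: leq_trans sC _; nia.
suff -> : w (i + (r * M - M))%N = w i - C`_i by rewrite opprB addrC subrK.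
rewrite e1 e2 !cS.
have rE : r = r.-1.+1 by lia.
rewrite rE big_ord_recr big_ord_recl /= muln0 subn0 ltn0 ifF; last by nia.
rewrite big1 => [|u _]; last first.
  by case: ifP => // h1; rewrite nth_default //; apply: leq_trans sS _; have := ltn_ord u; nia.
rewrite add0r big1 ?addr0 => [|u _]; last by rewrite ifT // /bump; nia.
by congr (S`_ _); nia.
Qed.

End Cyclotomic.

(** The powers of X below N are independent modulo X^N - 1. *)
Lemma value_inj (F : fieldType) N (a b : nat -> F) : (0 < N)%N ->
  let x := in_qpoly ('X^N - 1) 'X in
  value x N a = value x N b -> forall i, (i < N)%N -> a i = b i.
Proof.
move=> N0; rewrite /= !value_poly !in_qpoly_alg => h i iN.
have Pm : ('X^N - 1 : {poly F}) \is monic by rewrite -[1]/(1%:P) monicXnsubC.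
have Ps : size ('X^N - 1 : {poly F}) = N.+1 by rewrite -[1]/(1%:P) size_XnsubC.
have [|S DS] := in_qpoly_eq Pm _ h; first by rewrite Ps.
have S0 : S = 0.
  apply/eqP/negP => /negP S0.
  have sD : (size (S * ('X^N - 1))%R <= N)%N.
    rewrite -DS; apply: leq_trans (size_polyD _ _) _.
    by rewrite size_polyN geq_max !size_poly.
  move: sD; rewrite size_Mmonic // Ps; have := size_poly_eq0 S.
  by rewrite (negbTE S0); lia.
move: DS; rewrite S0 mul0r => /subr0_eq/(congr1 (fun p : {poly F} => p`_i)).
by rewrite !coef_poly iN.
Qed.

Lemma Xn1_order (F : fieldType) N : (0 < N)%N ->
  (in_qpoly ('X^N - 1) 'X : {poly %/ ('X^N - 1 : {poly F})}) ^+ N = 1.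
Proof.
move=> N0; apply/eqP; rewrite -subr_eq0 -rmorphXn -(rmorph1 (in_qpoly _)) -rmorphB /=.
rewrite in_qpoly_self // -[1]/(1%:P) ?monicXnsubC // size_XnsubC //.
Qed.

(** * One level of the multiplication *)

Section Level.
Context (F : fieldType).
Implicit Types (a b c w : nat -> F).

(** Each block of N = K B entries is cut into K pieces of length B, and each piece is
    padded with zeros to length R. *)
Definition chunk N B K R a : nat -> F := fun p =>
  if (p %% R < B)%N
  then a (p %/ R %/ K * N + p %/ R %% K * B + p %% R)%N else 0.

(** Products of two pieces have length up to 2 B, so the upper half of the cyclically
    preceding piece is added to the lower half of each piece.  The subtraction of the
    entry D = R - M further reduces modulo the cyclotomic polynomial. *)
Definition overlap N B K R D (kinv : F) c : nat -> F := fun p =>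
  let it := (p %/ N)%N in
  let j := (p %% N %/ B)%N in
  let i := (p %% N %% B)%N in
  let j' := ((j + K.-1) %% K)%N in
  kinv * (c ((it * K + j) * R + i)%N - c ((it * K + j) * R + i + D)%N
    + (c ((it * K + j') * R + i + B)%N - c ((it * K + j') * R + i + B + D)%N)).

Context (r nu : nat).
Hypothesis r23 : (r == 2)%N || (r == 3)%N.
Hypothesis r_unit : r%:R != 0 :> F.

(** Length, length of a piece and number of pieces are lN, lB and lK.  The ring has
    x ^ lR = 1 and degree lR - lM, and x ^ lgen has order lK. *)
Definition lbeta : nat := uphalf nu.
Definition lk : nat := nu - lbeta.
Definition lN := (r ^ nu)%N.
Definition lB := (r ^ lbeta)%N.
Definition lK := (r ^ lk)%N.
Definition lR := (r ^ lbeta.+2)%N.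
Definition lM := (r ^ lbeta.+1)%N.
Definition lgen := (r ^ (lbeta.+2 - lk))%N.

Definition forward a : nat -> F :=
  stages r lK lR (lR - lgen) lk lk (chunk lN lB lK lR a).

Definition backward c : nat -> F :=
  overlap lN lB lK lR (lR - lM) (r%:R^-1 ^+ lk) (stages r lK lR lgen lk lk c).

Let r_gt1 : (1 < r)%N. Proof. by case/orP: r23 => /eqP ->. Qed.
Let r_gt0 : (0 < r)%N. Proof. exact: ltnW. Qed.
Let B_gt0 : (0 < lB)%N. Proof. by rewrite expn_gt0 r_gt0. Qed.
Let K_gt0 : (0 < lK)%N. Proof. by rewrite expn_gt0 r_gt0. Qed.
Let M_gt0 : (0 < lM)%N. Proof. by rewrite expn_gt0 r_gt0. Qed.
Let R_gt0 : (0 < lR)%N. Proof. by rewrite expn_gt0 r_gt0. Qed.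
Let k_le : (lk <= lbeta.+2)%N.
Proof. by rewrite /lk /lbeta; have := uphalf_half nu; have := odd_double_half nu; case: odd; lia. Qed.
Let beta_le : (lbeta <= nu)%N.
Proof. by rewrite /lbeta; have := uphalf_half nu; have := odd_double_half nu; case: odd; lia. Qed.
Let NKB : lN = (lK * lB)%N.
Proof. by rewrite /lN /lK /lB -expnD subnK. Qed.
Let RM : lR = (r * lM)%N. Proof. by rewrite /lR expnS. Qed.
Let MB : lM = (r * lB)%N. Proof. by rewrite /lM expnS. Qed.
Let gK : (lgen * r ^ lk = r * lM)%N.
Proof. by rewrite -RM /lgen /lR -expnD subnK. Qed.
Let g_le : (lgen <= lR)%N.
Proof. by rewrite /lgen /lR leq_pexp2l // leq_subr. Qed.

Definition piece a it j : {poly F} := \poly_(i < lB) a (it * lN + j * lB + i)%N.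

(** Coefficient j of the product of the two sequences of pieces modulo X^K - 1. *)
Definition cpiece a b it j : {poly F} :=
  \sum_(j1 < lK) \sum_(j2 < lK | ((j1 + j2) %% lK == j)%N)
     piece a it j1 * piece b it j2.

Lemma size_cpiece a b it j : (size (cpiece a b it j) <= lB + lB)%N.
Proof.
apply: leq_trans (size_sum _ _ _) _; apply/bigmax_leqP => j1 _.
apply: leq_trans (size_sum _ _ _) _; apply/bigmax_leqP => j2 _.
apply: leq_trans (size_polyMleq _ _) _.
have := size_poly lB (fun i => a (it * lN + j1 * lB + i)%N).
have := size_poly lB (fun i => b (it * lN + j2 * lB + i)%N).
by rewrite -/(piece _ _ _) -/(piece _ _ _); lia.
Qed.

Let E := {poly %/ cyclo F r lM}.
Let x : E := in_qpoly (cyclo F r lM) 'X.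
Let xR : x ^+ lR = 1. Proof. by rewrite RM; apply: cyclo_order. Qed.
Let xgK : x ^+ (lgen * lK) = 1. Proof. by rewrite gK -RM. Qed.

Lemma chunk_row a it y : (y < lK)%N ->
  rowv lR x (chunk lN lB lK lR a) (it * lK + y) = horner_alg x (piece a it y).
Proof.
move=> yK; rewrite -value_poly /rowv /value.
have -> : lR = (lB + (lR - lB))%N by rewrite RM MB; nia.
rewrite big_split_ord /= [X in _ + X]big1 ?addr0 => [|i _]; last first.
  rewrite -(_ : lR = (lB + (lR - lB))%N); last by rewrite RM MB; nia.
  rewrite /chunk modnMDl modn_small; last by have := ltn_ord i; lia.
  by rewrite ifF ?scale0r //; lia.
rewrite -(_ : lR = (lB + (lR - lB))%N); last by rewrite RM MB; nia.
apply: eq_bigr => i _; have iR : (i < lR)%N by have := ltn_ord i; rewrite RM MB; nia.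
rewrite /chunk modnMDl modn_small // ltn_ord divnMDl // [(i %/ lR)%N]divn_small // addn0.
by rewrite divnMDl // modnMDl [(y %% lK)%N]modn_small // [(y %/ lK)%N]divn_small ?addn0.
Qed.

Lemma forward_row a it e : (e < lK)%N ->
  rowv lR x (forward a) (it * lK + e) =
  \sum_(u < lK) x ^+ (lgen * (e * u)) * horner_alg x (piece a it u).
Proof.
move=> eK; rewrite (@transform_row _ _ _ _ _ x lgen) ?subnKC //.
by apply: eq_bigr => u _; rewrite chunk_row.
Qed.

(** Transforming back, the products of the transforms become the cyclic convolution of
    the sequences of pieces, times K, by orthogonality of the powers of x. *)
Lemma backward_row a b it j : (j < lK)%N ->
  rowv lR x (stages r lK lR lgen lk lk (conv lR (forward a) (forward b))) (it * lK + j)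
  = horner_alg x (lK%:R *: cpiece a b it j).
Proof.
move=> jK; have gKR : (lgen * lK = lR)%N by rewrite RM -gK.
have jle : (j <= lK)%N by apply: ltnW.
rewrite (@transform_row _ _ _ _ _ x (lR - lgen)) ?subnK //; last first.
  rewrite (_ : (lR - lgen) * lK = lR * lK.-1)%N; last first.
    by rewrite mulnBl gKR -[lK in LHS](prednK K_gt0) mulnS addKn.
  by rewrite exprM xR expr1n.
rewrite -[X in horner_alg x X]/(lK%:R *: _) scaler_nat rmorphMn /cpiece rmorph_sum /=.
transitivity (\sum_(u < lK) \sum_(j1 < lK) \sum_(j2 < lK)
   (horner_alg x (piece a it j1) * horner_alg x (piece b it j2)) *
     x ^+ (lgen * (u * (j1 + j2 + (lK - j))))).
  apply: eq_bigr => u _.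
  rewrite {1}/rowv (@conv_value _ _ x lR (it * lK + u)) // -!/(rowv _ _ _ _) !forward_row //.
  rewrite big_distrlr big_distrr; apply: eq_bigr => j1 _.
  rewrite big_distrr; apply: eq_bigr => j2 _.
  have -> : x ^+ ((lR - lgen) * (j * u)) = x ^+ (lgen * (u * (lK - j))).
    transitivity (x ^+ (lR * (j * u)) * x ^+ (lgen * (u * (lK - j)))); last first.
      by rewrite exprM xR expr1n mul1r.
    rewrite -[LHS]mulr1 -(expr1n E u) -xR -gKR -exprM -!exprD; congr (_ ^+ _).
    rewrite gKR; nia.
  rewrite !mulnDr !exprD.
  move: (horner_alg x _) (horner_alg x _) (x ^+ (lgen * (u * j1))) (x ^+ (lgen * (u * j2)))
    (x ^+ (lgen * (u * (lK - j)))) => p1 p2 y1 y2 y3 /=; ring.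
rewrite exchange_big -sumrMnl; apply: eq_bigr => j1 _.
rewrite exchange_big rmorph_sum -sumrMnl [RHS]big_mkcond; apply: eq_bigr => j2 _.
rewrite -big_distrr rmorphM /=.
have e1 : ((j1 + j2) %% lK == j)%N = (lK %| j1 + j2 + (lK - j))%N.
  rewrite -{1}(modn_small jK) -(eqn_modDr (lK - j)) [(j + _)%N]addnC subnK // modnn.
  by [].
case: ifP => h.
  have h' : (lK %| j1 + j2 + (lK - j))%N by rewrite -e1.
  rewrite (eq_bigr (fun=> 1)) ?sumr_const ?card_ord ?mulr_natr // => u _.
  case/dvdnP: h' => z ->.
  rewrite (_ : (lgen * (u * (z * lK)) = lgen * lK * (u * z))%N); last by lia.
  by rewrite exprM xgK expr1n.
rewrite (@root_sum0 _ r lk lM) ?mulr0 //.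
- exact: cyclo_root.
- by rewrite -/lK -e1 h.
Qed.

Lemma backward_coef a b it j i : (j < lK)%N -> (i < lM)%N ->
  let c := stages r lK lR lgen lk lk (conv lR (forward a) (forward b)) in
  c ((it * lK + j) * lR + i)%N - c ((it * lK + j) * lR + i + (lR - lM))%N =
  lK%:R * (cpiece a b it j)`_i.
Proof.
move=> jK iM /=; have := @backward_row a b it j jK; rewrite /rowv RM => h.
have := cyclo_coef r_gt1 M_gt0 _ h iM; rewrite coefZ => <- //; first by rewrite addnA.
apply: leq_trans (size_scale_leq _ _) _; apply: leq_trans (size_cpiece _ _ _ _) _.
by rewrite MB; nia.
Qed.

(** One level of the recursion: the transform turns a cyclic convolution of
    length r ^ nu into r ^ (nu - beta) cyclic convolutions of length
    r ^ (beta + 2), beta being half of nu rounded up. *)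
Lemma level_conv a b :
  backward (conv lR (forward a) (forward b)) =1 conv lN a b.
Proof.
move=> p; set c := stages r lK lR lgen lk lk (conv lR (forward a) (forward b)).
have N0 : (0 < lN)%N by rewrite NKB muln_gt0 K_gt0.
pose it := (p %/ lN)%N.
have cp j i : (j < lK)%N -> (i < lM)%N -> r%:R^-1 ^+ lk *
    (c ((it * lK + j) * lR + i)%N - c ((it * lK + j) * lR + i + (lR - lM))%N) =
    (cpiece a b it j)`_i.
  move=> jK iM; rewrite backward_coef // mulrA natrX -exprMn mulVf // expr1n mul1r //.
pose res l := (cpiece a b it (l %/ lB)%N)`_(l %% lB) +
              (cpiece a b it ((l %/ lB + lK.-1) %% lK)%N)`_(l %% lB + lB).
have eqres l : (l < lN)%N -> backward (conv lR (forward a) (forward b)) (it * lN + l) = res l.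
  move=> lN'; rewrite /backward -/c /overlap divnMDl // [(l %/ lN)%N]divn_small // addn0.
  rewrite modnMDl [(l %% lN)%N]modn_small //.
  have h1 : (l %/ lB < lK)%N by rewrite ltn_divLR // -NKB.
  have h2 : (l %% lB < lB)%N by rewrite ltn_mod.
  rewrite mulrDr cp //; last by rewrite MB; nia.
  have := cp ((l %/ lB + lK.-1) %% lK)%N (l %% lB + lB)%N; rewrite !addnA => -> //.
    by rewrite ltn_mod.
  by rewrite MB; nia.
rewrite (divn_eq p lN) -/it; have pN : (p %% lN < lN)%N by rewrite ltn_mod.
have sumN (A : nmodType) (f : nat -> A) :
    \sum_(l < lN) f l = \sum_(j < lK) \sum_(i < lB) f (j * lB + i)%N.
  by rewrite NKB sum_ord_mul.
rewrite eqres //; move: (p %% lN)%N pN; apply: value_inj => //.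
suff key (A : comAlgType F) (y : A) : y ^+ lN = 1 -> value y lN res =
    value y lN (fun l => conv lN a b (it * lN + l)%N) by apply: key; apply: Xn1_order.
move=> yN.
rewrite (conv_value it a b yN).
have chunks f : value y lN (fun l => f (it * lN + l)%N) =
    \sum_(j < lK) y ^+ (j * lB) * horner_alg y (piece f it j).
  rewrite /value (sumN _ (fun l => f (it * lN + l)%N *: y ^+ l)); apply: eq_bigr => j _.
  rewrite -value_poly /value big_distrr; apply: eq_bigr => i _ /=.
  by rewrite -scalerAr -exprD addnA.
rewrite !chunks big_distrlr /= {chunks}.
transitivity (\sum_(j < lK) y ^+ (j * lB) * horner_alg y (cpiece a b it j)).
  have split j : horner_alg y (cpiece a b it j) =
      value y lB (fun i => (cpiece a b it j)`_i) +
      y ^+ lB * value y lB (fun i => (cpiece a b it j)`_(i + lB)).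
    transitivity (value y (lB + lB) (fun i => (cpiece a b it j)`_i)).
      rewrite value_poly; congr (horner_alg y _); apply/polyP => i.
      rewrite coef_poly; case: ltnP => // h; apply: nth_default.
      exact: leq_trans (size_cpiece _ _ _ _) h.
    rewrite /value big_split_ord /= big_distrr /=; congr (_ + _).
    by apply: eq_bigr => i _; rewrite -scalerAr -exprD [(i + _)%N]addnC.
  under [RHS]eq_bigr => j _ do rewrite split mulrDr.
  rewrite [RHS]big_split /= {1}/value (sumN _ (fun l => res l *: y ^+ l)).
  have body j (i : 'I_lB) : ((j * lB + i) %/ lB = j)%N /\ ((j * lB + i) %% lB = i)%N.
    by rewrite divnMDl // divn_small // addn0 modnMDl modn_small.
  transitivity (\sum_(j < lK) (y ^+ (j * lB) * value y lB (fun i => (cpiece a b it j)`_i) +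
     y ^+ (j * lB) * value y lB (fun i => (cpiece a b it ((j + lK.-1) %% lK)%N)`_(i + lB)))).
    apply: eq_bigr => j _; rewrite -mulrDr -big_split /= big_distrr /=.
    apply: eq_bigr => i _; rewrite /res; have [-> ->] := body j i.
    by rewrite -scalerDl -scalerAr -exprD.
  rewrite big_split /=; congr (_ + _).
  rewrite [RHS](sum_ord_shift _ lK.-1 (fun j => y ^+ (j * lB) *
    (y ^+ lB * value y lB (fun i => (cpiece a b it j)`_(i + lB))))).
  apply: eq_bigr => j _; rewrite mulrA; congr (_ * _).
  rewrite -exprD -mulSnr -[LHS](expr_mod _ yN) -[RHS](expr_mod _ yN) NKB -!muln_modl.
  congr (_ ^+ (_ * _)); rewrite -addn1 modnDml -addnA addn1 prednK //.
  by rewrite modnDr.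
transitivity (\sum_(j < lK) \sum_(j1 < lK) \sum_(j2 < lK)
   if ((j1 + j2) %% lK == j)%N then
     y ^+ (j * lB) * horner_alg y (piece a it j1 * piece b it j2) else 0).
  apply: eq_bigr => j _; rewrite /cpiece rmorph_sum big_distrr; apply: eq_bigr => j1 _.
  by rewrite rmorph_sum big_distrr big_mkcond.
rewrite exchange_big /=; apply: eq_bigr => j1 _.
rewrite exchange_big /=; apply: eq_bigr => j2 _.
have jK : ((j1 + j2) %% lK < lK)%N by rewrite ltn_mod.
rewrite (bigD1 (Ordinal jK)) //= eqxx big1 ?addr0 => [|j /negbTE hj]; last first.
  by case: eqP => // h; move/eqP: hj; case; apply/val_inj.
rewrite rmorphM /= mulrACA -exprD -mulnDl; congr (_ * _).
by rewrite -[RHS](expr_mod _ yN) NKB -muln_modl.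
Qed.

End Level.

(** * Programs for one level *)

(** A variable or an array is a table, referred to by its number.  Names in v are word
    variables and names in f field variables; of the arrays, aPow, aStk, aDN and aFD hold
    words and the others field elements. *)
Notation aPow := 6%N (only parsing).
Notation aStk := 7%N (only parsing).
Notation vr := 20%N (only parsing).
Notation vnu := 21%N (only parsing).
Notation vcnt := 22%N (only parsing).
Notation vbeta := 23%N (only parsing).
Notation vk := 24%N (only parsing).
Notation vN := 25%N (only parsing).
Notation vB := 26%N (only parsing).
Notation vK := 27%N (only parsing).
Notation vR := 28%N (only parsing).
Notation vg := 29%N (only parsing).
Notation vh := 30%N (only parsing).
Notation vsz := 31%N (only parsing).
Notation vs := 32%N (only parsing).
Notation vm := 33%N (only parsing).
Notation vrs := 34%N (only parsing).
Notation vp := 35%N (only parsing).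
Notation vl := 36%N (only parsing).
Notation vy := 37%N (only parsing).
Notation vit := 38%N (only parsing).
Notation ve := 39%N (only parsing).
Notation vbase := 40%N (only parsing).
Notation vsh := 41%N (only parsing).
Notation vi := 42%N (only parsing).
Notation vlev := 43%N (only parsing).
Notation vD := 44%N (only parsing).
Notation aA := 5%N (only parsing).
Notation aB := 6%N (only parsing).
Notation aC := 7%N (only parsing).
Notation aT := 8%N (only parsing).
Notation aRI := 9%N (only parsing).
Notation fz := 20%N (only parsing).
Notation fkinv := 21%N (only parsing).
Notation facc := 22%N (only parsing).

Definition wmod (e1 e2 : wexpr) : wexpr := WSub e1 (WMul (WDiv e1 e2) e2).

Definition copy_cmd (t t' : nat) (n : wexpr) : cmd :=
  For vp n (FSet t (X vp) (FGet t' (X vp))).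

Definition stage_term (t v : nat) : fexpr :=
  FGet t (WAdd (WMul (WAdd (X vbase) (WMul (WConst v) (X vm))) (X vR))
               (wmod (WAdd (X vl) (WMul (WConst v) (X vsh))) (X vR))).

Definition stage_cmd (t : nat) : cmd :=
  For vp (X vsz)
   (Seq (wasg vl (wmod (X vp) (X vR)))
   (Seq (wasg vit (WDiv (X vp) (X vR)))
   (Seq (wasg vy (wmod (X vit) (X vK)))
   (Seq (wasg vit (WDiv (X vit) (X vK)))
   (Seq (wasg ve (WDiv (X vy) (X vm)))
   (Seq (wasg vbase (WAdd (WAdd (WMul (X vit) (X vK))
                                (WMul (wmod (X ve) (X vrs)) (WMul (X vr) (X vm))))
                          (wmod (X vy) (X vm))))
   (Seq (wasg vsh (WMul (X vh) (WMul (X vm) (X ve))))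
   (FSet aT (X vp) (FAdd (FAdd (stage_term t 0) (stage_term t 1))
                         (FMul (Z fz) (stage_term t 2)))))))))))
  .

Definition chunk_cmd (t : nat) : cmd :=
  For vp (X vsz)
   (Seq (wasg vl (wmod (X vp) (X vR)))
   (Seq (wasg vit (WDiv (X vp) (X vR)))
   (Seq (wasg vy (wmod (X vit) (X vK)))
   (Seq (wasg vit (WDiv (X vit) (X vK)))
   (If (TLt (X vl) (X vB))
       (FSet aT (X vp) (FGet t (WAdd (WAdd (WMul (X vit) (X vN)) (WMul (X vy) (X vB))) (X vl))))
       (FSet aT (X vp) FZero)))))).

Definition overlap_cmd : cmd :=
  For vp (X vsz)
   (Seq (wasg vit (WDiv (X vp) (X vN)))
   (Seq (wasg vl (wmod (X vp) (X vN)))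
   (Seq (wasg vy (WDiv (X vl) (X vB)))
   (Seq (wasg vl (wmod (X vl) (X vB)))
   (Seq (wasg ve (wmod (WAdd (X vy) (WSub (X vK) (WConst 1))) (X vK)))
   (Seq (wasg vbase (WAdd (WMul (WAdd (WMul (X vit) (X vK)) (X vy)) (X vR)) (X vl)))
   (Seq (wasg vsh (WAdd (WAdd (WMul (WAdd (WMul (X vit) (X vK)) (X ve)) (X vR)) (X vl)) (X vB)))
   (FSet aT (X vp) (FMul (Z fkinv)
      (FAdd (FSub (FGet aC (X vbase)) (FGet aC (WAdd (X vbase) (X vD))))
            (FSub (FGet aC (X vsh)) (FGet aC (WAdd (X vsh) (X vD))))))))))))))
  .

Definition conv_cmd : cmd :=
  For vp (X vsz)
   (Seq (wasg vit (WMul (WDiv (X vp) (X vN)) (X vN)))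
   (Seq (wasg vl (wmod (X vp) (X vN)))
   (Seq (fasg facc FZero)
   (Seq (For vi (X vN) (fasg facc (FAdd (Z facc)
           (FMul (FGet aA (WAdd (X vit) (X vi)))
                 (FGet aB (WAdd (X vit) (wmod (WSub (WAdd (X vl) (X vN)) (X vi)) (X vN))))))))
   (FSet aC (X vp) (Z facc)))))).

Definition fft_cmd (t : nat) : cmd :=
  For vs (X vk)
   (Seq (wasg vm (WGet aPow (WSub (WSub (X vk) (X vs)) (WConst 1))))
   (Seq (wasg vrs (WGet aPow (X vs)))
   (Seq (stage_cmd t)
   (copy_cmd t aT (X vsz))))).

Lemma modn_sub x y : (x - x %/ y * y = x %% y)%N.
Proof. by rewrite {1}(divn_eq x y) addKn. Qed.

Lemma stage_base_lt n rs rm m it e y :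
  (m <= rm)%N -> (it < n)%N -> (e < rs)%N -> (y < m)%N ->
  (it * (rs * rm) + e * rm + y < n * (rs * rm))%N.
Proof.
move=> rmm h1 h2 h3.
have h4 : (it * (rs * rm) + rs * rm <= n * (rs * rm))%N.
  by rewrite addnC -mulSn leq_mul2r h1 orbT.
have h5 : (e * rm + rm <= rs * rm)%N by rewrite addnC -mulSn leq_mul2r h2 orbT.
lia.
Qed.

(* For straight-line code: fr proves frames of explicit updates, frt f composes with
   the frame f, rd E reads a cell, and the others execute one assignment. *)
Ltac fr := repeat first [exact: frame_refl | apply: frame_setw; [by []|] |
  apply: frame_setf; [by []|]].
Ltac frt f := eapply frame_trans;
  [|by apply: (frame_sub _ _ f); rewrite /= ?inE ?eqxx ?orbT].
Ltac rd E := rewrite /setw /setf /upd /= ?modn_sub ?E.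
Ltac wlast E v :=
  apply: (@wp_wasg _ _ _ _ _ _ _ v); [eassumption|eassumption|by []|rd E; try done| |].
Ltac wset E v := apply: wp_seq; wlast E v.
Ltac wput E i v :=
  apply: (@wp_wput _ _ _ _ _ _ _ _ i v);
  [eassumption|eassumption|by []|by []|rd E; try done|rd E; try done| |].
Ltac fput E i v :=
  apply: (@wp_fput _ _ _ _ _ _ _ _ i v);
  [eassumption|eassumption|by []|by []| |rd E; try done| |].
Ltac flast E v :=
  apply: (@wp_fasg _ _ _ _ _ _ _ v); [eassumption|eassumption|by []| |rd E; try done|].
Ltac fset E v := apply: wp_seq; flast E v.

Section MulSpec.
Context (F : fieldType) (W V : nat).
Hypothesis V_ge : (250 <= V)%N.
Hypothesis W_ge : (V ^ wlim <= W)%N.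
Implicit Types (s : store F).
Let wp := @wp F W V.

Lemma copy_spec t t' e n s : wok e -> wfresh [:: vp] e -> wden s e = n -> (n <= V)%N ->
  t != t' -> 
  forall Q, (forall d s', (d <= (wcost e + 30) * n.+1)%N -> frame [:: vp] [:: t] s s' ->
     (forall p, ftab s' t p = if (p < n)%N then ftab s t' p else ftab s t p) -> Q d s') ->
  wp (copy_cmd t t' e) s Q.
Proof.
move=> oke fr en nV tt Q hQ.
apply: (@wp_map F W V V_ge W_ge vp e _ [:: vp] [:: t] t n 8 0 (ftab s t')) => //.
  move=> i s1 ik f1 x1 h1; apply: wp_fset => //=.
  rewrite x1; split=> //; first exact: frame_setf (mem_head _ _) (frame_refl _ _ _).
  move=> p; rewrite /upd eqxx /= add0n; case: eqP => // _.
  by rewrite f1.2 // inE eq_sym.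
move=> d s' hd f' h'; apply: hQ => //; first by apply: leq_trans hd _; nia.
by move=> p; rewrite h' /= add0n subn0.
Qed.

Lemma stage_spec t r K R h rs m n s : t \in [:: 5; 6; 7]%N ->
  wtab s vr 0 = r -> wtab s vK 0 = K -> wtab s vR 0 = R -> wtab s vh 0 = h ->
  wtab s vrs 0 = rs -> wtab s vm 0 = m -> wtab s vsz 0 = (n * K * R)%N ->
  (r == 2)%N && (ftab s fz 0 == 0) || (r == 3)%N && (ftab s fz 0 == 1) ->
  (K = rs * (r * m))%N -> (h <= R)%N -> (n * K * R <= V)%N ->
  forall Q, (forall d s', (d <= 500 * (n * K * R).+1)%N ->
     frame [:: vp; vl; vit; vy; ve; vbase; vsh] [:: aT] s s' ->
     (forall p, (p < n * K * R)%N -> ftab s' aT p = stage r K R h rs m (ftab s t) p) ->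
     Q d s') ->
  wp (stage_cmd t) s Q.
Proof.
move=> tin er eK eR eh ers em esz rz KE hR nV Q hQ.
have t8 : t \notin [:: aT] by move: tin; rewrite !inE => /or3P[] /eqP ->.
apply: (@wp_map F W V V_ge W_ge vp _ _ [:: vp; vl; vit; vy; ve; vbase; vsh] [:: aT] aT
  (n * K * R) 400 0 (stage r K R h rs m (ftab s t))) => //.
  move=> i s1 ik f1 x1 _.
  have R0 : (0 < R)%N by nia.
  have K0 : (0 < K)%N by nia.
  have m0 : (0 < m)%N by nia.
  have E : (wtab s1 vr 0 = r) * (wtab s1 vK 0 = K) * (wtab s1 vR 0 = R) *
     (wtab s1 vh 0 = h) * (wtab s1 vrs 0 = rs) * (wtab s1 vm 0 = m) * (wtab s1 vp 0 = i).
    by rewrite x1 !f1.1.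
  have r0 : (0 < r)%N by case: (r) rz => //=.
  have yK : (i %/ R %% K < K)%N by rewrite ltn_mod.
  have itn : (i %/ R %/ K < n)%N.
    by rewrite !ltn_divLR //; move: ik; rewrite -!mulnA [(R * _)%N]mulnC.
  have n0 : (0 < n)%N by apply: leq_ltn_trans itn.
  have iV : (i <= V)%N by apply: leq_trans (ltnW ik) nV.
  have iRV : (i %/ R <= V)%N by apply: leq_trans (leq_div _ _) iV.
  have yV : (i %/ R %% K <= V)%N by apply: leq_trans (leq_mod _ _) iRV.
  have KRV : (K * R <= V)%N by apply: leq_trans nV; rewrite -mulnA leq_pmull.
  set l := (i %% R)%N; set it := (i %/ R %/ K)%N; set y := (i %/ R %% K)%N.
  wset E l; first by apply: leq_trans (leq_mod _ _) iV.
  wset E (i %/ R)%N => //.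
  wset E y => //.
  wset E it; first by apply: leq_trans (leq_div _ _) iRV.
  wset E (y %/ m)%N; first by apply: leq_trans (leq_div _ _) yV.
  wset E (it * K + (y %/ m) %% rs * (r * m) + y %% m)%N.
    apply: leq_trans nV; apply: leq_trans (leq_pmulr _ R0); apply: ltnW.
    rewrite KE; apply: (@stage_base_lt n rs (r * m) m) => //.
    - by rewrite leq_pmull.
    - by rewrite ltn_mod; case: (rs) KE K0 => // ->.
    - by rewrite ltn_mod.
  wset E (h * (m * (y %/ m)))%N.
    apply: leq_trans KRV; rewrite mulnC leq_mul //.
    by rewrite mulnC; apply: leq_trans (leq_divM _ _) (ltnW yK).
  fput E i (stage r K R h rs m (ftab s t) i).
  - by [].
  - rd E; rewrite (f1.2 fz) // !(f1.2 t) // /stage -/l -/it -/y.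
    have T v : ((it * K + (y %/ m) %% rs * (r * m) + y %% m + v * m) * R +
        (l + v * (h * (m * (y %/ m)))) %% R =
        (it * K + (y %/ m) %% rs * (r * m) + v * m + y %% m) * R +
        (l + h * (m * (y %/ m) * v)) %% R)%N.
      by congr (_ * _ + (_ + _) %% _)%N; lia.
    rewrite !T; case/orP: rz => /andP[/eqP -> /eqP ->].
      by rewrite mul0r addr0 !big_ord_recr big_ord0 /= add0r.
    by rewrite mul1r !big_ord_recr big_ord0 /= add0r.
  - by split; [by [] | fr | rd E | move=> p; rd E; rewrite add0n].
move=> d s' hd fr h'; apply: hQ => //; first by apply: leq_trans hd _; rewrite leq_mul2r orbT.
by move=> p pn; rewrite h' add0n subn0 pn.
Qed.

(** A program determines the entries of the allocated range only, so each array function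
    comes with a statement that it reads nothing outside. *)
Lemma stage_local r K R h rs m n (a b : nat -> F) : (K = rs * (r * m))%N ->
  (forall p, (p < n * K * R)%N -> a p = b p) ->
  forall p, (p < n * K * R)%N -> stage r K R h rs m a p = stage r K R h rs m b p.
Proof.
move=> KE ab p pn; apply: eq_bigr => v _; apply: ab.
have R0 : (0 < R)%N by case: R pn => //; rewrite muln0.
have K0 : (0 < K)%N by case: (K) pn => //; rewrite muln0.
have m0 : (0 < m)%N by case: (m) KE K0 => //; rewrite !muln0 => ->.
have vr' := ltn_ord v; have rs0 : (0 < rs)%N by case: (rs) KE K0 => // ->.
apply: (@leq_trans ((p %/ R %/ K * K + (p %/ R %% K %/ m) %% rs * (r * m) +
   (v * m + p %/ R %% K %% m)).+1 * R)%N).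
  by rewrite -!addnA mulSn addnC ltn_add2r ltn_mod.
rewrite leq_mul2r; apply/orP; right.
have pnK : (p %/ R %/ K < n)%N by rewrite !ltn_divLR // ; move: pn; rewrite -!mulnA [(R * _)%N]mulnC.
have h3 : (v * m + p %/ R %% K %% m < r * m)%N.
  have : ((v * m + m) <= r * m)%N by rewrite addnC -mulSn leq_mul2r vr' orbT.
  by have : (p %/ R %% K %% m < m)%N; [rewrite ltn_mod|lia].
have e4 : (p %/ R %% K %/ m %% rs < rs)%N by rewrite ltn_mod.
by have := stage_base_lt (leqnn _) pnK e4 h3; rewrite -KE.
Qed.

Lemma fft_spec t r k K R h n s : t \in [:: 5; 6; 7]%N ->
  wtab s vr 0 = r -> wtab s vK 0 = K -> wtab s vR 0 = R -> wtab s vh 0 = h ->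
  wtab s vk 0 = k -> wtab s vsz 0 = (n * K * R)%N ->
  (forall e, (e <= k)%N -> wtab s aPow e = (r ^ e)%N) ->
  (r == 2)%N && (ftab s fz 0 == 0) || (r == 3)%N && (ftab s fz 0 == 1) ->
  (K = r ^ k)%N -> (h <= R)%N -> (n * K * R <= V)%N -> (K <= V)%N -> (k <= V)%N ->
  forall Q, (forall d s', (d <= 700 * (n * K * R).+1 * k.+1)%N ->
     frame [:: vs; vm; vrs; vp; vl; vit; vy; ve; vbase; vsh] [:: aT; t] s s' ->
     (forall p, (p < n * K * R)%N -> ftab s' t p = stages r K R h k k (ftab s t) p) ->
     Q d s') ->
  wp (fft_cmd t) s Q.
Proof.
move=> tin er eK eR eh ek esz pw rz Kk hR nV KV kV Q hQ.
have r0 : (0 < r)%N by case: (r) rz => //=.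
have t8 : t != aT by move: tin; rewrite !inE => /or3P[] /eqP ->.
have t20 : fz \notin [:: aT; t] by move: tin; rewrite !inE => /or3P[] /eqP ->.
pose P i s1 := forall p, (p < n * K * R)%N -> ftab s1 t p = stages r K R h k i (ftab s t) p.
apply: (@wp_for F W V V_ge W_ge vs _ _ [:: vs; vm; vrs; vp; vl; vit; vy; ve; vbase; vsh]
   [:: aT; t] k (fun=> (550 * (n * K * R).+1)%N) P) => //.
  move=> i s1 ik f1 x1 P1.
  have E : (wtab s1 vr 0 = r) * (wtab s1 vK 0 = K) * (wtab s1 vR 0 = R) *
     (wtab s1 vh 0 = h) * (wtab s1 vsz 0 = n * K * R)%N * (wtab s1 vs 0 = i) *
     (wtab s1 vk 0 = k) * (ftab s1 fz 0 = ftab s fz 0).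
    by rewrite x1 !f1.1 // f1.2.
  have pw1 e : (e <= k)%N -> wtab s1 aPow e = (r ^ e)%N by move=> h1; rewrite f1.1 // pw.
  have mE : K = (r ^ i * (r * r ^ (k - i.+1)))%N.
    by rewrite Kk -expnS -expnD; congr (_ ^ _)%N; lia.
  have pV e : (e <= k)%N -> (r ^ e <= V)%N.
    by move=> h1; apply: leq_trans KV; rewrite Kk; case/orP: rz => /andP[/eqP -> _]; rewrite leq_pexp2l.
  have E' := (E, pw1 i (ltnW ik)).
  wset E' (r ^ (k - i.+1))%N; first by rewrite subn1 -subnS pw1 // leq_subr.
    by apply: pV; rewrite leq_subr.
  wset E' (r ^ i)%N; first by apply: pV; lia.
  apply: wp_seq; apply: (@stage_spec t r K R h (r ^ i) (r ^ (k - i.+1)) n) => //; try by rd E.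
  move=> d2 s2 hd2 f2 h2.
  apply: (@copy_spec t aT (X vsz) (n * K * R)%N) => //=.
    by rewrite (f2.1 vsz) //; rd E.
  move=> d3 s3 hd3 f3 h3.
  split.
  - by move: hd2 hd3; rewrite /=; lia.
  - by frt f3; frt f2; fr.
  - by rewrite (f3.1 vs) // (f2.1 vs) //; rd E'.
  - move=> p pn; rewrite h3 pn h2 //=; exact: stage_local P1 _ pn.
move=> d s' hd fr h'; apply: hQ => //; apply: leq_trans hd _.
rewrite sum_nat_const card_ord /=; nia.
Qed.

Lemma chunk_spec t N B K R n s : t \in [:: 5; 6; 7]%N ->
  wtab s vN 0 = N -> wtab s vB 0 = B -> wtab s vK 0 = K -> wtab s vR 0 = R ->
  wtab s vsz 0 = (n * K * R)%N -> (n * K * R <= V)%N ->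
  forall Q, (forall d s', (d <= 200 * (n * K * R).+1)%N ->
     frame [:: vp; vl; vit; vy] [:: aT] s s' ->
     (forall p, (p < n * K * R)%N -> ftab s' aT p = chunk N B K R (ftab s t) p) ->
     Q d s') ->
  wp (chunk_cmd t) s Q.
Proof.
move=> tin eN eB eK eR esz nV Q hQ.
have t8 : t \notin [:: aT] by move: tin; rewrite !inE => /or3P[] /eqP ->.
apply: (@wp_map F W V V_ge W_ge vp _ _ [:: vp; vl; vit; vy] [:: aT] aT
  (n * K * R) 150 0 (chunk N B K R (ftab s t))) => //.
  move=> i s1 ik f1 x1 _.
  have E : (wtab s1 vN 0 = N) * (wtab s1 vB 0 = B) * (wtab s1 vK 0 = K) *
     (wtab s1 vR 0 = R) * (wtab s1 vp 0 = i) * (forall p, ftab s1 t p = ftab s t p).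
    by rewrite x1 !f1.1 //; split=> // p; rewrite f1.2.
  have iV : (i <= V)%N by apply: leq_trans (ltnW ik) nV.
  have iRV : (i %/ R <= V)%N by apply: leq_trans (leq_div _ _) iV.
  wset E (i %% R)%N; first by apply: leq_trans (leq_mod _ _) iV.
  wset E (i %/ R)%N => //.
  wset E (i %/ R %% K)%N; first by apply: leq_trans (leq_mod _ _) iRV.
  wset E (i %/ R %/ K)%N; first by apply: leq_trans (leq_div _ _) iRV.
  apply: (wp_if V_ge W_ge) => //.
  have -> : tden (setw (setw (setw (setw s1 vl 0 (i %% R)) vit 0 (i %/ R)) vy 0
      (i %/ R %% K)) vit 0 (i %/ R %/ K)) (TLt (X vl) (X vB)) = (i %% R < B)%N.
    by rd E.
  case: ifP => lB.
    fput E i (chunk N B K R (ftab s t) i) => //; first by rd E; rewrite /chunk lB.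
    by split; [by [] | fr | rd E | move=> p; rd E; rewrite add0n].
  fput E i (chunk N B K R (ftab s t) i) => //; first by rd E; rewrite /chunk lB.
  by split; [by [] | fr | rd E | move=> p; rd E; rewrite add0n].
move=> d s' hd fr' h'; apply: hQ => //; first by apply: leq_trans hd _; rewrite leq_mul2r orbT.
by move=> p pn; rewrite h' add0n subn0 pn.
Qed.

Lemma overlap_spec N B K R D n s :
  wtab s vN 0 = N -> wtab s vB 0 = B -> wtab s vK 0 = K -> wtab s vR 0 = R ->
  wtab s vD 0 = D -> wtab s vsz 0 = (n * N)%N ->
  N = (K * B)%N -> (B + B <= R)%N -> (n * K * R <= V)%N -> (K + K <= V)%N ->
  forall Q, (forall d s', (d <= 400 * (n * N).+1)%N ->
     frame [:: vp; vl; vit; vy; ve; vbase; vsh] [:: aT] s s' ->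
     (forall p, (p < n * N)%N ->
        ftab s' aT p = overlap N B K R D (ftab s fkinv 0) (ftab s aC) p) ->
     Q d s') ->
  wp overlap_cmd s Q.
Proof.
move=> eN eB eK eR eD esz NE BR nV KV Q hQ.
have NV : (n * N <= V)%N.
  apply: leq_trans nV; rewrite NE mulnA leq_mul2l; apply/orP; right; lia.
apply: (@wp_map F W V V_ge W_ge vp _ _ [:: vp; vl; vit; vy; ve; vbase; vsh] [:: aT] aT
  (n * N) 300 0 (overlap N B K R D (ftab s fkinv 0) (ftab s aC))) => //.
  move=> i s1 ik f1 x1 _.
  have E : (wtab s1 vN 0 = N) * (wtab s1 vB 0 = B) * (wtab s1 vK 0 = K) *
     (wtab s1 vR 0 = R) * (wtab s1 vp 0 = i) * (wtab s1 vD 0 = D) *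
     (ftab s1 fkinv 0 = ftab s fkinv 0) * (forall p, ftab s1 aC p = ftab s aC p).
    by rewrite x1 !f1.1 // f1.2 //; split=> // p; rewrite f1.2.
  have N0 : (0 < N)%N by case: (N) ik => //; rewrite muln0.
  have K0 : (0 < K)%N by case: (K) NE N0 => // ->.
  have B0 : (0 < B)%N by case: (B) NE N0 => //; rewrite muln0 => ->.
  have iV : (i <= V)%N by apply: leq_trans (ltnW ik) NV.
  have bnd it j l : (it < n)%N -> (j < K)%N -> (l < R)%N -> ((it * K + j) * R + l <= V)%N.
    move=> h1 h2 h3; apply: leq_trans nV; apply: ltnW.
    apply: (@leq_trans ((it * K + j).+1 * R)%N); first by rewrite mulSn addnC ltn_add2r.
    rewrite leq_mul2r; apply/orP; right.
    apply: (@leq_trans (it.+1 * K)%N); first by rewrite mulSn -addnS addnC leq_add2r.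
    by rewrite leq_mul2r h1 orbT.
  set it := (i %/ N)%N; set l := (i %% N)%N.
  have itn : (it < n)%N by rewrite ltn_divLR.
  have jK : (l %/ B < K)%N by rewrite ltn_divLR // -NE ltn_mod.
  have lB : (l %% B < B)%N by rewrite ltn_mod.
  have lN : (l < N)%N by rewrite ltn_mod.
  have lV : (l <= V)%N by apply: leq_trans (leq_mod _ _) iV.
  have jK' : ((l %/ B + K.-1) %% K < K)%N by rewrite ltn_mod.
  wset E it; first by apply: leq_trans (leq_div _ _) iV.
  wset E l => //.
  wset E (l %/ B)%N; first by apply: leq_trans (leq_div _ _) lV.
  wset E (l %% B)%N; first by apply: leq_trans (leq_mod _ _) lV.
  wset E ((l %/ B + K.-1) %% K)%N; [by rewrite subn1|by apply: leq_trans (ltnW jK') _; lia|].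
  wset E ((it * K + l %/ B) * R + l %% B)%N; first by apply: bnd => //; lia.
  wset E ((it * K + (l %/ B + K.-1) %% K) * R + l %% B + B)%N.
    by rewrite -addnA; apply: bnd => //; lia.
  fput E i (overlap N B K R D (ftab s fkinv 0) (ftab s aC) i).
  - by [].
  - by rd E.
  - by split; [by [] | fr | rd E | move=> p; rd E; rewrite add0n].
move=> d s' hd fr' h'; apply: hQ => //; first by apply: leq_trans hd _; rewrite leq_mul2r orbT.
by move=> p pn; rewrite h' add0n subn0 pn.
Qed.

Lemma conv_spec N n s :
  wtab s vN 0 = N -> wtab s vsz 0 = (n * N)%N -> (n * N <= V)%N -> (N + N <= V)%N ->
  forall Q, (forall d s', (d <= 500 * (n * N).+1 * N.+1)%N ->
     frame [:: vp; vl; vit; vi] [:: aC; facc] s s' ->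
     (forall p, (p < n * N)%N ->
        ftab s' aC p = conv N (ftab s aA) (ftab s aB) p) ->
     Q d s') ->
  wp conv_cmd s Q.
Proof.
move=> eN esz nV NV Q hQ.
apply: (@wp_map F W V V_ge W_ge vp _ _ [:: vp; vl; vit; vi] [:: aC; facc] aC
  (n * N) (400 * N.+1) 0 (conv N (ftab s aA) (ftab s aB))) => //.
  move=> i s1 ik f1 x1 _.
  have E : (wtab s1 vN 0 = N) * (wtab s1 vp 0 = i) *
      (forall p, ftab s1 aA p = ftab s aA p) * (forall p, ftab s1 aB p = ftab s aB p).
    by rewrite x1 !f1.1 //; split; [split|] => // p; rewrite f1.2.
  have N0 : (0 < N)%N by case: (N) ik => //; rewrite muln0.
  have iV : (i <= V)%N by apply: leq_trans (ltnW ik) nV.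
  wset E (i %/ N * N)%N; first by apply: leq_trans (leq_divM _ _) iV.
  wset E (i %% N)%N; first by apply: leq_trans (leq_mod _ _) iV.
  apply: wp_seq; apply: (@wp_fasg F W V V_ge W_ge _ _ 0) => //.
  apply: wp_seq.
  set s2 := setf _ _ _ _.
  have E2 : (wtab s2 vN 0 = N) * (wtab s2 vp 0 = i) * (wtab s2 vit 0 = i %/ N * N)%N *
      (wtab s2 vl 0 = i %% N)%N *
      (forall p, ftab s2 aA p = ftab s aA p) * (forall p, ftab s2 aB p = ftab s aB p).
    by rewrite /s2; rd E; do ![split] => // p; rewrite E.
  have f2 : frame [:: vit; vl] [:: facc] s1 s2 by rewrite /s2; fr.
  have a2 : ftab s2 facc 0 = 0 by rewrite /s2; rd E.
  clearbody s2.
  pose P j s3 := ftab s3 facc 0 = \sum_(z < j) ftab s aA (i %/ N * N + z)%N *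
      ftab s aB (i %/ N * N + (i %% N + N - z) %% N)%N.
  apply: (@wp_for F W V V_ge W_ge vi (X vN) _ [:: vi] [:: facc] N (fun=> 100%N) P).
  - by [].
  - by [].
  - by [].
  - by rewrite /= E2.
  - by lia.
  - by [].
  - by rewrite /P big_ord0.
  - move=> j s3 jN f3 x3 P3.
    have E3 : (wtab s3 vN 0 = N) * (wtab s3 vi 0 = j) * (wtab s3 vit 0 = i %/ N * N)%N *
      (wtab s3 vl 0 = i %% N)%N *
      (forall p, ftab s3 aA p = ftab s aA p) * (forall p, ftab s3 aB p = ftab s aB p).
      rewrite x3 !f3.1 // !E2; do ![split] => // p; rewrite f3.2 // E2 //.
    apply: (@wp_fasg F W V V_ge W_ge _ _ (\sum_(z < j.+1) ftab s aA (i %/ N * N + z)%N *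
      ftab s aB (i %/ N * N + (i %% N + N - z) %% N)%N)) => //.
      by rd E3; rewrite big_ord_recr /= P3.
    by split; [by []|fr|rd E3|].
  - move=> d3 s3 hd3 f3 P3.
    have E3 : (wtab s3 vp 0 = i) by rewrite f3.1 // E2.
    fput E3 i (conv N (ftab s aA) (ftab s aB) i).
    + by [].
    + by rd E3; rewrite P3.
    + split.
      * by move: hd3; rewrite sum_nat_const card_ord /=; lia.
      * by apply: frame_setf => //; frt f3; frt f2; fr.
      * by rd E3.
      * move=> p; rd E3; rewrite add0n; case: eqP => // _.
        by rewrite f3.2 // f2.2.
move=> d s' hd fr' h'; apply: hQ => //; first by apply: leq_trans hd _; rewrite /=; nia.
by move=> p pn; rewrite h' add0n subn0 pn.
Qed.

End MulSpec.

(** * All levels *)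

(** The exponent of the length one level down. *)
Definition nnext (nu : nat) : nat := (uphalf nu).+2.

Lemma nnextE nu : (nnext nu - 5 = (nu - 5)./2)%N.
Proof.
rewrite /nnext uphalf_half; have := odd_double_half nu; case: odd => /=.
  by move=> h; rewrite -{2}h; lia.
by move=> h; rewrite -{2}h; lia.
Qed.

Definition nus (nu i : nat) : nat := iter i nnext nu.

Lemma nusE nu i : (nus nu i - 5 = (nu - 5) %/ 2 ^ i)%N.
Proof.
elim: i => [|i IH]; first by rewrite divn1.
by rewrite /nus iterS nnextE -/(nus nu i) IH expnSr divnMA divn2.
Qed.

(** The exponent above 5 is halved at each level, and 5 is where the recursion stops,
    nnext 5 being 5. *)
Definition depth (nu : nat) : nat :=
  if (nu <= 5)%N then 0%N else (trunc_log 2 (nu - 5)).+1.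

Lemma depthP nu i : (5 < nus nu i)%N = (i < depth nu)%N.
Proof.
have -> : (5 < nus nu i)%N = (0 < nus nu i - 5)%N by lia.
rewrite nusE divn_gt0 ?expn_gt0 // /depth; case: (leqP nu 5) => h.
  have -> : (nu - 5 = 0)%N by lia.
  by rewrite leqn0 expn_eq0.
rewrite ltnS; apply/idP/idP => h1; first by apply: trunc_log_max.
apply: (@leq_trans (2 ^ trunc_log 2 (nu - 5))); first by rewrite leq_exp2l.
by apply: trunc_logP => //; lia.
Qed.

Lemma nus_ge5 nu i : (5 <= nu)%N -> (5 <= nus nu i)%N.
Proof.
move=> h; elim: i => [//|i IH]; rewrite /nus iterS -/(nus nu i) /nnext.
by have := odd_double_half (nus nu i); rewrite uphalf_half; case: odd => /=; lia.
Qed.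

Lemma nnext_le nu : (5 <= nu)%N -> (nnext nu <= nu)%N.
Proof.
by move=> h; have := odd_double_half nu; rewrite /nnext uphalf_half; case: odd => /=; lia.
Qed.

Lemma nus_le nu i : (5 <= nu)%N -> (nus nu i <= nu)%N.
Proof.
move=> h; elim: i => [//|i IH]; rewrite /nus iterS -/(nus nu i).
by apply: leq_trans (nnext_le (nus_ge5 _ h)) IH.
Qed.

Lemma depth_le nu : (depth nu <= nu)%N.
Proof.
rewrite /depth; case: (leqP nu 5) => // h.
have : (trunc_log 2 (nu - 5) < nu - 5)%N.
  by apply: leq_trans (ltn_expl _ (isT : 1 < 2)%N) (trunc_logP _ _) => //; lia.
lia.
Qed.

(** The sizes grow by a factor of at most 16 ^ depth, that is polynomially in nu. *)
Lemma depth_bound r nu : (r <= 3)%N -> (0 < nu)%N ->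
  (r ^ (nu + 2 * depth nu) <= r ^ nu * (16 * nu ^ 4))%N.
Proof.
move=> r3 nu0; rewrite expnD leq_mul2l; apply/orP; right.
apply: (@leq_trans (16 ^ depth nu)%N).
  rewrite expnM; case: (depth nu) => // d.
  by rewrite leq_exp2r // -mulnn (leq_trans (leq_mul r3 r3)).
rewrite /depth; case: (leqP nu 5) => h; first by rewrite expn0 muln_gt0 expn_gt0 nu0.
rewrite expnS leq_mul2l /= -[16%N]/(2 ^ 4)%N -expnM mulnC expnM leq_exp2r //.
by apply: leq_trans (trunc_logP _ _) _ => //; lia.
Qed.

Lemma lbeta_facts nu : (5 <= nu)%N ->
  [/\ (lbeta nu + lk nu = nu)%N, (lk nu <= lbeta nu)%N & ((lbeta nu).+2 <= nu)%N].
Proof.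
move=> h; rewrite /lk /lbeta uphalf_half; have := odd_double_half nu.
by case: odd => /= e; split; lia.
Qed.

Lemma chunk_local (F : fieldType) N B K R n (a b : nat -> F) : (N = K * B)%N ->
  (forall p, (p < n * N)%N -> a p = b p) ->
  forall p, (p < n * K * R)%N -> chunk N B K R a p = chunk N B K R b p.
Proof.
move=> NE ab p pn; rewrite /chunk; case: ifP => // lB; apply: ab.
have R0 : (0 < R)%N by case: (R) pn => //; rewrite muln0.
have K0 : (0 < K)%N by case: (K) pn => //; rewrite muln0.
have h1 : (p %/ R %/ K < n)%N by rewrite !ltn_divLR //; move: pn; rewrite -!mulnA [(R * _)%N]mulnC.
have h2 : (p %/ R %% K < K)%N by rewrite ltn_mod.
have h3 : ((p %/ R %% K).+1 * B <= N)%N by rewrite NE leq_mul2r h2 orbT.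
have h4 : ((p %/ R %/ K).+1 * N <= n * N)%N by rewrite leq_mul2r h1 orbT.
move: h3 h4 lB; rewrite !mulSn; lia.
Qed.

Lemma overlap_local (F : fieldType) N B K R D (kinv : F) n (a b : nat -> F) : (N = K * B)%N -> (B + B + D <= R)%N ->
  (forall p, (p < n * K * R)%N -> a p = b p) ->
  forall p, (p < n * N)%N -> overlap N B K R D kinv a p = overlap N B K R D kinv b p.
Proof.
move=> NE BR ab p pn; rewrite /overlap.
have N0 : (0 < N)%N by case: (N) pn => //; rewrite muln0.
have K0 : (0 < K)%N by case: (K) NE N0 => // ->.
have B0 : (0 < B)%N by case: (B) NE N0 => //; rewrite muln0 => ->.
have h1 : (p %/ N < n)%N by rewrite ltn_divLR.
have h2 : (p %% N %/ B < K)%N by rewrite ltn_divLR // -NE ltn_mod.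
have h3 : ((p %% N %/ B + K.-1) %% K < K)%N by rewrite ltn_mod.
have h4 : (p %% N %% B < B)%N by rewrite ltn_mod.
have loc it j l : (it < n)%N -> (j < K)%N -> (l < R)%N ->
    a ((it * K + j) * R + l)%N = b ((it * K + j) * R + l)%N.
  move=> g1 g2 g3; apply: ab.
  have g4 : ((it * K + j).+1 * R <= n * K * R)%N.
    rewrite leq_mul2r; apply/orP; right.
    have : (it.+1 * K <= n * K)%N by rewrite leq_mul2r g1 orbT.
    by rewrite mulSn; lia.
  by move: g4; rewrite mulSn; lia.
by rewrite -!addnA !loc //; lia.
Qed.

Lemma conv_local (F : fieldType) N n (a b a' b' : nat -> F) : 
  (forall p, (p < n * N)%N -> a p = a' p) -> (forall p, (p < n * N)%N -> b p = b' p) ->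
  forall p, (p < n * N)%N -> conv N a b p = conv N a' b' p.
Proof.
move=> aa bb p pn; have N0 : (0 < N)%N by case: (N) pn => //; rewrite muln0.
have h1 : (p %/ N < n)%N by rewrite ltn_divLR.
have h4 : ((p %/ N).+1 * N <= n * N)%N by rewrite leq_mul2r h1 orbT.
apply: eq_bigr => i _; rewrite aa ?bb //.
  have : ((p %% N + N - i) %% N < N)%N by rewrite ltn_mod.
  by move: h4; rewrite mulSn; lia.
by move: h4; rewrite mulSn; have := ltn_ord i; lia.
Qed.

Section Levels.
Context (F : fieldType) (r : nat).
Hypothesis r23 : (r == 2)%N || (r == 3)%N.
Implicit Types (a b : nat -> F).

(** The number of products at level i. *)
Fixpoint cnts (nu i : nat) : nat :=
  if i is j.+1 then (cnts nu j * lK r (nus nu j))%N else 1%N.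

Fixpoint fwds (nu i : nat) a : nat -> F :=
  if i is j.+1 then forward r (nus nu j) (fwds nu j a) else a.

Lemma lKR nu : (lK r nu * lR r nu = r ^ nu.+2)%N.
Proof.
rewrite /lK /lR -expnD; congr (_ ^ _)%N; rewrite /lk /lbeta uphalf_half.
by have := odd_double_half nu; case: odd => /=; lia.
Qed.

(** Each level multiplies the total size by r ^ 2, as a piece of length r ^ beta becomes a
    row of length r ^ (beta + 2). *)
Lemma cnts_size nu i : (cnts nu i * r ^ nus nu i = r ^ (nu + 2 * i))%N.
Proof.
elim: i => [|i IH]; first by rewrite mul1n muln0 addn0.
rewrite -[cnts nu i.+1]/(cnts nu i * lK r (nus nu i))%N -mulnA.
rewrite -[(r ^ nus nu i.+1)%N]/(lR r (nus nu i)) lKR.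
rewrite -addn2 expnD mulnA IH -expnD; congr (_ ^ _)%N; lia.
Qed.

Lemma cnts_ring nu i : (cnts nu i * lK r (nus nu i) * lR r (nus nu i) = r ^ (nu + 2 * i.+1))%N.
Proof. by rewrite -cnts_size. Qed.

Let r_gt0 : (0 < r)%N. Proof. by case/orP: r23 => /eqP ->. Qed.

Lemma stages_local k K R h n a b s : (K = r ^ k)%N -> (s <= k)%N ->
  (forall p, (p < n * K * R)%N -> a p = b p) ->
  forall p, (p < n * K * R)%N -> stages r K R h k s a p = stages r K R h k s b p.
Proof.
move=> KE; elim: s => [|s IH] // sk ab.
have KE' : K = (r ^ s * (r * r ^ (k - s.+1)))%N.
  by rewrite KE -expnS -expnD; congr (_ ^ _)%N; lia.
exact: stage_local KE' (IH (ltnW sk) ab).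
Qed.

Lemma forward_local nu n a b : (5 <= nu)%N ->
  (forall p, (p < n * r ^ nu)%N -> a p = b p) ->
  forall p, (p < n * lK r nu * lR r nu)%N -> forward r nu a p = forward r nu b p.
Proof.
move=> nu5 ab; apply: stages_local => //; apply: chunk_local ab.
by rewrite /lN /lK /lB -expnD; have [e _ _] := lbeta_facts nu5; rewrite addnC e.
Qed.

Lemma fwds_conv nu i a b : r%:R != 0 :> F ->
  backward r (nus nu i) (conv (r ^ nus nu i.+1) (fwds nu i.+1 a) (fwds nu i.+1 b))
  =1 conv (r ^ nus nu i) (fwds nu i a) (fwds nu i b).
Proof. by move=> ru; apply: level_conv. Qed.

End Levels.

(** * The multiplication program *)

Definition params_cmd : cmd :=
  Seq (wasg vbeta (WDiv (WAdd (X vnu) (WConst 1)) (WConst 2)))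
 (Seq (wasg vk (WSub (X vnu) (X vbeta)))
 (Seq (wasg vN (WGet aPow (X vnu)))
 (Seq (wasg vB (WGet aPow (X vbeta)))
 (Seq (wasg vK (WGet aPow (X vk)))
 (Seq (wasg vR (WGet aPow (WAdd (X vbeta) (WConst 2))))
      (wasg vg (WGet aPow (WSub (WAdd (X vbeta) (WConst 2)) (X vk))))))))).

Definition forward_cmd (t : nat) : cmd :=
  Seq (chunk_cmd t) (Seq (copy_cmd t aT (X vsz)) (fft_cmd t)).

(** The transforms of one level.  The exponent is pushed on a stack for the way back. *)
Definition down_cmd : cmd :=
  Seq params_cmd
 (Seq (wasg vsz (WMul (WMul (X vcnt) (X vK)) (X vR)))
 (Seq (wasg vh (WSub (X vR) (X vg)))
 (Seq (forward_cmd aA)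
 (Seq (forward_cmd aB)
 (Seq (WSet aStk (X vlev) (X vnu))
 (Seq (wasg vlev (WAdd (X vlev) (WConst 1)))
 (Seq (wasg vcnt (WMul (X vcnt) (X vK)))
      (wasg vnu (WAdd (X vbeta) (WConst 2)))))))))).

Definition up_cmd : cmd :=
  Seq (wasg vlev (WSub (X vlev) (WConst 1)))
 (Seq (wasg vnu (WGet aStk (X vlev)))
 (Seq params_cmd
 (Seq (wasg vsz (WMul (X vcnt) (X vR)))
 (Seq (wasg vh (X vg))
 (Seq (fft_cmd aC)
 (Seq (wasg vD (WSub (X vR) (WGet aPow (WAdd (X vbeta) (WConst 1)))))
 (Seq (fasg fkinv (FGet aRI (X vk)))
 (Seq (wasg vcnt (WDiv (X vcnt) (X vK)))
 (Seq (wasg vsz (WMul (X vcnt) (X vN)))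
 (Seq overlap_cmd
      (copy_cmd aC aT (X vsz)))))))))))).

Definition cyc_cmd : cmd :=
  Seq (wasg vcnt (WConst 1))
 (Seq (wasg vlev (WConst 0))
 (Seq (While (TLt (WConst 5) (X vnu)) down_cmd)
 (Seq (wasg vN (WGet aPow (X vnu)))
 (Seq (wasg vsz (WMul (X vcnt) (X vN)))
 (Seq conv_cmd
      (While (TLt (WConst 0) (X vlev)) up_cmd)))))).

Notation wsC := [:: vnu; vcnt; vbeta; vk; vN; vB; vK; vR; vg; vh; vsz; vs; vm; vrs;
  vp; vl; vy; vit; ve; vbase; vsh; vi; vlev; vD; aStk] (only parsing).
Notation fsC := [:: aA; aB; aC; aT; fkinv; facc] (only parsing).

Section CycSpec.
Context (F : fieldType) (W V : nat).
Hypothesis V_ge : (250 <= V)%N.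
Hypothesis W_ge : (V ^ wlim <= W)%N.
Implicit Types (s : store F).
Let wp := @wp F W V.
Context (r nu0 : nat).
Hypothesis r23 : (r == 2)%N || (r == 3)%N.
Hypothesis nu0_ge : (5 <= nu0)%N.
Let S := (r ^ (nu0 + 2 * depth nu0))%N.
Hypothesis S_le : (S + S <= V)%N.
Hypothesis r_unit : r%:R != 0 :> F.

Let r_gt1 : (1 < r)%N. Proof. by case/orP: r23 => /eqP ->. Qed.
Let powV e : (e <= nu0)%N -> (r ^ e <= V)%N.
Proof.
by move=> h; apply: leq_trans S_le; rewrite -[(r ^ e)%N]addn0 leq_add // leq_exp2l //; lia.
Qed.
Let nu0V : (nu0 <= V)%N.
Proof. by apply: leq_trans (powV (leqnn _)); apply: ltnW; apply: ltn_expl. Qed.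

(** What the fast multiplication reads besides its operands. *)
Definition radix_ok s : Prop :=
  [/\ wtab s vr 0 = r, (r == 2)%N && (ftab s fz 0 == 0) || (r == 3)%N && (ftab s fz 0 == 1),
      forall e, (e <= nu0)%N -> wtab s aPow e = (r ^ e)%N &
      forall e, (e <= nu0)%N -> ftab s aRI e = r%:R^-1 ^+ e].

Lemma radix_frame ws fs s s' : frame ws fs s s' ->
  vr \notin ws -> aPow \notin ws -> fz \notin fs -> aRI \notin fs ->
  radix_ok s -> radix_ok s'.
Proof.
move=> f h1 h2 h3 h4 [a b c d]; split; first by rewrite f.1.
- by rewrite f.2.
- by move=> e he; rewrite f.1 // c.
- by move=> e he; rewrite f.2 // d.
Qed.

Lemma params_spec nu s : radix_ok s -> wtab s vnu 0 = nu -> (5 <= nu <= nu0)%N ->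
  forall Q, (forall d s', (d <= 200)%N ->
    frame [:: vbeta; vk; vN; vB; vK; vR; vg] [::] s s' ->
    (wtab s' vbeta 0 = lbeta nu) * (wtab s' vk 0 = lk nu) * (wtab s' vN 0 = r ^ nu)%N *
    (wtab s' vB 0 = lB r nu) * (wtab s' vK 0 = lK r nu) * (wtab s' vR 0 = lR r nu) *
    (wtab s' vg 0 = lgen r nu) -> Q d s') ->
  wp params_cmd s Q.
Proof.
move=> [er rz pw ri] enu /andP[nu5 nule] Q hQ.
have [n1 n2 n3] := lbeta_facts nu5.
have E := enu.
have kle : (lk nu <= (lbeta nu).+2)%N by lia.
have P e : (e <= nu)%N -> wtab s aPow e = (r ^ e)%N by move=> h; apply: pw; lia.
have E' := (enu, P _ (leqnn nu), P (lbeta nu) ltac:(lia), P (lk nu) ltac:(lia),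
  P (lbeta nu + 2)%N ltac:(lia), P (lbeta nu + 2 - lk nu)%N ltac:(lia)).
wset E' (lbeta nu); [by rewrite addn1 divn2 /lbeta|by lia|].
wset E' (lk nu); first by lia.
wset E' (r ^ nu)%N; first by apply: powV.
wset E' (lB r nu); first by apply: powV; lia.
wset E' (lK r nu); first by apply: powV; lia.
wset E' (lR r nu); [by rewrite addn2|by apply: powV; lia|].
wlast E' (lgen r nu); [by rewrite addn2|by apply: powV; lia|].
by apply: hQ => //; fr.
Qed.

Definition params_ok nu s : Prop :=
  (wtab s vbeta 0 = lbeta nu) * (wtab s vk 0 = lk nu) * (wtab s vN 0 = r ^ nu)%N *
  (wtab s vB 0 = lB r nu) * (wtab s vK 0 = lK r nu) * (wtab s vR 0 = lR r nu) *
  (wtab s vg 0 = lgen r nu).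

Lemma params_frame ws fs nu s s' : frame ws fs s s' ->
  ~~ has (mem ws) [:: vbeta; vk; vN; vB; vK; vR; vg] ->
  params_ok nu s -> params_ok nu s'.
Proof.
move=> f /=; rewrite !negb_or => /and5P[h1 h2 h3 h4 /and4P[h5 h6 h7 _]] p.
by do ![split]; rewrite f.1 // p.
Qed.

Lemma forward_spec t nu n s : t \in [:: 5; 6; 7]%N -> radix_ok s -> params_ok nu s ->
  (5 <= nu <= nu0)%N -> wtab s vh 0 = (lR r nu - lgen r nu)%N ->
  wtab s vsz 0 = (n * lK r nu * lR r nu)%N -> (n * lK r nu * lR r nu <= V)%N ->
  forall Q, (forall d s', (d <= 1000 * (n * lK r nu * lR r nu).+1 * nu0.+1)%N ->
     frame [:: vs; vm; vrs; vp; vl; vit; vy; ve; vbase; vsh] [:: aT; t] s s' ->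
     (forall p, (p < n * lK r nu * lR r nu)%N ->
        ftab s' t p = forward r nu (ftab s t) p) ->
     Q d s') ->
  wp (forward_cmd t) s Q.
Proof.
move=> tin rad par nub eh esz szV Q hQ.
have t8 : t != aT by move: tin; rewrite !inE => /or3P[] /eqP ->.
have tz : t != fz by move: tin; rewrite !inE => /or3P[] /eqP ->.
have [nu5 nule] := andP nub.
have [n1 n2 n3] := lbeta_facts nu5.
apply: wp_seq; apply: (@chunk_spec F W V V_ge W_ge t (r ^ nu) (lB r nu) (lK r nu) (lR r nu) n) => //; try by rewrite par.
move=> d1 s1 hd1 f1 h1; apply: wp_seq.
apply: (@copy_spec F W V V_ge W_ge t aT (X vsz) (n * lK r nu * lR r nu)%N) => //=.
  by rewrite f1.1.
move=> d2 s2 hd2 f2 h2.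
have f12 : frame [:: vp; vl; vit; vy] [:: aT; t] s s2 by frt f2; frt f1; fr.
have rad2 : radix_ok s2.
  by apply: radix_frame f12 _ _ _ _ rad => //; move: tin; rewrite !inE => /or3P[] /eqP ->.
have par2 : params_ok nu s2 by apply: params_frame f12 _ par.
have [a b c d] := rad2.
apply: (@fft_spec F W V V_ge W_ge t r (lk nu) (lK r nu) (lR r nu) (lR r nu - lgen r nu) n) => //;
  try by rewrite ?par2 // f12.1.
- by move=> e he; apply: c; lia.
- by rewrite leq_subr.
- by apply: powV; lia.
- by lia.
move=> d3 s3 hd3 f3 h3; apply: hQ.
- move: hd1 hd2 hd3; rewrite /=.
  set z := (_ * _).+1 => hd1 hd2 hd3.
  have : (700 * z * (lk nu).+1 <= 700 * z * nu0.+1)%N by rewrite leq_mul2l; lia.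
  have : (z <= z * nu0.+1)%N by rewrite leq_pmulr.
  lia.
- by frt f3; frt f12; fr.
- move=> p pn; rewrite h3 //; apply: (@stages_local F r r23 _ _ _ _ n) => // p' pn'.
  by rewrite h2 pn' h1.
Qed.

Let size_le i : (i <= depth nu0)%N -> (r ^ (nu0 + 2 * i) <= S)%N.
Proof. by move=> h; rewrite leq_exp2l //; lia. Qed.

Definition down_inv s0 i s : Prop :=
  [/\ frame wsC fsC s0 s, wtab s vnu 0 = nus nu0 i, wtab s vcnt 0 = cnts r nu0 i,
      wtab s vlev 0 = i /\ (forall j, (j < i)%N -> wtab s aStk j = nus nu0 j) &
      forall p, (p < cnts r nu0 i * r ^ nus nu0 i)%N ->
        ftab s aA p = fwds r nu0 i (ftab s0 aA) p /\
        ftab s aB p = fwds r nu0 i (ftab s0 aB) p].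

Lemma down_spec s0 i s : radix_ok s0 -> (i < depth nu0)%N -> down_inv s0 i s ->
  wp down_cmd s (fun d s' => (d <= 3000 * S.+1 * nu0.+1)%N /\ down_inv s0 i.+1 s').
Proof.
move=> rad0 iD [f0 enu ecnt [elev estk] hab].
set nu := nus nu0 i in enu hab *; set n := cnts r nu0 i in ecnt hab *.
have rad : radix_ok s by apply: radix_frame f0 _ _ _ _ rad0.
have nu5 : (5 <= nu)%N by apply: nus_ge5.
have nule : (nu <= nu0)%N by apply: nus_le.
have nub : (5 <= nu <= nu0)%N by rewrite nu5.
have [n1 n2 n3] := lbeta_facts nu5.
have sz : (n * lK r nu * lR r nu <= S)%N by rewrite cnts_ring //; apply: size_le.
have szV : (n * lK r nu * lR r nu <= V)%N by lia.
have R0 : (0 < lR r nu)%N by rewrite expn_gt0 ltnW.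
have nKV : (n * lK r nu <= V)%N by apply: leq_trans szV; rewrite leq_pmulr.
apply: wp_seq; apply: (params_spec rad enu nub) => d1 s1 hd1 f1 par1.
have E1 : (wtab s1 vcnt 0 = n) * (wtab s1 vlev 0 = i) * (wtab s1 vnu 0 = nu).
  by rewrite !f1.1.
have E1' := (par1, E1).
wset E1' (n * lK r nu * lR r nu)%N => //.
wset E1' (lR r nu - lgen r nu)%N; first by apply: leq_trans (leq_subr _ _) _; apply: powV; lia.
set s2 := setw _ _ _ _.
have f2 : frame [:: vsz; vh] [::] s1 s2 by rewrite /s2; fr.
have v2 : (wtab s2 vsz 0 = n * lK r nu * lR r nu)%N * (wtab s2 vh 0 = lR r nu - lgen r nu)%N.
  by split; rewrite /s2; rd E1'.
clearbody s2.
have f12 : frame wsC fsC s s2 by frt f2; frt f1; fr.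
have rad2 : radix_ok s2 by apply: radix_frame f12 _ _ _ _ rad.
have par2 : params_ok nu s2 by apply: params_frame f2 _ par1.
apply: wp_seq; apply: (@forward_spec aA nu n) => //; try by rewrite v2.
move=> d3 s3 hd3 f3 h3.
have rad3 : radix_ok s3 by apply: radix_frame f3 _ _ _ _ rad2.
have par3 : params_ok nu s3 by apply: params_frame f3 _ par2.
apply: wp_seq; apply: (@forward_spec aB nu n) => //; try by rewrite f3.1 // v2.
move=> d4 s4 hd4 f4 h4.
have par4 : params_ok nu s4 by apply: params_frame f4 _ par3.
have E4 : (wtab s4 vcnt 0 = n) * (wtab s4 vlev 0 = i) * (wtab s4 vnu 0 = nu).
  by rewrite !f4.1 // !f3.1 // !f2.1 // !E1.
have E4' := (par4, E4).
apply: wp_seq; wput E4' i nu; first by lia.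
wset E4' i.+1; [by rewrite addn1|by have := depth_le nu0; lia|].
wset E4' (n * lK r nu)%N => //.
wlast E4' (lbeta nu).+2; [by rewrite addn2|by lia|].
split.
  move: hd1 hd3 hd4; rewrite /=; set z := (_ * _).+1 => hd1 hd3 hd4.
  have h1 : (z * nu0.+1 <= S.+1 * nu0.+1)%N by rewrite leq_mul2r; lia.
  have h2 : (1 <= z * nu0.+1)%N by rewrite muln_gt0.
  lia.
split.
- apply: frame_trans f0 _; do 4![apply: frame_setw; [by []|]].
  by frt f4; frt f3; frt f12; fr.
- by rd E4'.
- by rd E4'.
- split; first by rd E4'.
  move=> j; rewrite ltnS => ji; rd E4'; case: eqP => [->//|nij].
  by rewrite f4.1 // f3.1 // f2.1 // f1.1 // estk //; lia.
- move=> p pn.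
  have loc := forward_local r23 (n := n) nu5.
  split; rd E4'.
    rewrite (f4.2 aA) // h3 //; apply: loc => // p' pn'.
    by rewrite (f2.2 aA) // (f1.2 aA) //; have [] := hab p' pn'.
  rewrite h4 //; apply: loc => // p' pn'.
  by rewrite (f3.2 aB) // (f2.2 aB) // (f1.2 aB) //; have [] := hab p' pn'.
Qed.

Definition up_inv s0 i s : Prop :=
  [/\ frame wsC fsC s0 s, wtab s vcnt 0 = cnts r nu0 i,
      wtab s vlev 0 = i, (forall j, (j < i)%N -> wtab s aStk j = nus nu0 j) &
      forall p, (p < cnts r nu0 i * r ^ nus nu0 i)%N ->
        ftab s aC p = conv (r ^ nus nu0 i) (fwds r nu0 i (ftab s0 aA))
                           (fwds r nu0 i (ftab s0 aB)) p].

Lemma up_spec s0 i s : radix_ok s0 -> (i < depth nu0)%N -> up_inv s0 i.+1 s ->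
  wp up_cmd s (fun d s' => (d <= 3000 * S.+1 * nu0.+1)%N /\ up_inv s0 i s').
Proof.
move=> rad0 iD [f0 ecnt elev estk hab].
set nu := nus nu0 i; set n := cnts r nu0 i.
have rad : radix_ok s by apply: radix_frame f0 _ _ _ _ rad0.
have nu5 : (5 <= nu)%N by apply: nus_ge5.
have nule : (nu <= nu0)%N by apply: nus_le.
have nub : (5 <= nu <= nu0)%N by rewrite nu5.
have [n1 n2 n3] := lbeta_facts nu5.
have sz : (n * lK r nu * lR r nu <= S)%N by rewrite cnts_ring //; apply: size_le.
have szV : (n * lK r nu * lR r nu <= V)%N by lia.
have R0 : (0 < lR r nu)%N by rewrite expn_gt0 ltnW.
have K0 : (0 < lK r nu)%N by rewrite expn_gt0 ltnW.
have n0 : (0 < n)%N by rewrite /n; elim: (i) => //= j IH; rewrite muln_gt0 IH expn_gt0 ltnW.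
have nKV : (n * lK r nu <= V)%N by apply: leq_trans szV; rewrite leq_pmulr.
have nV : (n <= V)%N by apply: leq_trans nKV; rewrite leq_pmulr.
have NE : (r ^ nu = lK r nu * lB r nu)%N by rewrite /lK /lB -expnD addnC n1.
have szN : (n * r ^ nu <= S)%N by rewrite cnts_size //; apply: size_le; apply: ltnW.
have E0 := (elev, estk i (ltnSn i)).
wset E0 i; [by rewrite subn1|by have := depth_le nu0; lia|].
wset E0 nu; first by lia.
set s0' := setw _ _ _ _.
have f0' : frame [:: vlev; vnu] [::] s s0' by rewrite /s0'; fr.
have rad0' : radix_ok s0' by apply: radix_frame f0' _ _ _ _ rad.
have E0' : (wtab s0' vcnt 0 = n * lK r nu)%N * (wtab s0' vlev 0 = i) * (wtab s0' vnu 0 = nu).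
  by rewrite /s0'; do ![split]; rd E0; rewrite ecnt.
clearbody s0'.
apply: wp_seq; apply: (params_spec rad0' _ nub) => [|d1 s1 hd1 f1 par1]; first by rewrite E0'.
have E1 : (wtab s1 vcnt 0 = n * lK r nu)%N * (wtab s1 vlev 0 = i).
  by rewrite !f1.1 // !E0'.
have E1' := (par1, E1).
wset E1' (n * lK r nu * lR r nu)%N => //.
wset E1' (lgen r nu); first by apply: powV; lia.
set s2 := setw _ _ _ _.
have f2 : frame [:: vsz; vh] [::] s1 s2 by rewrite /s2; fr.
have v2 : (wtab s2 vsz 0 = n * lK r nu * lR r nu)%N * (wtab s2 vh 0 = lgen r nu).
  by split; rewrite /s2; rd E1'.
clearbody s2.
have f12 : frame [:: vlev; vnu; vbeta; vk; vN; vB; vK; vR; vg; vsz; vh] [::] s s2.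
  by frt f2; frt f1; frt f0'; fr.
have rad2 : radix_ok s2 by apply: radix_frame f12 _ _ _ _ rad.
have par2 : params_ok nu s2 by apply: params_frame f2 _ par1.
have [a b c d] := rad2.
apply: wp_seq.
apply: (@fft_spec F W V V_ge W_ge aC r (lk nu) (lK r nu) (lR r nu) (lgen r nu) n) => //;
  try by rewrite ?par2 // v2.
- by move=> e he; apply: c; lia.
- by rewrite leq_exp2l //; lia.
- by apply: powV; lia.
- by lia.
move=> d3 s3 hd3 f3 h3.
have rad3 : radix_ok s3 by apply: radix_frame f3 _ _ _ _ rad2.
have par3 : params_ok nu s3 by apply: params_frame f3 _ par2.
have E3 : (wtab s3 vcnt 0 = n * lK r nu)%N * (wtab s3 vlev 0 = i) *
    (wtab s3 aPow (lbeta nu + 1) = lM r nu)%N * (ftab s3 aRI (lk nu) = r%:R^-1 ^+ lk nu).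
  have [_ _ c3 e3] := rad3.
  rewrite c3; last by lia.
  rewrite e3; last by lia.
  by rewrite !f3.1 // !f2.1 // !E1 addn1.
have E3' := (par3, E3).
wset E3' (lR r nu - lM r nu)%N; first by apply: leq_trans (leq_subr _ _) _; apply: powV; lia.
fset E3' (r%:R^-1 ^+ lk nu : F) => //.
wset E3' n; [by rewrite mulnK|by []|].
wset E3' (n * r ^ nu)%N; first by lia.
set s4 := setw _ _ _ _.
have f4 : frame [:: vD; vcnt; vsz] [:: fkinv] s3 s4 by rewrite /s4; fr.
have E4 : (wtab s4 vcnt 0 = n) * (wtab s4 vlev 0 = i) * (wtab s4 vsz 0 = n * r ^ nu)%N *
    (wtab s4 vD 0 = lR r nu - lM r nu)%N * (ftab s4 fkinv 0 = r%:R^-1 ^+ lk nu).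
  by rewrite /s4; do ![split]; rd E3'.
clearbody s4.
have par4 : params_ok nu s4 by apply: params_frame f4 _ par3.
apply: wp_seq.
apply: (@overlap_spec F W V V_ge W_ge (r ^ nu) (lB r nu) (lK r nu) (lR r nu)
  (lR r nu - lM r nu) n) => //; try by rewrite ?par4 // E4.
- by rewrite /lB /lR !expnS; case/orP: r23 => /eqP ->; lia.
- have : (lK r nu + lK r nu <= S + S)%N; last by lia.
  by apply: leq_add; apply: leq_trans sz; apply: leq_trans (leq_pmulr _ R0); rewrite leq_pmull.
move=> d5 s5 hd5 f5 h5.
apply: (@copy_spec F W V V_ge W_ge aC aT (X vsz) (n * r ^ nu)%N) => //=; try by rewrite f5.1 // E4.
  by lia.
move=> d6 s6 hd6 f6 h6; split.
  move: hd1 hd3 hd5 hd6; rewrite /=.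
  set z := (n * lK r nu * lR r nu).+1; set z' := (n * r ^ nu).+1 => hd1 hd3 hd5 hd6.
  have g1 : (z * nu0.+1 <= S.+1 * nu0.+1)%N by rewrite leq_mul2r; lia.
  have g2 : (1 <= z * nu0.+1)%N by rewrite muln_gt0.
  have g3 : (z' <= S.+1)%N by rewrite ltnS.
  have g4 : (S.+1 <= S.+1 * nu0.+1)%N by rewrite leq_pmulr.
  have g5 : (z * (lk nu).+1 <= S.+1 * nu0.+1)%N by rewrite leq_mul //; lia.
  lia.
split.
- by apply: frame_trans f0 _; frt f6; frt f5; frt f4; frt f3; frt f12; fr.
- by rewrite f6.1 // f5.1 // E4.
- by rewrite f6.1 // f5.1 // E4.
- by move=> j ji; rewrite f6.1 // f5.1 // f4.1 // f3.1 // f12.1 // estk //; lia.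
- move=> p pn; rewrite h6 pn h5 // E4.
  rewrite -(fwds_conv r23 _ _ _ _ r_unit).
  have nu_R : (r ^ nus nu0 i.+1 = lR r nu)%N by [].
  rewrite -/nu /backward.
  apply: (@overlap_local F _ _ _ _ _ _ n) => // [|p' pn'].
  + by rewrite /lB /lR /lM !expnS; case/orP: r23 => /eqP ->; lia.
  + rewrite (f4.2 aC) // h3 //; apply: (@stages_local F r r23 _ _ _ _ n) => // p'' pn''.
    by rewrite f12.2 // hab // nu_R -mulnA.
Qed.

(** The recursion runs over the levels, all products of a level being in one array.
    Exponents stop at 5, where the schoolbook product costs a constant per entry. *)
Lemma cyc_spec s : radix_ok s -> wtab s vnu 0 = nu0 ->
  forall Q, (forall d s', (d <= 1000 * (1000 * (S.+1 * nu0.+1 ^ 2)))%N -> frame wsC fsC s s' ->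
     (forall p, (p < r ^ nu0)%N ->
        ftab s' aC p = conv (r ^ nu0) (ftab s aA) (ftab s aB) p) -> Q d s') ->
  wp cyc_cmd s Q.
Proof.
move=> rad enu Q hQ; have V1 : (1 <= V)%N by lia.
wset enu 1%N => //; wset enu 0%N => //.
set s1 := setw _ _ _ _.
have f1 : frame [:: vcnt; vlev] [::] s s1 by rewrite /s1; fr.
have E1 : (wtab s1 vcnt 0 = 1%N) * (wtab s1 vlev 0 = 0%N) * (wtab s1 vnu 0 = nu0).
  by rewrite /s1; do ![split]; rd enu.
clearbody s1.
have D0 : down_inv s 0 s1.
  split; rewrite ?E1 //; first by frt f1; fr.
  by move=> p pn; rewrite !f1.2.
apply: wp_seq.
apply: (@wp_while F W V V_ge W_ge _ _ _ (depth nu0) (fun=> 3000 * S.+1 * nu0.+1)%N (down_inv s)) => //.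
- by move=> i s2 iD [_ e2 _ _ _]; split=> //=; rewrite e2 depthP.
- by move=> i s2 iD I2; apply: down_spec.
move=> d2 s2 hd2 [f2 e2 c2 [l2 k2] h2].
set D := depth nu0 in hd2 e2 c2 l2 k2 h2 *.
set N := (r ^ nus nu0 D)%N; set n := cnts r nu0 D in c2 h2 *.
have nN : (n * N = S)%N by rewrite cnts_size.
have N0 : (0 < N)%N by rewrite expn_gt0 ltnW.
have S0 : (0 < S)%N by rewrite expn_gt0 ltnW.
have n0 : (0 < n)%N by move: S0; rewrite -nN muln_gt0 => /andP[].
have nusD : (nus nu0 D <= 5)%N by rewrite leqNgt depthP ltnn.
have pN : wtab s2 aPow (nus nu0 D) = N.
  by rewrite f2.1 //; have [_ _ c _] := rad; rewrite c // nus_le.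
have NV : (N <= S)%N by rewrite -nN leq_pmull.
have E2 := (e2, c2, l2, pN).
wset E2 N; first by lia.
wset E2 (n * N)%N; first by lia.
set s3 := setw _ _ _ _.
have f3 : frame [:: vN; vsz] [::] s2 s3 by rewrite /s3; fr.
have E3 : (wtab s3 vN 0 = N) * (wtab s3 vsz 0 = n * N)%N * (wtab s3 vcnt 0 = n) * (wtab s3 vlev 0 = D).
  by rewrite /s3; do ![split]; rd E2.
clearbody s3.
apply: wp_seq; apply: (@conv_spec F W V V_ge W_ge N n) => //; [by rewrite E3|by rewrite E3|by lia|by lia|].
move=> d4 s4 hd4 f4 h4.
have U0 : up_inv s D s4.
  split.
  - by apply: frame_trans f2 _; frt f4; frt f3; fr.
  - by rewrite f4.1 // E3.
  - by rewrite f4.1 // E3.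
  - by move=> j jD; rewrite f4.1 // f3.1 // k2.
  - move=> p pn; rewrite h4 //; apply: (conv_local (n := n)) => // p' pn'.
      by rewrite f3.2 //; have [] := h2 p' pn'.
    by rewrite f3.2 //; have [] := h2 p' pn'.
apply: (@wp_while F W V V_ge W_ge _ _ _ D (fun=> 3000 * S.+1 * nu0.+1)%N
  (fun i => up_inv s (D - i))) => //.
- by rewrite subn0.
- by move=> i s5 iD [_ _ l5 _ _]; split=> //=; rewrite l5 subn_gt0.
- move=> i s5 iD; rewrite (_ : D - i = (D - i.+1).+1)%N; last by lia.
  by move=> I5; apply: up_spec => //; rewrite -/D; lia.
move=> d5 s5 hd5; rewrite subnn => -[f5 _ _ _ h5].
apply: hQ => //; last by move=> p pn; rewrite h5 // mul1n.
have N243 : (N <= 243)%N.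
  apply: (@leq_trans (r ^ 5)%N); first by rewrite leq_exp2l.
  by case/orP: r23 => /eqP ->.
have Dnu : (D <= nu0)%N by apply: depth_le.
move: hd2 hd4 hd5; rewrite nN !sum_nat_const !card_ord /= => hd2 hd4 hd5.
have h6 : (500 * S.+1 * N.+1 <= 500 * S.+1 * 244)%N by rewrite leq_mul2l ltnS N243 orbT.
have h7 : (D * (3000 * S.+1 * nu0.+1) <= 3000 * S.+1 * nu0.+1 ^ 2)%N.
  by rewrite mulnC -mulnn mulnA leq_mul2l; apply/orP; right; lia.
have h8 : (D.+1 <= S.+1 * nu0.+1 ^ 2)%N.
  apply: (@leq_trans nu0.+1); first by rewrite ltnS.
  by rewrite -mulnn mulnA; apply: leq_pmull.
have h9 : (S.+1 <= S.+1 * nu0.+1 ^ 2)%N by rewrite leq_pmulr // expn_gt0.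
have e6 : (D * (3000 * S.+1 * nu0.+1) <= 3000 * (S.+1 * nu0.+1 ^ 2))%N.
  by apply: leq_trans h7 _; rewrite mulnA.
move: h6 h8 h9 e6 hd2 hd4 hd5; set y := (S.+1 * nu0.+1 ^ 2)%N.
set z := (D * _)%N; set u := (_ * _ * N.+1)%N; set v := (_ * D.+1)%N => *.
lia.
Qed.

End CycSpec.

(** * Updating a block of digits *)

Notation vT := 50%N (only parsing).
Notation vJ := 51%N (only parsing).
Notation vST := 52%N (only parsing).
Notation vnu1 := 53%N (only parsing).
Notation vL := 54%N (only parsing).
Notation vc := 55%N (only parsing).
Notation vcj := 56%N (only parsing).
Notation vck := 57%N (only parsing).
Notation aU := 10%N (only parsing).
Notation aQ := 11%N (only parsing).
Notation aG := 12%N (only parsing).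
Notation frinv := 23%N (only parsing).

Definition pow_cmd : cmd :=
  Seq (WSet aPow (WConst 0) (WConst 1))
 (Seq (FSet aRI (WConst 0) FOne)
 (Seq (wasg vnu1 (WConst 0))
      (While (TLt (WGet aPow (X vnu1)) (WAdd (WMul (WConst 4) (X vL)) (WConst 243)))
        (Seq (WSet aPow (WAdd (X vnu1) (WConst 1)) (WMul (WGet aPow (X vnu1)) (X vr)))
        (Seq (FSet aRI (WAdd (X vnu1) (WConst 1)) (FMul (FGet aRI (X vnu1)) (Z frinv)))
             (wasg vnu1 (WAdd (X vnu1) (WConst 1)))))))).

Definition v2_cmd : cmd :=
  Seq (wasg vL (WConst 1))
      (While (TEq (wmod (X vc) (WMul (WConst 2) (X vL))) (WConst 0))
        (wasg vL (WMul (WConst 2) (X vL)))).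

(** The block of quotient digits of column j found last, multiplied by the row
    window of basis element j in column k, is subtracted from the digits of
    column k that follow. *)
Definition block_cmd : cmd :=
  Seq (For vp (WGet aPow (X vnu1))
        (If (TLt (X vp) (X vL))
            (FSet aA (X vp) (FGet aQ (WAdd (WMul (X vcj) (X vST)) (WAdd (WSub (X vc) (X vL)) (X vp)))))
            (FSet aA (X vp) FZero)))
 (Seq (For vp (WGet aPow (X vnu1))
        (If (TLt (X vp) (WMul (WConst 2) (X vL)))
            (FSet aB (X vp) (FGet aG (WAdd (WMul (WAdd (WMul (X vcj) (X vJ)) (X vck)) (X vST)) (X vp))))
            (FSet aB (X vp) FZero)))
 (Seq (wasg vnu (X vnu1))
 (Seq cyc_cmd
      (For vp (X vL)
        (FSet aU (WAdd (WAdd (WMul (X vck) (X vST)) (X vc)) (X vp))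
          (FSub (FGet aU (WAdd (WAdd (WMul (X vck) (X vST)) (X vc)) (X vp)))
                (FGet aC (WAdd (X vL) (X vp))))))))).

Section Exponent.
Context (r : nat).
Hypothesis r23 : (r == 2)%N || (r == 3)%N.
Let r_gt1 : (1 < r)%N. Proof. by case/orP: r23 => /eqP ->. Qed.

(** Length 4 L leaves room for a product of L digits by 2 L row entries, and 243 = 3 ^ 5
    makes the exponent at least 5 for both radices. *)
Definition nuof L : nat := up_log r (4 * L + 243).

Lemma nuof_lt L i : (r ^ i < 4 * L + 243)%N = (i < nuof L)%N.
Proof.
rewrite /nuof; apply/idP/idP => h.
  rewrite ltnNge; apply/negP => h2; have := up_logP (4 * L + 243) r_gt1.
  by have : (r ^ up_log r (4 * L + 243) <= r ^ i)%N; [rewrite leq_exp2l|lia].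
rewrite ltnNge; apply/negP => h2; have := up_log_min r_gt1 h2.
by rewrite leqNgt h.
Qed.

Lemma nuof_le L : (4 * L + 243 <= r ^ nuof L)%N.
Proof. exact: up_logP. Qed.

Lemma nuof_ge5 L : (5 <= nuof L)%N.
Proof.
rewrite leqNgt; apply/negP => h; have := nuof_le L.
have : (r ^ nuof L <= 3 ^ 4)%N; last by rewrite (_ : 3 ^ 4 = 81)%N //; lia.
apply: (@leq_trans (r ^ 4)%N); first by rewrite leq_exp2l.
by rewrite leq_exp2r //; case/orP: r23 => /eqP ->.
Qed.

Lemma nuof_size L : (r ^ nuof L <= 3 * (4 * L + 243))%N.
Proof.
have := nuof_ge5 L; case E : (nuof L) => [//|m] _.
have := nuof_lt L m; rewrite E ltnSn expnS => h.
by apply: leq_mul; [case/orP: r23 => /eqP ->|apply: ltnW].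
Qed.

End Exponent.

(** There is no wraparound, and entries L to 2 L - 1 of the product are the ones in which
    all L digits meet row entries of the window. *)
Lemma block_conv (F : fieldType) N L (A B : nat -> F) x : (4 * L <= N)%N -> (x < L)%N ->
  conv N (fun p => if (p < L)%N then A p else 0)
         (fun p => if (p < 2 * L)%N then B p else 0) (L + x)%N =
  \sum_(i < L) A i * B (L + x - i)%N.
Proof.
move=> LN xL; rewrite /conv divn_small; last by lia.
have -> : N = (L + (N - L))%N by lia.
rewrite mul0n big_split_ord /= [X in _ + X]big1 ?addr0 => [|i _]; last first.
  by rewrite ifF ?mul0r //; lia.
apply: eq_bigr => i _; have iL := ltn_ord i; rewrite !add0n iL.
rewrite subnKC; last by lia.
rewrite (modn_small (m := (L + x)%N)); last by lia.
rewrite (_ : L + x + N - i = L + x - i + N)%N; last by lia.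
by rewrite modnDr modn_small ?ifT //; lia.
Qed.

Section BlockSpec.
Context (F : fieldType) (W V : nat).
Hypothesis V_ge : (250 <= V)%N.
Hypothesis W_ge : (V ^ wlim <= W)%N.
Implicit Types (s : store F).
Let wp := @wp F W V.
Lemma v2_spec c s : wtab s vc 0 = c -> (0 < c)%N -> (c <= V)%N ->
  forall Q, (forall d s', (d <= 50 * (logn 2 c).+1)%N -> frame [:: vL] [::] s s' ->
    wtab s' vL 0 = (2 ^ logn 2 c)%N -> Q d s') ->
  wp v2_cmd s Q.
Proof.
move=> ec c0 cV Q hQ; have V1 : (1 <= V)%N by lia.
wset ec 1%N => //; set s1 := setw _ _ _ _.
pose Inv i s2 := frame [:: vL] [::] s s2 /\ wtab s2 vL 0 = (2 ^ i)%N.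
apply: (@wp_while F W V V_ge W_ge _ _ _ (logn 2 c) (fun=> 20%N) Inv) => //.
- by split; [rewrite /s1; fr|rewrite /s1; rd ec].
- move=> i s2 iD [f e2]; split=> //=.
  by rewrite modn_sub (f.1 vc) // ec e2 -expnS -/(dvdn _ _) pfactor_dvdn.
- move=> i s2 iD [f e2].
  have pV : (2 ^ i.+1 <= V)%N.
    by apply: leq_trans cV; apply: dvdn_leq => //; rewrite pfactor_dvdn.
  wlast e2 (2 ^ i.+1)%N; [by rewrite expnS|by []|].
  by split; [by []|split; [fr|rd e2]].
move=> d s2 hd [f e2]; apply: hQ => //.
move: hd; rewrite sum_nat_const card_ord /=; lia.
Qed.

Context (r : nat).
Hypothesis r23 : (r == 2)%N || (r == 3)%N.
Hypothesis r_unit : r%:R != 0 :> F.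
Let r_gt1 : (1 < r)%N. Proof. by case/orP: r23 => /eqP ->. Qed.

Lemma pow_spec L s : wtab s vL 0 = L -> wtab s vr 0 = r ->
  (r == 2)%N && (ftab s fz 0 == 0) || (r == 3)%N && (ftab s fz 0 == 1) ->
  ftab s frinv 0 = r%:R^-1 -> (r ^ nuof r L <= V)%N ->
  forall Q, (forall d s', (d <= 100 * (nuof r L).+1)%N ->
    frame [:: vnu1; aPow] [:: aRI] s s' ->
    radix_ok r (nuof r L) s' -> wtab s' vnu1 0 = nuof r L -> Q d s') ->
  wp pow_cmd s Q.
Proof.
move=> eL er ez eri nuV Q hQ.
have E := (eL, er, eri); have V1 : (1 <= V)%N by lia.
apply: wp_seq; wput E 0%N 1%N => //.
apply: wp_seq; fput E 0%N (1 : F) => //.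
wset E 0%N => //.
set s1 := setw _ _ _ _.
pose Inv i s2 := [/\ frame [:: vnu1; aPow] [:: aRI] s s2, wtab s2 vnu1 0 = i,
  (forall e, (e <= i)%N -> wtab s2 aPow e = (r ^ e)%N) &
  (forall e, (e <= i)%N -> ftab s2 aRI e = r%:R^-1 ^+ e)].
apply: (@wp_while F W V V_ge W_ge _ _ _ (nuof r L) (fun=> 40%N) Inv) => //.
- split; [by rewrite /s1; fr|by rewrite /s1; rd E| |].
    by move=> e; rewrite leqn0 => /eqP ->; rewrite /s1; rd E.
  by move=> e; rewrite leqn0 => /eqP ->; rewrite /s1; rd E; rewrite expr0.
- move=> i s2 iD [f e2 c2 d2]; split=> //=.
  by rewrite (f.1 vL) // e2 eL c2 // nuof_lt.
- move=> i s2 iD [f e2 c2 d2].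
  have E2 : (wtab s2 vnu1 0 = i) * (wtab s2 vr 0 = r) * (ftab s2 frinv 0 = r%:R^-1) *
     (wtab s2 aPow i = r ^ i)%N * (ftab s2 aRI i = r%:R^-1 ^+ i).
    by rewrite e2 c2 // d2 // f.1 // f.2 // er eri.
  have piV : (r ^ i.+1 <= V)%N by apply: leq_trans nuV; rewrite leq_exp2l.
  apply: wp_seq; wput E2 i.+1 (r ^ i.+1)%N; [by rewrite addn1|by rewrite expnSr|by []|].
  apply: wp_seq; fput E2 i.+1 (r%:R^-1 ^+ i.+1 : F) => //; first by rewrite addn1.
    by rd E2; rewrite exprSr.
  wlast E2 i.+1; [by rewrite addn1| |].
    by apply: leq_trans piV; apply: ltnW; apply: ltn_expl.
  split; first by rewrite /=.
  split.
  + by fr; exact: f.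
  + by rd E2.
  + by move=> e ei; rd E2; case: eqP => [->//|h]; apply: c2; lia.
  + by move=> e ei; rd E2; case: eqP => [->//|h]; apply: d2; lia.
move=> d s2 hd [f e2 c2 d2]; apply: hQ => //.
  move: hd; rewrite sum_nat_const card_ord /=; lia.
by split=> //; [rewrite f.1|rewrite !f.2].
Qed.

Notation wsB := [:: vnu; vcnt; vbeta; vk; vN; vB; vK; vR; vg; vh; vsz; vs; vm; vrs;
  vp; vl; vy; vit; ve; vbase; vsh; vi; vlev; vD; aStk] (only parsing).

Lemma block_spec c L j k J ST s :
  let nu := nuof r L in let N := (r ^ nu)%N in
  radix_ok r nu s -> wtab s vnu1 0 = nu -> wtab s vL 0 = L -> wtab s vc 0 = c ->
  wtab s vcj 0 = j -> wtab s vck 0 = k -> wtab s vJ 0 = J -> wtab s vST 0 = ST ->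
  (L <= c)%N -> (r ^ (nu + 2 * depth nu) + r ^ (nu + 2 * depth nu) <= V)%N ->
  forall Q, (forall d s',
    (d <= 2000 * (1000 * ((r ^ (nu + 2 * depth nu)).+1 * nu.+1 ^ 2)))%N ->
    frame wsB [:: aA; aB; aC; aT; fkinv; facc; aU] s s' ->
    (forall p, ftab s' aU p = if (k * ST + c <= p < k * ST + c + L)%N
       then ftab s aU p - \sum_(i < L) ftab s aQ (j * ST + (c - L + i))%N *
          ftab s aG ((j * J + k) * ST + (L + (p - (k * ST + c)) - i))%N
       else ftab s aU p) -> Q d s') ->
  wp block_cmd s Q.
Proof.
move=> nu N rad enu1 eL ec ej ek eJ eST Lc SV Q hQ.
set S := (r ^ (nu + 2 * depth nu))%N in SV hQ.
have NS : (N <= S)%N by rewrite leq_exp2l // leq_addr.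
have LN := nuof_le r23 L; rewrite -/nu -/N in LN.
have NV : (N <= V)%N by lia.
have nu5 : (5 <= nu)%N by apply: nuof_ge5 r23 _.
have nuN : (nu <= N)%N by apply: ltnW; apply: ltn_expl.
have pN : wtab s aPow nu = N by have [_ _ c' _] := rad; rewrite c'.
have E := (enu1, eL, ec, ej, ek, eJ, eST, pN).
pose A p := ftab s aQ (j * ST + (c - L + p))%N.
pose B p := ftab s aG ((j * J + k) * ST + p)%N.
apply: wp_seq.
apply: (@wp_map F W V V_ge W_ge vp _ _ [:: vp] [:: aA] aA N 100 0
  (fun p => if (p < L)%N then A p else 0)) => //=.
- by rewrite E.
- move=> i s1 iN f1 x1 _.
  have E1 : (wtab s1 vp 0 = i) * (wtab s1 vL 0 = L) * (wtab s1 vc 0 = c) *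
     (wtab s1 vcj 0 = j) * (wtab s1 vST 0 = ST) * (forall p, ftab s1 aQ p = ftab s aQ p).
    by rewrite x1 !f1.1 // !E; do ![split] => // p; rewrite f1.2.
  apply: (wp_if V_ge W_ge) => //=; rewrite !E1; case: ifP => iL.
    fput E1 i (A i) => //; first by rd E1.
    by split; [by []|fr|rd E1|move=> p; rd E1; rewrite add0n iL].
  fput E1 i (0 : F) => //; by split; [by []|fr|rd E1|move=> p; rd E1; rewrite add0n iL].
move=> d1 s1 hd1 f1 h1.
have E1 : (wtab s1 vnu1 0 = nu) * (wtab s1 vL 0 = L) * (wtab s1 vc 0 = c) *
     (wtab s1 vcj 0 = j) * (wtab s1 vck 0 = k) * (wtab s1 vJ 0 = J) * (wtab s1 vST 0 = ST) *
     (wtab s1 aPow nu = N) * (forall p, ftab s1 aG p = ftab s aG p).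
  by rewrite !f1.1 // !E; do ![split] => // p; rewrite f1.2.
apply: wp_seq.
apply: (@wp_map F W V V_ge W_ge vp _ _ [:: vp] [:: aB] aB N 100 0
  (fun p => if (p < 2 * L)%N then B p else 0)) => //=.
- by rewrite !E1.
- move=> i s2 iN f2 x2 _.
  have E2 : (wtab s2 vp 0 = i) * (wtab s2 vL 0 = L) * (wtab s2 vcj 0 = j) *
     (wtab s2 vck 0 = k) * (wtab s2 vJ 0 = J) *
     (wtab s2 vST 0 = ST) * (forall p, ftab s2 aG p = ftab s aG p).
    by rewrite x2 !f2.1 // !E1; do ![split] => // p; rewrite f2.2 // E1.
  apply: (wp_if V_ge W_ge) => //=; rewrite !E2; case: ifP => iL.
    fput E2 i (B i) => //; first by rd E2.
    by split; [by []|fr|rd E2|move=> p; rd E2; rewrite add0n iL].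
  fput E2 i (0 : F) => //; by split; [by []|fr|rd E2|move=> p; rd E2; rewrite add0n iL].
move=> d2 s2 hd2 f2 h2.
have e2 : wtab s2 vnu1 0 = nu by rewrite f2.1 // E1.
wset e2 nu; first by lia.
set s3 := setw _ _ _ _.
have f3 : frame [:: vp; vnu] [:: aA; aB] s s3.
  by rewrite /s3; fr; frt f2; frt f1; fr.
have a3 p : (p < N)%N -> ftab s3 aA p = if (p < L)%N then A p else 0.
  by move=> pN'; rewrite /s3 /= f2.2 // h1 add0n subn0 pN'.
have b3 p : (p < N)%N -> ftab s3 aB p = if (p < 2 * L)%N then B p else 0.
  by move=> pN'; rewrite /s3 /= h2 add0n subn0 pN'.
have nu3 : wtab s3 vnu 0 = nu by rewrite /s3; rd e2.
clearbody s3.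
have rad3 : radix_ok r nu s3 by apply: radix_frame f3 _ _ _ _ rad.
apply: wp_seq; apply: (@cyc_spec F W V V_ge W_ge r nu r23 nu5 SV r_unit s3 rad3 nu3).
move=> d4 s4 hd4 f4 h4.
have f34 : frame wsB [:: aA; aB; aC; aT; fkinv; facc] s s4 by frt f4; frt f3; fr.
have E4 : (wtab s4 vL 0 = L) * (wtab s4 vc 0 = c) * (wtab s4 vck 0 = k) *
   (wtab s4 vST 0 = ST) * (forall p, ftab s4 aU p = ftab s aU p).
  by rewrite !f34.1 // !E; do ![split] => // p; rewrite f34.2.
have c4 x : (x < L)%N -> ftab s4 aC (L + x)%N = \sum_(i < L) A i * B (L + x - i)%N.
  move=> xL; rewrite h4; last by rewrite -/N; lia.
  rewrite -(@block_conv F N) //; last by lia.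
  by apply: (@conv_local F N 1); rewrite ?mul1n //; lia.
apply: (@wp_map F W V V_ge W_ge vp _ _ [:: vp] [:: aU] aU L 100 (k * ST + c)
  (fun p => ftab s aU (k * ST + c + p)%N - \sum_(i < L) A i * B (L + p - i)%N)) => //=.
- by rewrite E4.
- by lia.
- move=> i s5 iL f5 x5 g5.
  have E5 : (wtab s5 vp 0 = i) * (wtab s5 vL 0 = L) * (wtab s5 vc 0 = c) *
     (wtab s5 vck 0 = k) * (wtab s5 vST 0 = ST) * (ftab s5 aU (k * ST + c + i)%N = ftab s aU (k * ST + c + i)%N)
     * (forall p, ftab s5 aC p = ftab s4 aC p).
    rewrite x5 !f5.1 // !E4; do ![split] => //; first by rewrite g5 ?E4 //; lia.
    by move=> p; rewrite f5.2.
  fput E5 (k * ST + c + i)%N (ftab s aU (k * ST + c + i)%N - \sum_(i0 < L) A i0 * B (L + i - i0)%N) => //.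
    by rd E5; rewrite c4.
  by split; [by []|fr|rd E5|move=> p; rd E5].
move=> d5 s5 hd5 f5 h5; apply: hQ.
- move: hd1 hd2 hd4 hd5; rewrite /=.
  set y := (S.+1 * nu.+1 ^ 2)%N => hd1 hd2 hd4 hd5.
  have : (S.+1 <= y)%N by rewrite /y leq_pmulr // expn_gt0.
  lia.
- by frt f5; frt f34; fr.
- move=> p; rewrite h5 E4; case: ifP => // h; rewrite subnKC //; by case/andP: h.
Qed.

End BlockSpec.

(** * Division with deferred updates *)

Notation vx := 58%N (only parsing).
Notation vyy := 59%N (only parsing).
Notation vtau := 60%N (only parsing).
Notation vk2 := 61%N (only parsing).
Notation aFD := 9%N (only parsing).
Notation ca := (WGet 0 (WConst 1)) (only parsing).
Notation cb := (WGet 0 (WConst 2)) (only parsing).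

Definition slot_cmd : cmd :=
  For vx ca (For vyy (X vJ)
   (Seq (wasg vck (WSub (WSub (X vJ) (WConst 1)) (X vyy)))
   (If (TEq (wmod (WMul cb (X vck)) ca) (WSub (WSub ca (WConst 1)) (X vx)))
    (If (TLt (WGet aFD (X vck)) (WSub (X vT) (X vtau)))
     (Seq (FSet aQ (WAdd (WMul (X vck) (X vST)) (X vtau))
                   (FGet aU (WAdd (WMul (X vck) (X vST)) (X vtau))))
     (For vk2 (X vJ)
       (FSet aU (WAdd (WMul (X vk2) (X vST)) (X vtau))
         (FSub (FGet aU (WAdd (WMul (X vk2) (X vST)) (X vtau)))
           (FMul (FGet aQ (WAdd (WMul (X vck) (X vST)) (X vtau)))
             (FGet aG (WMul (WAdd (WMul (X vck) (X vJ)) (X vk2)) (X vST))))))))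
     Skip)
    Skip))).

Definition division_cmd : cmd :=
  For vtau (X vT)
   (Seq slot_cmd
   (Seq (wasg vc (WAdd (X vtau) (WConst 1)))
   (Seq v2_cmd
   (Seq pow_cmd
   (For vcj (X vJ) (For vck (X vJ) block_cmd)))))).

(** After the first c digits are known, digit t has received the products that
    involve the first bs c t of them. *)
Fixpoint bs (c t : nat) : nat :=
  if c is c'.+1 then if (t < c + 2 ^ logn 2 c)%N then c else bs c' t else 0%N.

Lemma bs_self t : bs t t = t.
Proof. by case: t => //= t; rewrite ifT // -{1}[t.+1]addn0 ltn_add2l expn_gt0. Qed.

Lemma bs_le c t : (bs c t <= c)%N.
Proof. by elim: c => //= c IH; case: ifP => // _; apply: leqW. Qed.

(** Multiples of 2 ^ e being at distance at least 2 ^ e, a number strictly between two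
    neighbours has a smaller 2-part, and its block ends before the next one. *)
Lemma v2_gap c d e : (0 < d)%N -> (d < c)%N -> (2 ^ e %| c)%N -> (c - 2 ^ e < d)%N ->
  (d + 2 ^ logn 2 d <= c)%N.
Proof.
move=> d0 dc ec cd; set f := logn 2 d.
have fd : (2 ^ f %| d)%N by rewrite pfactor_dvdn.
have fe : (f < e)%N.
  rewrite ltnNge; apply/negP => ef.
  have ed : (2 ^ e %| d)%N by apply: dvdn_trans fd; rewrite dvdn_exp2l.
  have : (2 ^ e %| c - d)%N by rewrite dvdn_sub.
  by move=> /dvdn_leq; lia.
have fc : (2 ^ f %| c - d)%N.
  by rewrite dvdn_sub //; apply: dvdn_trans ec; rewrite dvdn_exp2l // ltnW.
by have := dvdn_leq _ fc; lia.
Qed.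

(** The entries that a block updates have received exactly the digits before the block. *)
Lemma bs_block c t : let L := (2 ^ logn 2 c.+1)%N in
  (c.+1 <= t < c.+1 + L)%N -> bs c t = (c.+1 - L)%N.
Proof.
set L := (2 ^ _)%N => /= /andP[ct tL]; have L0 : (0 < L)%N by rewrite expn_gt0.
have Ldvd : (L %| c.+1)%N by rewrite pfactor_dvdn.
have Lc : (L <= c.+1)%N by apply: dvdn_leq.
suff: forall d, (d < L)%N -> bs (c.+1 - L + d) t = (c.+1 - L)%N.
  by move=> /(_ (L - 1)%N); rewrite (_ : c.+1 - L + (L - 1) = c)%N; [apply; lia|lia].
elim=> [|d IH] dL.
  rewrite addn0; case E : (c.+1 - L)%N => [//|m]; rewrite -E.
  have L2 : (L * 2 %| c.+1 - L)%N.
    case/dvdnP: Ldvd => z zE.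
    have oz : odd z.
      apply/negPn/negP => ez; have : (2 ^ (logn 2 c.+1).+1 %| c.+1)%N.
        rewrite expnSr -/L zE mulnC dvdn_pmul2r // .
        by rewrite dvdn2.
      by rewrite pfactor_dvdn // ltnn.
    rewrite zE (_ : z * L - L = (z - 1) * L)%N; last by rewrite mulnBl mul1n.
    rewrite mulnC dvdn_pmul2r // dvdn2 oddB; last by case: (z) oz.
    by rewrite oz.
  have h2 : (L * 2 <= 2 ^ logn 2 (c.+1 - L))%N.
    rewrite /L -expnSr leq_exp2l // -pfactor_dvdn //; last by rewrite E.
    by rewrite expnSr.
  rewrite {1}E /= -E ifT //; lia.
have := @v2_gap c.+1 (c.+1 - L + d.+1) (logn 2 c.+1) ltac:(lia) ltac:(lia) Ldvd ltac:(lia).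
rewrite addnS => h; rewrite /= ifF; first by apply: IH; lia.
by apply/negbTE; rewrite -leqNgt; apply: leq_trans h ct.
Qed.

Lemma bs_step c t : (t < c.+1 + 2 ^ logn 2 c.+1)%N = false -> bs c.+1 t = bs c t.
Proof. by rewrite /= => ->. Qed.

Lemma cell_eq ST k t k' t' : (t < ST)%N -> (t' < ST)%N ->
  (k * ST + t == k' * ST + t')%N = (k == k') && (t == t').
Proof.
move=> h1 h2; apply/eqP/andP => [h|[/eqP -> /eqP ->] //].
have e1 := congr1 (fun z => z %/ ST)%N h; have e2 := congr1 (fun z => z %% ST)%N h.
move: e1 e2; rewrite /= !divnMDl ?(leq_ltn_trans _ h1) // !divn_small // !addn0.
by rewrite !modnMDl !modn_small // => -> ->.
Qed.

Lemma cell_in ST k t k' c L : (t < ST)%N -> (c + L <= ST)%N ->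
  (k * ST + c <= k' * ST + t < k * ST + c + L)%N = (k == k') && (c <= t < c + L)%N.
Proof.
move=> tS cS; apply/idP/idP => [/andP[h1 h2]|/andP[/eqP -> h]]; last by lia.
have kk : k = k'.
  apply/eqP; rewrite eqn_leq; apply/andP; split.
    rewrite leqNgt; apply/negP => h.
    by have : (k'.+1 * ST <= k * ST)%N; [rewrite leq_mul2r h orbT|rewrite mulSn; lia].
  rewrite leqNgt; apply/negP => h.
  by have : (k.+1 * ST <= k' * ST)%N; [rewrite leq_mul2r h orbT|rewrite mulSn; lia].
rewrite kk eqxx; rewrite kk in h1 h2; lia.
Qed.

(** Each power 2 ^ e with e <= log T divides at most T / 2 ^ e of the numbers up to T. *)
Lemma sum_v2 T : (\sum_(c < T) 2 ^ logn 2 c.+1 <= T * (trunc_log 2 T).+1)%N.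
Proof.
case: (posnP T) => [->|T0]; first by rewrite big_ord0.
apply: (@leq_trans (\sum_(c < T) \sum_(e < (trunc_log 2 T).+1) (2 ^ e %| c.+1) * 2 ^ e)%N).
  apply: leq_sum => c _.
  have h : (logn 2 c.+1 < (trunc_log 2 T).+1)%N.
    rewrite ltnS; apply: trunc_log_max => //; apply: leq_trans (ltn_ord c).
    by apply: dvdn_leq => //; rewrite pfactor_dvdn.
  by rewrite (bigD1 (Ordinal h)) //= pfactor_dvdn // leqnn mul1n leq_addr.
rewrite exchange_big /= mulnC -[X in (_ <= X * _)%N]card_ord -sum_nat_const.
apply: leq_sum => e _; rewrite -big_distrl /=.
rewrite (_ : \sum_(i < T) _ = T %/ 2 ^ e)%N; first exact: leq_divM.
by rewrite divn_count_dvd big_add1 big_mkord.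
Qed.

Lemma sum_ord_split (A : nmodType) m n (f : nat -> A) : (m <= n)%N ->
  \sum_(i < n) f i = \sum_(i < n - m) f i + \sum_(i < m) f (n - m + i)%N.
Proof. 
by move=> mn; transitivity (\sum_(i < n - m + m) f i);
  [rewrite subnK|rewrite big_split_ord].
Qed.

Section DivisionSpec.
Context (F : fieldType) (W V : nat).
Hypothesis V_ge : (250 <= V)%N.
Hypothesis W_ge : (V ^ wlim <= W)%N.
Implicit Types (s : store F).
Let wp := @wp F W V.
Context (a b J T ST : nat) (FD : nat -> nat).
Hypotheses (a_gt0 : (0 < a)%N) (aV : (a <= V)%N) (JV : (J <= V)%N).
Hypotheses (STE : ST = (2 * T)%N) (TV : (T < V)%N).

(** Columns and rows have ST = 2 T entries, because the window of a block may reach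
    beyond T.  FD j is the time of the leading monomial of row j. *)
Definition sizes_ok s : Prop :=
  (wtab s 0 1 = a) * (wtab s 0 2 = b) * (wtab s vT 0 = T) * (wtab s vJ 0 = J) *
  (wtab s vST 0 = ST) * (forall k, (k < J)%N -> wtab s aFD k = FD k).

Lemma sizes_frame ws fs s s' : frame ws fs s s' ->
  ~~ has (mem ws) [:: 0%N; vT; vJ; vST; aFD] -> sizes_ok s -> sizes_ok s'.
Proof.
move=> f /=; rewrite !negb_or => /and5P[h1 h2 h3 h4 /andP[h5 _]] p.
by do ![split] => *; rewrite f.1 // p.
Qed.

Definition U_ s k t : F := ftab s aU (k * ST + t)%N.
Definition Q_ s k t : F := ftab s aQ (k * ST + t)%N.
Definition G_ s j k d : F := ftab s aG ((j * J + k) * ST + d)%N.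
Definition active t k : bool := (FD k < T - t)%N.

(** The order in which the columns are reduced: by decreasing fractional part of
    b * k / a, the larger column first. *)
Definition later k j : bool :=
  ((b * k) %% a < (b * j) %% a)%N || ((b * k) %% a == (b * j) %% a)%N && (k < j)%N.

(** The columns treated before step (x, y) of the two loops: the outer one runs over the
    values of b k mod a downwards, the inner one over the columns downwards. *)
Definition doneK x y k : bool :=
  (a - 1 - (b * k) %% a < x)%N || (a - 1 - (b * k) %% a == x)%N && (J - 1 - k < y)%N.

Lemma doneK_later x y k : (y < J)%N -> (k < J)%N ->
  (a - 1 - (b * (J - 1 - y)) %% a)%N = x -> doneK x y k -> later k (J - 1 - y) -> False.
Proof.
move=> yJ kJ <-; rewrite /doneK /later.
have := ltn_pmod (b * k) a_gt0; have := ltn_pmod (b * (J - 1 - y)) a_gt0.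
move: ((b * k) %% a)%N ((b * (J - 1 - y)) %% a)%N => u v.
clear -yJ kJ; lia.
Qed.

(** Inside slot t only the entries 0 of the rows matter. *)
Definition slot_inv s0 t (dn : nat -> bool) s : Prop :=
  [/\ forall k, (k < J)%N -> U_ s k t = U_ s0 k t - \sum_(j < J) Q_ s j t * G_ s0 j k 0,
      forall k, (k < J)%N -> ~~ dn k -> Q_ s k t = 0,
      forall k, (k < J)%N -> dn k -> if active t k then U_ s k t = 0 else Q_ s k t = 0 &
      forall k t', (k < J)%N -> (t' < ST)%N -> t' != t ->
        U_ s k t' = U_ s0 k t' /\ Q_ s k t' = Q_ s0 k t'].

Lemma slot_inv_ext s0 t dn dn' s : (forall k, (k < J)%N -> dn k = dn' k) ->
  slot_inv s0 t dn s -> slot_inv s0 t dn' s.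
Proof.
move=> e [h1 h2 h3 h4]; split=> // k kJ; first by rewrite -e //; apply: h2.
by rewrite -e //; apply: h3.
Qed.

(** A row changes, within the slot, only columns that are treated after its own, so an
    entry that has been cleared stays 0. *)
Lemma slot_spec t s : sizes_ok s -> wtab s vtau 0 = t -> (t < T)%N ->
  (forall k, (k < J)%N -> Q_ s k t = 0) ->
  (forall k, (k < J)%N -> G_ s k k 0 = 1) ->
  (forall j k, (j < J)%N -> (k < J)%N -> j != k -> G_ s j k 0 != 0 -> later k j) ->
  forall Q, (forall d s', (d <= 400 * (a * J + J * J + a + J + 1))%N ->
    frame [:: vx; vyy; vck; vk2] [:: aU; aQ] s s' ->
    slot_inv s t (fun=> true) s' -> Q d s') ->
  wp slot_cmd s Q.
Proof.
move=> so et tT Q0 G1 G2 Q hQ.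
have tS : (t < ST)%N by lia.
pose ws := [:: vx; vyy; vck; vk2]; pose fs := [:: aU; aQ].
pose match' x y : bool := (a - 1 - (b * (J - 1 - y)) %% a == x)%N.
pose cost x := (60 * J.+1 + \sum_(y < J) (60 + match' x y * (100 * J.+1)))%N.
pose P x s1 := slot_inv s t (doneK x 0) s1.
have P0 : P 0%N s.
  split=> // k kJ; last by rewrite /doneK andbF ltn0.
    by rewrite big1 ?subr0 // => j _; rewrite Q0 ?mul0r.
  by move=> _; apply: Q0.
apply: (@wp_for F W V V_ge W_ge vx _ _ ws fs a cost P) => //=; first by rewrite so.
  move=> x s1 xa f1 x1 P1.
  have so1 : sizes_ok s1 by apply: sizes_frame f1 _ so.
  pose P' y s2 := slot_inv s t (doneK x y) s2.
  apply: (@wp_for F W V V_ge W_ge vyy _ _ [:: vyy; vck; vk2] fs J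
     (fun y => 60 + match' x y * (100 * J.+1))%N P') => //=; first by rewrite so1.
  - move=> y s2 yJ f2 x2 P2.
    have so2 : sizes_ok s2 by apply: sizes_frame f2 _ so1.
    set k0 := (J - 1 - y)%N; have k0J : (k0 < J)%N by rewrite /k0; lia.
    have e2 : (wtab s2 vx 0 = x) * (wtab s2 vtau 0 = t) * (wtab s2 vyy 0 = y).
      by rewrite x2 f2.1 // x1 f2.1 // f1.1 // et.
    have E2 := (so2, e2).
    wset E2 k0; first by rewrite /k0; lia.
    set s3 := setw _ _ _ _.
    have f3 : frame [:: vck] [::] s2 s3 by rewrite /s3; fr.
    have so3 : sizes_ok s3 by apply: sizes_frame f3 _ so2.
    have e3 : (wtab s3 vx 0 = x) * (wtab s3 vtau 0 = t) * (wtab s3 vyy 0 = y) * (wtab s3 vck 0 = k0).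
      by rewrite /s3; do ![split]; rd E2.
    have P3 : P' y s3 by [].
    clearbody s3.
    have E3 := (so3, e3).
    have rk : ((b * k0) %% a < a)%N by rewrite ltn_mod.
    have othr k : (k < J)%N -> k != k0 -> doneK x y.+1 k = doneK x y k.
      by move=> kJ kk; rewrite /doneK; congr (_ || _ && _); move: kk; rewrite /k0; lia.
    apply: (wp_if V_ge W_ge) => //=; rewrite modn_sub !E3.
    case: ifP => mt; last first.
      apply: wp_skip; split; [by rewrite /=; lia|by frt f3; fr|by rewrite f3.1|].
      apply: slot_inv_ext P3 => k kJ; have [->|kk] := eqVneq k k0; last by rewrite othr.
      rewrite /doneK; congr (_ || _).
      by rewrite (_ : (a - 1 - _ == x)%N = false) //; move/eqP: mt; lia.
    have mt' : (a - 1 - (b * k0) %% a == x)%N by move/eqP: mt => ->; apply/eqP; lia.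
    have dk0 : doneK x y k0 = false.
      by rewrite /doneK (eqP mt') ltnn eqxx /= /k0; lia.
    have dk1 : doneK x y.+1 k0.
      by rewrite /doneK (eqP mt') ltnn eqxx /= /k0; lia.
    have m1 : match' x y = true by [].
    rewrite m1 mul1n.
    have [p1 p2 p3 p4] := P3.
    apply: (wp_if V_ge W_ge) => //=; rewrite !E3 //.
    case: ifP => act; last first.
      apply: wp_skip; split; [by rewrite /=; lia|by frt f3; fr|by rewrite f3.1|].
      split=> // k kJ; have [->|kk] := eqVneq k k0.
      + by rewrite dk1.
      + by rewrite othr //; apply: p2.
      + by move=> _; rewrite /active act; apply: p2; rewrite ?dk0.
      + by rewrite othr //; apply: p3.
    have k0S : (k0 * ST + t = k0 * ST + t)%N by [].
    apply: wp_seq; fput E3 (k0 * ST + t)%N (U_ s3 k0 t) => //; first by rd E3.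
    set s4 := setf _ _ _ _.
    have f4 : frame [::] [:: aQ] s3 s4 by rewrite /s4; fr.
    have so4 : sizes_ok s4 by apply: sizes_frame f4 _ so3.
    set q := U_ s3 k0 t.
    have Q4 k t' : (t' < ST)%N -> Q_ s4 k t' = if (k == k0) && (t' == t) then q else Q_ s3 k t'.
      by move=> tS'; rewrite /s4 /Q_ /setf /upd /= cell_eq.
    have U4 k t' : U_ s4 k t' = U_ s3 k t' by [].
    clearbody s4.
    have e4 : (wtab s4 vx 0 = x) * (wtab s4 vtau 0 = t) * (wtab s4 vyy 0 = y) * (wtab s4 vck 0 = k0).
      by rewrite !f4.1 // !e3.
    pose P4 i s5 := forall k t', (k < J)%N -> (t' < ST)%N ->
      U_ s5 k t' = U_ s4 k t' - (if (k < i)%N && (t' == t) then q * G_ s k0 k 0 else 0).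
    apply: (@wp_for F W V V_ge W_ge vk2 _ _ [:: vk2] [:: aU] J (fun=> 60%N) P4) => //=.
    + by rewrite so4.
    + by move=> k t' _ _; rewrite subr0.
    + move=> i s5 iJ f5 x5 P5.
      have so5 : sizes_ok s5 by apply: sizes_frame f5 _ so4.
      have E5 : (wtab s5 vtau 0 = t) * (wtab s5 vck 0 = k0) * (wtab s5 vk2 0 = i) *
          (ftab s5 aQ (k0 * ST + t)%N = q) * (forall p, ftab s5 aG p = ftab s aG p).
        rewrite x5 !f5.1 // !e4; do ![split] => //.
          by rewrite f5.2 // -/(Q_ s4 k0 t) Q4 // !eqxx.
        by move=> p; rewrite f5.2 // f4.2 // f3.2 // f2.2 // f1.2.
      have E5' := (so5, E5).
      fput E5' (i * ST + t)%N (U_ s5 i t - q * G_ s k0 i 0) => //.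
        by rd E5'; rewrite /U_ /G_ addn0.
      split; [by []|fr|by rd E5'|].
      move=> k t' kJ tS'; rewrite /U_ /setf /upd /= cell_eq //.
      case: andP => [[/eqP -> /eqP ->]|h].
        by have := P5 i t iJ tS; rewrite ltnn /= subr0 /U_ ltnSn eqxx => ->.
      rewrite -/(U_ s5 k t') P5 //; congr (_ - _); case: (t' =P t) => tt; last by rewrite !andbF.
      rewrite !andbT; have ki : k <> i by move=> e; apply: h; rewrite e tt !eqxx.
      by congr (if _ then _ else _); lia.
    + move=> d5 s5 hd5 f5 P5.
      split.
      * by move: hd5; rewrite sum_nat_const card_ord /=; lia.
      * by frt f5; frt f4; frt f3; fr.
      * by rewrite f5.1 // e4.
      have Q5 k t' : Q_ s5 k t' = Q_ s4 k t' by rewrite /Q_ f5.2.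
      have U5 k : (k < J)%N -> U_ s5 k t = U_ s3 k t - q * G_ s k0 k 0.
        by move=> kJ; rewrite P5 // kJ eqxx U4.
      split.
      * move=> k kJ; rewrite U5 // p1 // -addrA -opprD; congr (_ - _).
        rewrite (bigD1 (Ordinal k0J)) //= [in RHS](bigD1 (Ordinal k0J)) //=.
        rewrite Q5 Q4 // !eqxx /= p2 ?dk0 // mul0r add0r addrC; congr (_ + _).
        apply: eq_bigr => j jk; rewrite Q5 Q4 // ifF //.
        by apply/negbTE; rewrite negb_and; apply/orP; left; apply: contra jk => /eqP e; apply/eqP/val_inj.
      * move=> k kJ nd; have kk : k != k0 by apply: contraNneq nd => ->.
        by rewrite Q5 Q4 // (negbTE kk) /=; apply: p2 => //; rewrite -othr.
      * move=> k kJ; have [->|kk] := eqVneq k k0.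
          by rewrite /active act U5 // G1 // mulr1 subrr.
        rewrite othr // => dk; have := p3 k kJ dk; rewrite U5 // Q5 Q4 // (negbTE kk) /=.
        case: ifP => // _ ->; rewrite sub0r.
        have [->|g] := eqVneq (G_ s k0 k 0) 0; first by rewrite mulr0 oppr0.
        have := G2 k0 k k0J kJ; rewrite eq_sym kk => /(_ isT g).
        move=> lt; exfalso.
        exact: doneK_later yJ kJ (eqP mt') dk lt.
      * move=> k t' kJ tS' tt; rewrite P5 // U4 Q5 Q4 // (negbTE tt) !andbF subr0.
        exact: p4.
  - move=> d2 s2 hd2 f2 P2; split.
    + by move: hd2; rewrite /cost /=; lia.
    + by frt f2; fr.
    + by rewrite f2.1.
    + apply: slot_inv_ext P2 => k kJ; rewrite /doneK ltnS leq_eqVlt andbF orbF.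
      by rewrite orbC (_ : J - 1 - k < J)%N ?andbT //; lia.
move=> d s' hd fr' P1; apply: hQ => //.
  apply: leq_trans hd _; rewrite /cost big_split /= sum_nat_const card_ord.
  have : (\sum_(i < a) \sum_(y < J) (60 + match' i y * (100 * J.+1)) <=
          a * (60 * J) + J * (100 * J.+1))%N.
    under eq_bigr => i _ do rewrite big_split /= sum_nat_const card_ord.
    rewrite big_split /= sum_nat_const card_ord exchange_big /=.
    apply: leq_add; first by rewrite mulnA mulnC mulnCA mulnA mulnC [(J * _)%N]mulnC.
    rewrite -[X in (_ <= X * _)%N]card_ord -sum_nat_const; apply: leq_sum => y _.
    rewrite -big_distrl /= -[X in (_ <= X)%N]mul1n leq_mul2r; apply/orP; right.
    have ya : (a - 1 - (b * (J - 1 - y)) %% a < a)%N by lia.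
    rewrite (bigD1 (Ordinal ya)) //= /match' eqxx big1 ?addn0 // => i.
    by move=> hi; rewrite (_ : (_ == _ :> nat) = false) //; apply: contraNF hi => /eqP e; apply/eqP/val_inj.
  set y := (\sum_(i < a) _)%N; rewrite /= => h; lia.
apply: slot_inv_ext P1 => k kJ; rewrite /doneK.
by have : ((b * k) %% a < a)%N; [rewrite ltn_mod|lia].
Qed.

Section Rounds.
Context (r : nat).
Hypothesis r23 : (r == 2)%N || (r == 3)%N.
Hypothesis r_unit : r%:R != 0 :> F.
Let S L := (r ^ (nuof r L + 2 * depth (nuof r L)))%N.
Hypothesis S_le : forall L, (0 < L <= T)%N -> (S L + S L <= V)%N.
Let r_gt1 : (1 < r)%N. Proof. by case/orP: r23 => /eqP ->. Qed.

(** Bounds the logarithm of every block length. *)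
Definition logsize : nat := (nuof r T).+1.
Let X := logsize.
Definition block_const : nat := 2000 * (1000 * (1000 * 12)).

Lemma nuof_mono L : (L <= T)%N -> (nuof r L <= nuof r T)%N.
Proof.
move=> LT; rewrite leqNgt -nuof_lt // -leqNgt.
by apply: leq_trans (nuof_le r23 T); lia.
Qed.

Lemma block_cost L : (0 < L <= T)%N ->
  (2000 * (1000 * ((S L).+1 * (nuof r L).+1 ^ 2)) <= block_const * (L * X ^ 6))%N.
Proof.
move=> /andP[L0 LT]; rewrite /block_const -!mulnA leq_mul2l /= leq_mul2l /=.
have nuX : ((nuof r L).+1 <= X)%N by rewrite ltnS nuof_mono.
have -> : (1000 * (12 * (L * X ^ 6)) = 1000 * (12 * (L * X ^ 4)) * X ^ 2)%N.
  rewrite (_ : X ^ 6 = X ^ 4 * X ^ 2)%N; last by rewrite -expnD.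
  by move: (X ^ 4)%N (X ^ 2)%N => u v; ring.
apply: leq_mul; last by rewrite leq_exp2r.
have h1 : (S L <= r ^ nuof r L * (16 * nuof r L ^ 4))%N.
  apply: depth_bound; first by case/orP: r23 => /eqP ->.
  by apply: leq_trans (nuof_ge5 r23 L).
have h2 := nuof_size r23 L.
have h3 : (3 * (4 * L + 243) <= 741 * L)%N by lia.
have h4 : (nuof r L ^ 4 <= X ^ 4)%N by rewrite leq_exp2r // ltnW.
have h5 : (S L <= 741 * L * (16 * X ^ 4))%N.
  by apply: leq_trans h1 _; apply: leq_mul; [apply: leq_trans h3|rewrite leq_mul2l].
have h6 : (0 < L * X ^ 4)%N by rewrite muln_gt0 L0 expn_gt0.
move: (X ^ 4)%N h5 h6 => u h5 h6; lia.
Qed.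

Lemma log_le e : (2 ^ e <= T)%N -> (e <= 2 * X)%N.
Proof.
move=> h; rewrite -(leq_exp2l _ _ (isT : 1 < 2)%N) expnM.
apply: leq_trans h _; apply: (@leq_trans (r ^ nuof r T)%N).
  by apply: leq_trans (nuof_le r23 T); clear; lia.
apply: (@leq_trans (r ^ X)%N); first by rewrite leq_exp2l.
by rewrite leq_exp2r //; case/orP: r23 => /eqP ->.
Qed.

Notation wsM := [:: vnu; vcnt; vbeta; vk; vN; vB; vK; vR; vg; vh; vsz; vs; vm; vrs;
  vp; vl; vy; vit; ve; vbase; vsh; vi; vlev; vD; aStk; vx; vyy; vck; vk2; vtau; vc;
  vL; vnu1; aPow; vcj] (only parsing).
Notation fsM := [:: aA; aB; aC; aT; fkinv; facc; aU; aQ; aRI] (only parsing).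

(** The number of digits whose products entry t has received after c rounds. *)
Definition known (c t : nat) : nat := if (t < c)%N then t.+1 else bs c t.

Definition rounds_inv s0 c s : Prop :=
  [/\ forall j t, (j < J)%N -> (c <= t)%N -> (t < ST)%N -> Q_ s j t = 0,
      forall k t, (k < J)%N -> (t < c)%N -> if active t k then U_ s k t = 0 else Q_ s k t = 0 &
      forall k t, (k < J)%N -> (t < ST)%N ->
        U_ s k t = U_ s0 k t -
          \sum_(j < J) \sum_(i < known c t) Q_ s j i * G_ s0 j k (t - i)].

Definition round_cost c : nat :=
  (2000 * ((a + J + 1) ^ 2 * X) + J * J * (block_const * (2 ^ logn 2 c.+1 * X ^ 6)))%N.

Lemma division_spec s : sizes_ok s -> wtab s vr 0 = r ->
  (r == 2)%N && (ftab s fz 0 == 0) || (r == 3)%N && (ftab s fz 0 == 1) ->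
  ftab s frinv 0 = r%:R^-1 ->
  (forall k t, (k < J)%N -> (t < ST)%N -> Q_ s k t = 0) ->
  (forall k, (k < J)%N -> G_ s k k 0 = 1) ->
  (forall j k, (j < J)%N -> (k < J)%N -> j != k -> G_ s j k 0 != 0 -> later k j) ->
  forall Q, (forall d s', (d <= 30 * T.+1 + \sum_(c < T) round_cost c)%N ->
    frame wsM fsM s s' -> rounds_inv s T s' -> Q d s') ->
  wp division_cmd s Q.
Proof.
move=> so er ez eri Q0 G1 G2 Q hQ.
apply: (@wp_for F W V V_ge W_ge vtau _ _ wsM fsM T round_cost (rounds_inv s)) => //=;
  [by rewrite so|by lia| | |].
- split=> // [j t jJ _ tS|k t kJ tS]; first by apply: Q0.
  by rewrite big1 ?subr0 // => j _; rewrite big_ord0.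
- move=> c s1 cT f1 x1 [p1 p2 p3].
  have so1 : sizes_ok s1 by apply: sizes_frame f1 _ so.
  have cS : (c < ST)%N by lia.
  have Gs s' fs' ws' k j d : frame ws' fs' s s' -> aG \notin fs' -> G_ s' j k d = G_ s j k d.
    by move=> f h; rewrite /G_ f.2.
  have fG1 := Gs _ _ _ _ _ _ f1.
  apply: wp_seq; apply: (slot_spec so1 x1 cT).
  + by move=> k kJ; apply: p1.
  + by move=> k kJ; rewrite fG1 // G1.
  + by move=> j k jJ kJ jk; rewrite fG1 //; apply: G2.
  move=> d2 s2 hd2 f2 [h1 _ h2 h3].
  have so2 : sizes_ok s2 by apply: sizes_frame f2 _ so1.
  have x2 : wtab s2 vtau 0 = c by rewrite f2.1.
  wset x2 c.+1; [by rewrite addn1|by lia|].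
  set s3 := setw _ _ _ _.
  have f3 : frame [:: vc] [::] s2 s3 by rewrite /s3; fr.
  have c3 : wtab s3 vc 0 = c.+1 by rewrite /s3; rd x2.
  clearbody s3.
  apply: wp_seq; apply: (@v2_spec F W V V_ge W_ge c.+1) => //; first by lia.
  set L := (2 ^ logn 2 c.+1)%N.
  move=> d4 s4 hd4 f4 L4.
  have L0 : (0 < L)%N by rewrite expn_gt0.
  have Lc : (L <= c.+1)%N by apply: dvdn_leq => //; rewrite pfactor_dvdn.
  have LT : (0 < L <= T)%N by lia.
  have SV := S_le LT.
  have f14 : frame [:: vx; vyy; vck; vk2; vc; vL] [:: aU; aQ] s1 s4.
    by frt f4; frt f3; frt f2; fr.
  apply: wp_seq; apply: (@pow_spec F W V V_ge W_ge r r23 r_unit L) => //.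
  + by rewrite f14.1 // f1.1.
  + by rewrite f14.2 // f1.2.
  + by rewrite f14.2 // f1.2.
  + by apply: leq_trans SV; apply: leq_trans (leq_addl _ _); rewrite leq_exp2l // leq_addr.
  move=> d5 s5 hd5 f5 rad5 nu5.
  have f25 : frame [:: vc; vL; vnu1; aPow] [:: aRI] s2 s5 by frt f5; frt f4; frt f3; fr.
  have so5 : sizes_ok s5 by apply: sizes_frame f25 _ so2.
  have U5 k t : U_ s5 k t = U_ s2 k t by rewrite /U_ f25.2.
  have Q5 k t : Q_ s5 k t = Q_ s2 k t by rewrite /Q_ f25.2.
  have E5 : (wtab s5 vnu1 0 = nuof r L) * (wtab s5 vL 0 = L) * (wtab s5 vc 0 = c.+1).
    by rewrite nu5 f5.1 // L4 f5.1 // f4.1.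
  pose delta j k t := \sum_(i < L) Q_ s5 j (c.+1 - L + i) * G_ s j k (L + (t - c.+1) - i).
  pose P1 i s' := forall k t, (k < J)%N -> (t < ST)%N ->
    U_ s' k t = U_ s5 k t -
      if (c.+1 <= t < c.+1 + L)%N then \sum_(j < i) delta j k t else 0.
  pose wsI := [:: vcj; vck; vnu; vcnt; vbeta; vk; vN; vB; vK; vR; vg; vh; vsz; vs; vm; vrs;
    vp; vl; vy; vit; ve; vbase; vsh; vi; vlev; vD; aStk].
  pose fsI := [:: aA; aB; aC; aT; fkinv; facc; aU].
  pose bc := (block_const * (L * X ^ 6))%N.
  apply: (@wp_for F W V V_ge W_ge vcj _ _ wsI fsI J (fun=> 60 * J.+1 + J * bc)%N P1) => //=.
  + by rewrite so5.
  + by move=> k t _ _; rewrite big_ord0 if_same subr0.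
  + move=> j s6 jJ f6 x6 q6.
    have so6 : sizes_ok s6 by apply: sizes_frame f6 _ so5.
    pose P2 i s' := forall k t, (k < J)%N -> (t < ST)%N ->
      U_ s' k t = U_ s5 k t -
        if (c.+1 <= t < c.+1 + L)%N
        then \sum_(j' < j) delta j' k t + (if (k < i)%N then delta j k t else 0) else 0.
    apply: (@wp_for F W V V_ge W_ge vck _ _ (behead wsI) fsI J (fun=> bc) P2) => //=.
    * by rewrite so6.
    * by move=> k t kJ tS; rewrite q6 // addr0.
    * move=> k s7 kJ f7 x7 q7.
      have so7 : sizes_ok s7 by apply: sizes_frame f7 _ so6.
      have f57 : frame wsI fsI s5 s7 by frt f7; exact: f6.
      have E7 : (wtab s7 vnu1 0 = nuof r L) * (wtab s7 vL 0 = L) * (wtab s7 vc 0 = c.+1) *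
          (wtab s7 vcj 0 = j).
        by do ![split]; first [by rewrite f57.1 ?E5|by rewrite f7.1].
      apply: (@block_spec F W V V_ge W_ge r r23 r_unit c.+1 L j k J ST); rewrite ?E7 ?so7 //.
        by apply: radix_frame f57 _ _ _ _ rad5.
      move=> d8 s8 hd8 f8 h8; split.
      -- by apply: leq_trans hd8 _; apply: block_cost.
      -- by frt f8; fr.
      -- by rewrite f8.1.
      move=> k' t k'J tS; rewrite /U_ h8 cell_in //; last by lia.
      rewrite -/(U_ s7 k' t) q7 //; have [->|kk] := eqVneq k k'; last first.
        by rewrite (_ : (k' < k.+1)%N = (k' < k)%N) //; lia.
      rewrite -!/(U_ _ _ _) ltnn ltnSn addr0 /=.
      case: (boolP (c < t < c.+1 + L)%N) => ht; rewrite ?ht ?(negbTE ht) //.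
      rewrite opprD addrA; congr (_ - _); rewrite /delta; apply: eq_bigr => i _.
      rewrite /Q_ /G_ !(f57.2 aQ) // !(f57.2 aG) // !(f25.2 aG) // !(f2.2 aG) // !(f1.2 aG) //.
      by congr (_ * ftab s aG (_ + (_ + _ - _))%N); lia.
    * move=> d8 s8 hd8 f8 h8; split.
      -- by move: hd8; rewrite sum_nat_const card_ord /=; lia.
      -- by frt f8; fr.
      -- by rewrite f8.1.
      -- by move=> k t kJ tS; rewrite h8 // kJ big_ord_recr.
  + move=> d6 s6 hd6 f6 q6.
    have f26 : frame (wsI ++ [:: vc; vL; vnu1; aPow]) (aRI :: fsI) s2 s6 by frt f6; frt f25; fr.
    have Q6 k t : Q_ s6 k t = Q_ s2 k t by rewrite /Q_ f26.2.
    split.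
    * have e1 : (logn 2 c.+1 <= 2 * X)%N by apply: log_le; move: LT; rewrite -/L; lia.
      have e3 z : (J * (60 * J.+1 + J * z) = 60 * (J * J) + 60 * J + J * J * z)%N.
        by rewrite mulnDr [(J * (J * z))%N]mulnA; lia.
      have e2 : ((nuof r L).+1 <= X)%N by rewrite ltnS nuof_mono //; lia.
      move: hd2 hd4 hd5 hd6; rewrite sum_nat_const card_ord /round_cost -/L -/bc e3.
      have y0 : (J * J <= (a + J + 1) ^ 2)%N by rewrite -mulnn; lia.
      have y1 : (a * J + J * J + a + J + 1 <= (a + J + 1) ^ 2)%N by rewrite -mulnn; lia.
      have y2 : ((a + J + 1) ^ 2 <= (a + J + 1) ^ 2 * X)%N by rewrite leq_pmulr.
      have y3 : (X <= (a + J + 1) ^ 2 * X)%N by rewrite leq_pmull // expn_gt0 addn1.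
      move: ((a + J + 1) ^ 2)%N y0 y1 y2 y3 => z y0 y1 y2 y3.
      move: (z * X)%N y2 y3 => zX y2 y3; rewrite /=.
      move: (logn 2 c.+1) e1 (nuof r L).+1 e2 (J * J * bc)%N => e e1 nn e2 jb.
      clear -y0 y1 y2 y3 e1 e2; lia.
    * by frt f26; frt f2; fr.
    * by rewrite f26.1.
    split.
    * move=> j t jJ ct tS; rewrite Q6.
      have [_ ->] := h3 j t jJ tS ltac:(by rewrite neq_ltn ct orbT).
      by apply: p1 => //; apply: ltnW.
    * have Uold k t : (k < J)%N -> (t < c.+1)%N -> U_ s6 k t = U_ s2 k t.
        move=> kJ tc; rewrite q6 //; last by lia.
        by rewrite U5 ifF ?subr0 //; lia.
      move=> k t kJ tc; rewrite Uold // Q6.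
      move: tc; rewrite ltnS leq_eqVlt => /orP[/eqP ->|tc]; first exact: h2.
      have tS : (t < ST)%N by lia.
      have tne : t != c by rewrite neq_ltn tc.
      by have [-> ->] := h3 k t kJ tS tne; apply: p2.
    * move=> k t kJ tS; rewrite q6 // U5.
      have Qold j i : (j < J)%N -> (i < c)%N -> Q_ s6 j i = Q_ s1 j i.
        move=> jJ ic; rewrite Q6; have iS : (i < ST)%N by lia.
        by have [_ ->] := h3 j i jJ iS ltac:(by rewrite neq_ltn ic).
      have [tc|tc] := eqVneq t c.
        rewrite tc ifF ?subr0; last by lia.
        rewrite h1 // p3 // /known ltnn ltnSn bs_self -addrA -opprD -big_split /=.
        congr (_ - _); apply: eq_bigr => j _; rewrite big_ord_recr /= subnn Q6 fG1 //.
        by congr (_ + _); apply: eq_bigr => i _; rewrite Qold.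
      have [-> _] := h3 k t kJ tS tc; rewrite p3 // -addrA -opprD; congr (_ - _).
      case: ifP => ht.
        have kn : known c t = (c.+1 - L)%N by rewrite /known ifF ?bs_block //; lia.
        have kn' : known c.+1 t = c.+1.
          by rewrite /known ifF /=; [rewrite ifT //; case/andP: ht|lia].
        rewrite kn kn' -big_split /=; apply: eq_bigr => j _.
        rewrite (sum_ord_split (fun i => Q_ s6 j i * G_ s j k (t - i)) Lc).
        congr (_ + _); first by apply: eq_bigr => i _; rewrite Qold //; have := ltn_ord i; lia.
        apply: eq_bigr => i _; rewrite Q6 Q5; congr (_ * G_ _ _ _ _).
        by have := ltn_ord i; lia.
      rewrite addr0; have -> : known c.+1 t = known c t.
        rewrite /known ltnS leq_eqVlt (negbTE tc) orFb; case: ifP => // tc'.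
        by apply: bs_step; rewrite -/L; move: ht; lia.
      apply: eq_bigr => j _; apply: eq_bigr => i _; rewrite Qold //.
      move: (nat_of_ord i) (ltn_ord i) => z; rewrite /known.
      case: ifP => [h h'|_ h']; first by lia.
      exact: leq_trans h' (bs_le _ _).
move=> d s' hd fr' hi; apply: hQ => //; apply: leq_trans hd _; rewrite leq_add2r /=; lia.
Qed.

End Rounds.

End DivisionSpec.

(** * Monomials, leading monomials and normal forms *)

Section Bivariate.
Context (F : fieldType).
Implicit Types (p g h : {poly {poly F}}) (u v : nat * nat).

Lemma coefXY_ext p g : (forall u, coefXY p u = coefXY g u) -> p = g.
Proof. by move=> e; apply/polyP => i; apply/polyP => j; apply: (e (i, j)). Qed.

Lemma coefXYB p g u : coefXY (p - g) u = coefXY p u - coefXY g u.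
Proof. by rewrite /coefXY !coefB. Qed.

Lemma coefXY0 u : coefXY (0 : {poly {poly F}}) u = 0.
Proof. by rewrite /coefXY !coef0. Qed.

Lemma coefXY_sum I (r : seq I) (P : pred I) (f : I -> {poly {poly F}}) u :
  coefXY (\sum_(i <- r | P i) f i) u = \sum_(i <- r | P i) coefXY (f i) u.
Proof. by rewrite /coefXY !coef_sum. Qed.

Lemma coefXY_mon (c : F) u v : coefXY (monXY c u) v = if v == u then c else 0.
Proof.
rewrite /coefXY /monXY !coefZ coefXn; case: u v => [i j] [i' j'] /=.
rewrite xpair_eqE; case: eqP => _ /=; last by rewrite mulr0 coef0.
by rewrite mulr1 coefZ coefXn; case: eqP => _; rewrite ?mulr1 ?mulr0.
Qed.

Lemma mem_supp p u : (u \in supp p) = (coefXY p u != 0).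
Proof.
rewrite /supp mem_filter; apply: andb_idr => pu; case: u pu => i j pu.
apply/allpairsP; exists (i, j); rewrite !mem_iota !add0n /=; split=> //.
  rewrite ltnNge; apply: contraNN pu => h; rewrite /coefXY /=.
  by rewrite [p`_i]nth_default // coef0.
rewrite ltnNge; apply: contraNN pu => h; rewrite /coefXY /= nth_default //.
by apply: leq_trans h; apply: max_size_coefXY.
Qed.

Lemma evalXY_mon (c x y : F) u : (monXY c u).[x, y] = c * (x ^+ u.1 * y ^+ u.2).
Proof.
rewrite /monXY hornerZ hornerXn hornerM hornerZ hornerXn -polyC_exp hornerC.
by rewrite mulrAC mulrA.
Qed.

Definition evalXY (z : F * F) p : F := p.[z.1, z.2].

Lemma evalXYB z p g : evalXY z (p - g) = evalXY z p - evalXY z g.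
Proof. by rewrite /evalXY !hornerE. Qed.

Lemma evalXYM z p g : evalXY z (p * g) = evalXY z p * evalXY z g.
Proof. by rewrite /evalXY !hornerE. Qed.

Lemma evalXY_sum z I (r : seq I) (P : pred I) (f : I -> {poly {poly F}}) :
  evalXY z (\sum_(i <- r | P i) f i) = \sum_(i <- r | P i) evalXY z (f i).
Proof. by rewrite /evalXY horner_sum horner_sum. Qed.

End Bivariate.

Section MonomialOrder.
Context (a b : nat).
Implicit Types (u v w : nat * nat).
Local Notation le := (mon_le a b).
Local Notation wd := (wdeg a b).

Lemma mon_le_refl u : le u u.
Proof. by rewrite /mon_le eqxx leqnn orbT. Qed.

Lemma mon_le_total u v : le u v || le v u.
Proof. by rewrite /mon_le; lia. Qed.

Lemma mon_le_trans u v w : le u v -> le v w -> le u w.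
Proof. by rewrite /mon_le; lia. Qed.

Lemma mon_le_wdeg u v : le u v -> (wd u <= wd v)%N.
Proof. by rewrite /mon_le; lia. Qed.

(** Divisibility is compatible with the order because both weights are nonnegative. *)
Lemma mon_dvd_le u v : mon_dvd u v -> le u v.
Proof.
case: u v => [i j] [i' j'] /andP[/= h1 h2]; rewrite /mon_le /wdeg /=.
have : (a * i <= a * i')%N by rewrite leq_mul2l h1 orbT.
have : (b * j <= b * j')%N by rewrite leq_mul2l h2 orbT.
lia.
Qed.

Lemma mon_max (s : seq (nat * nat)) : s != [::] ->
  exists2 u, u \in s & forall v, v \in s -> le v u.
Proof.
elim: s => [//|x s IH] _; case: (eqVneq s [::]) => [->|/IH[u us hu]].
  by exists x; rewrite ?mem_head // => v; rewrite inE => /eqP ->; apply: mon_le_refl.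
case/orP: (mon_le_total x u) => xu.
  exists u; first by rewrite inE us orbT.
  by move=> v; rewrite inE => /orP[/eqP ->//|]; apply: hu.
exists x; first exact: mem_head.
move=> v; rewrite inE => /orP[/eqP ->|vs]; first exact: mon_le_refl.
by apply: mon_le_trans xu; apply: hu.
Qed.

Lemma LM_exists (F : fieldType) (p : {poly {poly F}}) : p != 0 -> exists u, is_LM a b p u.
Proof.
move=> p0; have [|u h1 h2] := @mon_max (supp p); last by exists u.
apply: contraNneq p0 => e; apply/eqP/coefXY_ext => u; rewrite coefXY0.
by apply/eqP/negPn; rewrite -mem_supp e.
Qed.

Hypothesis a_gt0 : (0 < a)%N.

Lemma mon_le_anti u v : le u v -> le v u -> u = v.
Proof.
case: u v => [i j] [i' j']; rewrite /mon_le /wdeg /= => h1 h2.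
have jj : j = j' by lia.
have ii : (a * i = a * i')%N by lia.
by rewrite jj; congr (_, _); apply/eqP; rewrite -(eqn_pmul2l a_gt0) ii.
Qed.

Lemma LM_unique (F : fieldType) (p : {poly {poly F}}) u v :
  is_LM a b p u -> is_LM a b p v -> u = v.
Proof. by move=> [u1 u2] [v1 v2]; apply: mon_le_anti; [apply: v2|apply: u2]. Qed.

(** Monomials of Y-degree below a have distinct weights, a and b being coprime. *)
Lemma wdeg_inj u v : coprime a b -> (u.2 < a)%N -> (v.2 < a)%N -> wd u = wd v -> u = v.
Proof.
case: u v => [i j] [i' j'] /= co ja ja'; rewrite /wdeg /= => e.
suff jj : j = j'.
  rewrite jj; congr (_, _); apply/eqP; rewrite -(eqn_pmul2l a_gt0); apply/eqP.
  by move: e; rewrite jj; lia.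
wlog jj : i j i' j' ja ja' e / (j <= j')%N.
  by move=> W; case/orP: (leq_total j j') => h; [apply: (W i j i' j')|symmetry; apply: (W i' j' i j)].
have h : (a %| j' - j)%N.
  rewrite -(Gauss_dvdr _ co) mulnBr.
  have -> : (b * j' - b * j = a * i - a * i')%N.
    by have : (b * j <= b * j')%N; [rewrite leq_mul2l jj orbT|lia].
  by rewrite -mulnBr dvdn_mulr.
by have := dvdn_leq _ h; lia.
Qed.

End MonomialOrder.

Section GroebnerFacts.
Context (F : finFieldType) (a b n m : nat) (H : {poly {poly F}}) (P : 'I_n -> F * F).
Context (G : seq {poly {poly F}}).
Hypothesis cab : Cab_poly a b H.
Hypothesis HP : forall i, H.[(P i).1, (P i).2] = 0.
Hypothesis gb : reduced_Groebner_basis a b (vanishing_ideal P) G.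
Implicit Types (u v : nat * nat) (g h f : {poly {poly F}}).

Let a_gt0 : (0 < a)%N. Proof. by case: cab => [[]]. Qed.
Let b_gt0 : (0 < b)%N. Proof. by case: cab => [[]]. Qed.
Let co : coprime a b. Proof. by case: cab. Qed.

Definition standard u : Prop :=
  forall g v, g \in G -> is_LM a b g v -> ~~ mon_dvd v u.

Lemma vanish_LM h u : vanishing_ideal P h -> is_LM a b h u -> ~ standard u.
Proof.
move=> hI hu; have [_ [_ hG] _ _] := gb.
have [g [v [gG gv vu]]] := hG h u hI hu.
by move=> /(_ g v gG gv); rewrite vu.
Qed.

Lemma LM_H : is_LM a b H (0%N, a).
Proof.
have [_ _ [h1 h2] h3 _] := cab; split=> // v vH; have := h3 v vH.
rewrite /mon_le /wdeg muln0 add0n [(b * a)%N]mulnC leq_eqVlt => /orP[/eqP e|->] //.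
rewrite e eqxx ltnn /= -(leq_pmul2l b_gt0) [(b * a)%N]mulnC -e; lia.
Qed.

Lemma H_vanish : vanishing_ideal P H. Proof. exact: HP. Qed.

(** X^q - X vanishes at every point, which bounds the X-exponents of normal forms. *)
Definition XqX : {poly {poly F}} := monXY 1 (#|F|, 0)%N - monXY 1 (1, 0)%N.

Lemma XqX_vanish : vanishing_ideal P XqX.
Proof.
move=> i; rewrite /XqX -[LHS]/(evalXY (P i) _) evalXYB /evalXY !evalXY_mon.
by rewrite /= expr0 !mulr1 !mul1r expf_card subrr.
Qed.

Lemma LM_XqX : is_LM a b XqX (#|F|, 0)%N.
Proof.
have q1 : (1 < #|F|)%N by apply: finNzRing_gt1.
have ne : ((#|F|, 0)%N == (1, 0)%N) = false by rewrite xpair_eqE; lia.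
split; first by rewrite mem_supp /XqX coefXYB !coefXY_mon eqxx ne subr0 oner_neq0.
move=> v; rewrite mem_supp /XqX coefXYB !coefXY_mon.
have [->|v1] := eqVneq v (#|F|, 0)%N; first by rewrite mon_le_refl.
have [->|v2] := eqVneq v (1, 0)%N; last by rewrite subr0 eqxx.
rewrite /mon_le /wdeg /= !muln0 !addn0 muln1 => _.
by apply/orP; left; rewrite ltn_Pmulr.
Qed.

Lemma standard_y u : standard u -> (u.2 < a)%N.
Proof.
move=> su; rewrite ltnNge; apply/negP => au.
have [_ [_ hG] _ _] := gb; have [g [v [gG gv vu]]] := hG _ _ H_vanish LM_H.
have /negP[] := su g v gG gv; case/andP: vu => /= v1 v2.
by apply/andP; split; [apply: leq_trans v1 _|apply: leq_trans v2 _].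
Qed.

Lemma standard_x u : standard u -> (u.1 < #|F|)%N.
Proof.
move=> su; rewrite ltnNge; apply/negP => au.
have [_ [_ hG] _ _] := gb; have [g [v [gG gv vu]]] := hG _ _ XqX_vanish LM_XqX.
have /negP[] := su g v gG gv; case/andP: vu => /= v1 v2.
by apply/andP; split; [apply: leq_trans v1 _|apply: leq_trans v2 _].
Qed.

Lemma mem_Bmon u : (u \in Bmon a b m) = (u.2 < a)%N && (wdeg a b u <= m)%N.
Proof.
rewrite /Bmon mem_sort mem_filter andbC; case: (leqP (wdeg a b u) m) => h; last by rewrite !andbF.
rewrite !andbT; case: u h => i j h; apply/allpairsP/idP => [[[i' j'] [/= _ h2 [_ e2]]]|/= ja].
  by move: h2; rewrite e2 mem_iota add0n.
have iN : (i < m.+1)%N.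
  rewrite ltnS; apply: leq_trans h; rewrite /wdeg /=; apply: leq_trans (leq_addr _ _).
  by rewrite leq_pmull.
by exists (i, j); split; rewrite /= -?[(_ :: _)]/(iota 0 m.+1) ?mem_iota ?add0n /=.
Qed.

Lemma uniq_Bmon : uniq (Bmon a b m).
Proof.
rewrite /Bmon sort_uniq filter_uniq // allpairs_uniq ?iota_uniq //.
by move=> [x y] [x' y'].
Qed.

Lemma RR_coef h u : in_RR a b m h -> coefXY h u != 0 -> u \in Bmon a b m.
Proof.
move=> [lam ->]; rewrite coefXY_sum; apply: contraNT => uB; apply/eqP.
by rewrite big1_seq // => v /andP[_ vB]; rewrite coefXY_mon; case: eqP => // e; rewrite e vB in uB.
Qed.

Lemma in_RR_supp f : (forall u, u \in supp f -> u \in Bmon a b m) -> in_RR a b m f.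
Proof.
move=> fB; exists (coefXY f); apply: coefXY_ext => u; rewrite coefXY_sum.
case: (boolP (u \in Bmon a b m)) => uB.
  rewrite (bigD1_seq u) ?uniq_Bmon //= coefXY_mon eqxx big1 ?addr0 // => v vu.
  by rewrite coefXY_mon eq_sym (negbTE vu).
rewrite big1_seq => [|v /andP[_ vB]]; last first.
  by rewrite coefXY_mon; case: eqP => // e; rewrite e vB in uB.
by apply/eqP/negPn; rewrite -mem_supp; apply: contra uB; apply: fB.
Qed.

(** The normal form of a function of L(m P_oo) lies in L(m P_oo): otherwise the
    leading monomial of the difference, which vanishes, would be standard. *)
Lemma normal_form_bound f h u : in_RR a b m h -> vanishing_ideal P (f - h) ->
  (forall v, v \in supp f -> standard v) -> u \in supp f -> u \in Bmon a b m.
Proof.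
move=> hR fh fs uf; rewrite mem_Bmon standard_y /=; last exact: fs.
have f0 : f != 0 by apply: contraTneq uf => ->; rewrite mem_supp coefXY0 eqxx.
have [w [wf wmax]] := LM_exists a b f0.
apply: leq_trans (mon_le_wdeg (wmax u uf)) _; rewrite leqNgt; apply/negP => mw.
have hB v : v \in supp h -> (wdeg a b v <= m)%N.
  by rewrite mem_supp => /(RR_coef hR); rewrite mem_Bmon => /andP[].
have hw : coefXY h w = 0.
  by apply/eqP/negPn; rewrite -mem_supp; apply/negP => /hB; lia.
apply: (vanish_LM fh _ (fs w wf)); split.
  by rewrite mem_supp coefXYB hw subr0 -mem_supp.
move=> v; rewrite mem_supp coefXYB => fhv.
have [vf|vf] := boolP (v \in supp f); first exact: wmax.
have vh : v \in supp h.
  rewrite mem_supp; apply: contraNneq fhv => ->.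
  by rewrite subr0; apply/negPn; rewrite -mem_supp.
by rewrite /mon_le; apply/orP; left; apply: leq_ltn_trans (hB v vh) mw.
Qed.

Local Notation bstep := (fun acc u =>
  if ev P (monXY 1 u) \in <<[seq ev P (monXY 1 v) | v <- acc]>>%VS
  then acc else rcons acc u).

Lemma foldl_sub s acc v : v \in foldl bstep acc s -> v \in acc ++ s.
Proof.
elim: s acc => [|x s IH] acc /=; first by rewrite cats0.
move/IH; rewrite !mem_cat inE; case: ifP => _; last rewrite mem_rcons inE.
  by case/orP => ->; rewrite ?orbT.
by case/orP=> [/orP[]|] ->; rewrite ?orbT.
Qed.

Lemma foldl_keep s acc v : v \in acc -> v \in foldl bstep acc s.
Proof.
elim: s acc => [//|x s IH] acc /= vacc; apply: IH; case: ifP => // _.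
by rewrite mem_rcons inE vacc orbT.
Qed.

Lemma foldl_skip s acc u : u \in s -> u \notin foldl bstep acc s ->
  exists s1 s2, s = s1 ++ u :: s2 /\
    ev P (monXY 1 u) \in <<[seq ev P (monXY 1 v) | v <- foldl bstep acc s1]>>%VS.
Proof.
elim: s acc => [//|x s IH] acc /=; rewrite inE => /orP[/eqP ux|us] nu.
  subst x; exists [::], s; split=> //; move: nu; case: ifP => //= _ nu.
  by case/negP: nu; apply: foldl_keep; rewrite mem_rcons mem_head.
have [s1 [s2 [-> h]]] := IH _ us nu.
by exists (x :: s1), s2.
Qed.

(** If a reduced monomial were rejected, it would lead a polynomial that vanishes at the
    points, and the basis would divide it. *)
Lemma standard_Bhat u : u \in Bmon a b m -> standard u -> u \in Bhat a b m P.
Proof.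
move=> uB su; apply/negPn/negP => nu.
have [s1 [s2 [sE h]]] := foldl_skip uB nu.
set acc := foldl bstep [::] s1 in h.
have accB v : v \in acc -> v \in s1 by move/foldl_sub.
have accwd v : v \in acc -> (wdeg a b v < wdeg a b u)%N.
  move=> /accB vs; have so : sorted (fun u v => (wdeg a b u <= wdeg a b v)%N) (Bmon a b m).
    by apply: sort_sorted => x y; apply: leq_total.
  have tr : transitive (fun u v => (wdeg a b u <= wdeg a b v)%N).
    by move=> x y z; apply: leq_trans.
  have un := uniq_Bmon; rewrite sE in so un.
  have vB : v \in Bmon a b m by rewrite sE mem_cat vs.
  have vu : v != u.
    by apply: contraTneq un => <-; rewrite cat_uniq /= vs !andbF.
  have le : (wdeg a b v <= wdeg a b u)%N.
    move: so; rewrite (sorted_pairwise tr) pairwise_cat => /and3P[/allrelP h1 _ _].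
    by apply: h1; rewrite ?mem_head.
  rewrite ltn_neqAle le andbT; apply: contraNneq vu => e; apply/eqP.
  by move: vB uB; rewrite !mem_Bmon => /andP[v2 _] /andP[u2 _]; apply: wdeg_inj e.
set X := [seq ev P (monXY 1 v) | v <- acc] in h.
have := coord_span (X := in_tuple X) h => hE.
pose lam i := coord (in_tuple X) i (ev P (monXY 1 u)).
pose r := \sum_(i < size X) monXY (lam i) (nth (0, 0)%N acc i).
have szX : size X = size acc by rewrite size_map.
have rs v : coefXY r v != 0 -> v \in acc.
  rewrite coefXY_sum; apply: contraNT => va; rewrite big1 // => i _.
  rewrite coefXY_mon; case: eqP => // e; case/negP: va; rewrite e mem_nth //.
  by rewrite -szX.
have uacc : u \notin acc by apply/negP => /accwd; rewrite ltnn.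
have ru : coefXY r u = 0 by apply/eqP/negPn; apply: contra uacc; apply: rs.
apply: (@vanish_LM (monXY 1 u - r) u _ _ su).
  move=> i; have := congr1 (fun w : 'rV_n => w ord0 i) hE.
  rewrite !mxE => e; rewrite -[LHS]/(evalXY (P i) _) evalXYB {1}/evalXY e.
  rewrite summxE evalXY_sum; apply/eqP; rewrite subr_eq0; apply/eqP.
  apply: eq_bigr => j _; rewrite !mxE /evalXY evalXY_mon -/(lam j); congr (_ * _).
  by rewrite (nth_map (0, 0)%N) -?szX // mxE evalXY_mon mul1r.
split; first by rewrite mem_supp coefXYB coefXY_mon eqxx ru subr0 oner_neq0.
move=> v; rewrite mem_supp coefXYB coefXY_mon.
have [->|_] := eqVneq v u; first by rewrite mon_le_refl.
rewrite sub0r oppr_eq0 => /rs/accwd h'.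
by rewrite /mon_le h'.
Qed.

Theorem normal_form_correct f (c : 'rV[F]_n) : Cab_code a b m P c ->
  (forall i, f.[(P i).1, (P i).2] = c ord0 i) ->
  (forall u, u \in supp f -> standard u) ->
  [/\ in_RR a b m f, standard_form a f & forall u, u \in supp f -> u \in Bhat a b m P].
Proof.
move=> [h hR ch] fP fs.
have fh : vanishing_ideal P (f - h).
  move=> i; rewrite -[LHS]/(evalXY (P i) _) evalXYB {1}/evalXY fP ch mxE.
  by rewrite subrr.
have fB u : u \in supp f -> u \in Bmon a b m by apply: normal_form_bound hR fh fs.
split; first exact: in_RR_supp.
  apply/bigmax_leqP => i _; apply/leq_sizeP => j aj; apply/eqP/negPn.
  have := fs (nat_of_ord i, j); rewrite mem_supp /coefXY /= => h1.
  by apply/negP => h2; have := standard_y (h1 h2); rewrite /=; lia.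
by move=> u uf; apply: standard_Bhat; [apply: fB|apply: fs].
Qed.

End GroebnerFacts.

(** * The staircase of the basis and the division identity *)

Lemma coefXY_monM (F : fieldType) (c : F) v (p : {poly {poly F}}) u :
  coefXY (monXY c v * p) u =
  if mon_dvd v u then c * coefXY p (u.1 - v.1, u.2 - v.2)%N else 0.
Proof.
rewrite /coefXY /monXY /mon_dvd -scalerAl coefZ coefXnM /=.
case: (ltnP u.1 v.1) => h1 /=; first by rewrite mulr0 coef0.
rewrite -scalerAl coefZ coefXnM; case: (ltnP u.2 v.2) => h2 //=; by rewrite mulr0.
Qed.

(** The leading monomial as the program reads it: the first term of the sorted list. *)
Definition lmon (F : fieldType) (a b : nat) (p : {poly {poly F}}) : nat * nat :=
  head (0, 0)%N (sort (fun u v => mon_le a b v u) (supp p)).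

Lemma lmonP (F : fieldType) (a b : nat) (p : {poly {poly F}}) :
  p != 0 -> is_LM a b p (lmon a b p).
Proof.
move=> p0; have [w [ws _]] := LM_exists a b p0.
set s := sort (fun u v => mon_le a b v u) (supp p).
have ss : sorted (fun u v => mon_le a b v u) s.
  by apply: sort_sorted => x y; rewrite orbC mon_le_total.
have tr : transitive (fun u v => mon_le a b v u).
  by move=> x y z h1 h2; apply: mon_le_trans h1.
have mem v : (v \in supp p) = (v \in s) by rewrite mem_sort.
rewrite /lmon -/s; case E : s => [|x t]; first by rewrite mem E in ws.
split; first by rewrite mem E mem_head.
move=> v; rewrite mem E inE => /orP[/eqP ->|vt]; first exact: mon_le_refl.
by move: ss; rewrite E /= (path_sortedE tr) => /andP[/allP /(_ v vt)].
Qed.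

Section Staircase.
Context (F : finFieldType) (a b n : nat) (H : {poly {poly F}}) (P : 'I_n -> F * F).
Context (G : seq {poly {poly F}}).
Hypothesis cab : Cab_poly a b H.
Hypothesis HP : forall i, H.[(P i).1, (P i).2] = 0.
Hypothesis gb : reduced_Groebner_basis a b (vanishing_ideal P) G.
Implicit Types (u v : nat * nat) (g h f : {poly {poly F}}).
Local Notation lm := (lmon a b).
Local Notation q := #|F|.

Let a_gt0 : (0 < a)%N. Proof. by case: cab => [[]]. Qed.

Lemma gb_lm g : g \in G -> is_LM a b g (lm g) /\ coefXY g (lm g) = 1.
Proof.
move=> gG; have [_ _ h _] := gb; have [u gu u1] := h g gG.
have g0 : g != 0.
  by apply/eqP => g0; move: u1; rewrite g0 coefXY0 => /eqP; rewrite eq_sym oner_eq0.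
have := lmonP a b g0 => l; split=> //.
by rewrite (LM_unique a_gt0 l gu).
Qed.

Lemma gb_dvd g g' : g \in G -> g' \in G -> g != g' -> ~~ mon_dvd (lm g') (lm g).
Proof.
move=> gG gG' gg; have [_ _ _ h] := gb.
have [[l1 _] _] := gb_lm gG; have [l2 _] := gb_lm gG'.
exact: h g g' _ _ gG gG' gg l1 l2.
Qed.

Lemma gb_tail g u : g \in G -> u \in supp g -> u != lm g -> standard a b G u.
Proof.
move=> gG ug ul g' v gG' gv; have [l1 _] := gb_lm gG; have [l2 _] := gb_lm gG'.
have vl : v = lm g' by apply: LM_unique gv l2.
have [_ _ _ h] := gb; have [gg|gg] := eqVneq g g'; last exact: h g g' u v gG gG' gg ug gv.
apply/negP => vu; case/negP: ul; apply/eqP; apply: (mon_le_anti a_gt0).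
  exact: l1.2.
by rewrite gg -vl; apply: mon_dvd_le vu.
Qed.

(** Two leading monomials with the same Y-exponent would divide one another. *)
Lemma gb_y_inj g g' : g \in G -> g' \in G -> (lm g).2 = (lm g').2 -> g = g'.
Proof.
move=> gG gG' e; apply/eqP/negPn/negP => gg.
have h1 := gb_dvd gG gG' gg; have h2 := gb_dvd gG' gG; rewrite eq_sym in h2.
move: h1 (h2 gg); rewrite /mon_dvd e leqnn !andbT -!ltnNge; lia.
Qed.

Lemma gb_below h u : vanishing_ideal P h -> is_LM a b h u ->
  exists2 g, g \in G & mon_dvd (lm g) u.
Proof.
move=> hI hu; have [_ [_ hG] _ _] := gb.
have [g [v [gG gv vu]]] := hG h u hI hu; exists g => //.
by have [l _] := gb_lm gG; rewrite (LM_unique a_gt0 l gv).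
Qed.

(** The curve itself has leading monomial Y^a. *)
Lemma gb_top : exists2 g, g \in G & (lm g).1 = 0%N /\ ((lm g).2 <= a)%N.
Proof.
have [g gG /andP[/= h1 h2]] := gb_below (@H_vanish _ _ _ _ HP) (LM_H cab).
by exists g => //; split=> //; move: h1; rewrite leqn0 => /eqP.
Qed.

(** X^q - X has leading monomial X^q. *)
Lemma gb_right : exists2 g, g \in G & ((lm g).1 <= q)%N /\ (lm g).2 = 0%N.
Proof.
have [g gG /andP[/= h1 h2]] := gb_below (@XqX_vanish _ _ P) (LM_XqX cab).
by exists g => //; split=> //; move: h2; rewrite leqn0 => /eqP.
Qed.

Lemma gb_lm_le g : g \in G -> ((lm g).1 <= q)%N /\ ((lm g).2 <= a)%N.
Proof.
move=> gG; have [g1 gG1 [x1 y1]] := gb_top; have [g2 gG2 [x2 y2]] := gb_right; split.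
  have [->//|gg] := eqVneq g g2; have := gb_dvd gG gG2 gg.
  by rewrite /mon_dvd y2 andbT -ltnNge => h; apply: leq_trans (ltnW h) x2.
have [->//|gg] := eqVneq g g1; have := gb_dvd gG gG1 gg.
by rewrite /mon_dvd x1 /= -ltnNge => h; apply: leq_trans (ltnW h) y1.
Qed.

Lemma gb_supp_le g u : g \in G -> u \in supp g -> (u.1 <= q)%N /\ (u.2 <= a)%N.
Proof.
move=> gG ug; have [->|ul] := eqVneq u (lm g); first exact: gb_lm_le.
have su := gb_tail gG ug ul.
split; apply: ltnW; first exact: standard_x cab gb _ su.
exact: standard_y cab HP gb _ su.
Qed.

Lemma gb_size : (size G <= a.+1)%N.
Proof.
have [un _ _ _] := gb.
rewrite -(size_map (fun g => (lm g).2)) -(size_iota 0 a.+1); apply: uniq_leq_size.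
  by rewrite map_inj_in_uniq // => g g' gG gG'; apply: gb_y_inj.
by move=> j /mapP[g gG ->]; rewrite mem_iota add0n ltnS; case: (gb_lm_le gG).
Qed.

Lemma supp_size g : g \in G -> (size (supp g) <= q.+1 * a.+1)%N.
Proof.
move=> gG; have -> : (q.+1 * a.+1 = size [seq (i, j) | i <- iota 0 q.+1, j <- iota 0 a.+1])%N.
  by rewrite size_allpairs !size_iota.
apply: uniq_leq_size.
  rewrite /supp filter_uniq // allpairs_uniq ?iota_uniq //.
  by move=> [x y] [x' y'].
move=> [i j] ug; have [/= h1 h2] := gb_supp_le gG ug.
by apply: (@allpairs_f _ _ _ (fun x y : nat => (x, y)) (iota 0 q.+1) (iota 0 a.+1)); rewrite mem_iota add0n ltnS.
Qed.

(** Row j of the division is the basis element whose leading monomial has the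
    largest Y-exponent at most j, times a power of Y. *)
Definition is_base (j e : nat) : Prop :=
  [/\ (e < size G)%N, ((lm G`_e).2 <= j)%N &
      forall e', (e' < size G)%N -> ((lm G`_e').2 <= j)%N -> ((lm G`_e').2 <= (lm G`_e).2)%N].

(** The chosen element has the least X-exponent among the basis elements that can divide
    a monomial with Y-exponent k. *)
Lemma standard_below k e i : is_base k e -> (i < (lm G`_e).1)%N -> standard a b G (i, k).
Proof.
move=> [eG ek emax] ie g v gG gv; have [l _] := gb_lm gG.
rewrite (LM_unique a_gt0 gv l); apply/negP => /andP[/= h1 h2].
have eG' : G`_e \in G by rewrite mem_nth.
have gi : (index g G < size G)%N by rewrite index_mem.
have := emax _ gi; rewrite nth_index // => /(_ h2) h3.
have [gg|gg] := eqVneq G`_e g; first by move: ie; rewrite gg; lia.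
by have := gb_dvd eG' gG gg; rewrite /mon_dvd h3 andbT; lia.
Qed.

Context (J : nat) (base : nat -> nat).
Hypothesis JE : J = (2 * a - 1)%N.
Hypothesis baseP : forall j, (j < J)%N -> is_base j (base j).

Definition rdeg j : nat := (lm G`_(base j)).1.
Definition rowshift j : nat := (j - (lm G`_(base j)).2)%N.
Definition rowp j : {poly {poly F}} := monXY 1 (0, rowshift j)%N * G`_(base j).
Definition fl k : nat := ((b * k) %/ a)%N.

Lemma rowp_coef j s k : coefXY (rowp j) (s, k) =
  if (rowshift j <= k)%N then coefXY G`_(base j) (s, k - rowshift j)%N else 0.
Proof. by rewrite /rowp coefXY_monM /mon_dvd /= subn0 mul1r. Qed.

Lemma base_in j : (j < J)%N -> G`_(base j) \in G.
Proof. by move=> /baseP[h _ _]; rewrite mem_nth. Qed.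

Lemma rdeg_le j : (j < J)%N -> (rdeg j <= q)%N.
Proof. by move=> jJ; have [] := gb_lm_le (base_in jJ). Qed.

Lemma rowp_lead j : (j < J)%N -> coefXY (rowp j) (rdeg j, j) = 1.
Proof.
move=> jJ; have [_ h _] := baseP jJ; rewrite rowp_coef /rowshift leq_subr subKn //.
by rewrite -[RHS](gb_lm (base_in jJ)).2 /rdeg; case: (lm _).
Qed.

Lemma rowp_LM j s k : (j < J)%N -> coefXY (rowp j) (s, k) != 0 ->
  mon_le a b (s, k) (rdeg j, j).
Proof.
move=> jJ; have [_ h _] := baseP jJ; rewrite rowp_coef; case: ifP => [rk c0|]; last by rewrite eqxx.
have [[_ lmax] _] := gb_lm (base_in jJ); rewrite -mem_supp in c0.
move: (lmax _ c0) h rk; rewrite /mon_le /wdeg /rdeg /rowshift /=.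
case: (lm _) => [d j0] /= hm h rk; move: hm.
have -> : (b * k = b * (k - (j - j0)) + b * (j - j0))%N by rewrite -mulnDr subnK.
have -> : (b * j = b * j0 + b * (j - j0))%N by rewrite -mulnDr subnKC.
lia.
Qed.

(** For j < a the Y-exponents and the shift are both below a, the leading one excepted.
    For j >= a the chosen element has the highest leading Y-exponent of all, and the
    Y-exponents of its other terms are smaller. *)
Lemma rowp_col j s k : (j < J)%N -> coefXY (rowp j) (s, k) != 0 -> (k < J)%N.
Proof.
move=> jJ; have [eG h emax] := baseP jJ; have gG := base_in jJ.
rewrite rowp_coef; case: ifP => [rk c0|]; last by rewrite eqxx.
set k0 := (k - rowshift j)%N in c0; have kE : (k = k0 + rowshift j)%N by rewrite subnK.
rewrite -mem_supp in c0.
have [e|ne] := eqVneq (s, k0) (lm G`_(base j)).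
  by have := congr1 snd e; move: kE; rewrite /rowshift /= => -> ->; rewrite subnKC.
have su := gb_tail gG c0 ne.
have ka := standard_y cab HP gb su; rewrite /= in ka.
have [ja|ja] := ltnP j a; first by rewrite kE /rowshift; lia.
have [g gG' [g1 g2]] := gb_top.
have gi : (index g G < size G)%N by rewrite index_mem.
have := emax _ gi; rewrite nth_index // => /(_ (leq_trans g2 ja)) h3.
have := su g (lm g) gG' (gb_lm gG').1; rewrite /mon_dvd g1 /= -ltnNge => h4.
by rewrite kE /rowshift; lia.
Qed.

(** Dividing the weight by a and rounding down preserves the order. *)
Lemma time_le s k d j : mon_le a b (s, k) (d, j) -> (s + fl k <= d + fl j)%N.
Proof.
move=> /mon_le_wdeg; rewrite /wdeg /= => h; rewrite /fl.
by have := leq_div2r a h; rewrite ![(a * _)%N]mulnC !divnMDl.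
Qed.

Lemma rowp_time j s k : (j < J)%N -> coefXY (rowp j) (s, k) != 0 ->
  (s + fl k <= rdeg j + fl j)%N.
Proof. by move=> jJ /(rowp_LM jJ) /time_le. Qed.

Lemma expo_le T t i fk fj dj : (fj + dj < T - i)%N -> (i < t.+1)%N -> (t < T)%N ->
  (fk <= T - 1 - t)%N ->
  (T - 1 - i - fj - dj <= T - 1 - t - fk)%N = (fk + (t - i) <= dj + fj)%N.
Proof. clear; lia. Qed.

Lemma expo_sub T t i fk fj dj : (fj + dj < T - i)%N -> (i < t.+1)%N -> (t < T)%N ->
  (fk <= T - 1 - t)%N -> (fk + (t - i) <= dj + fj)%N ->
  (T - 1 - t - fk - (T - 1 - i - fj - dj) = dj + fj - fk - (t - i))%N.
Proof. clear; lia. Qed.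

Section Quotient.
Context (T : nat) (fhat : {poly {poly F}}).
Context (U0 U Q : nat -> nat -> F) (Gm : nat -> nat -> nat -> F).
Definition act t k : bool := (fl k + rdeg k < T - t)%N.
Hypothesis fhat_supp : forall x k, coefXY fhat (x, k) != 0 -> (k < J)%N /\ (x + fl k < T)%N.
Hypothesis U0E : forall k t, (k < J)%N -> (t < T)%N ->
  U0 k t = if (fl k <= T - 1 - t)%N then coefXY fhat (T - 1 - t - fl k, k)%N else 0.
Hypothesis GmE : forall j k d, (j < J)%N -> (k < J)%N -> (d < T)%N ->
  Gm j k d = if (fl k + d <= rdeg j + fl j)%N
             then coefXY (rowp j) (rdeg j + fl j - fl k - d, k)%N else 0.
Hypothesis UE : forall k t, (k < J)%N -> (t < T)%N ->
  U k t = U0 k t - \sum_(j < J) \sum_(i < t.+1) Q j i * Gm j k (t - i).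
Hypothesis Uact : forall k t, (k < J)%N -> (t < T)%N ->
  if act t k then U k t = 0 else Q k t = 0.

(** The X-exponent of the quotient term that digit i of column j stands for. *)
Definition expo j i : nat := (T - 1 - i - fl j - rdeg j)%N.

Definition remainder : {poly {poly F}} :=
  fhat - \sum_(j < J) \sum_(i < T | act i j) monXY (Q j i) (expo j i, 0)%N * rowp j.

(** The recurrence of the program is the division identity, read coefficientwise. *)
Lemma remainder_coef x k : coefXY remainder (x, k) =
  if (k < J)%N && (x + fl k < T)%N then U k (T - 1 - fl k - x)%N else 0.
Proof.
rewrite /remainder coefXYB coefXY_sum.
have term j i : (j < J)%N -> act i j ->
    coefXY (monXY (Q j i) (expo j i, 0)%N * rowp j) (x, k) != 0 ->
    [/\ (k < J)%N, (x + fl k < T)%N & (i <= T - 1 - fl k - x)%N].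
  move=> jJ; rewrite /act => aij; rewrite coefXY_monM /mon_dvd /= subn0 andbT.
  case: ifP => [ex|]; last by rewrite eqxx.
  rewrite mulf_eq0 negb_or => /andP[_ c0].
  have kJ := rowp_col jJ c0; have := rowp_time jJ c0.
  move: ex; rewrite /expo => ex tm; split=> //; lia.
case: ifP => [/andP[kJ xk]|nk]; last first.
  have -> : coefXY fhat (x, k) = 0.
    apply/eqP/negPn/negP => /fhat_supp[h1 h2]; move: nk; by rewrite h1 h2.
  rewrite big1 ?subr0 // => j _; rewrite coefXY_sum big1 // => i ai.
  apply/eqP/negPn/negP => /(term _ _ (ltn_ord j) ai)[h1 h2 _].
  by move: nk; rewrite h1 h2.
set t := (T - 1 - fl k - x)%N; have tT : (t < T)%N by rewrite /t; lia.
have xE : x = (T - 1 - t - fl k)%N by rewrite /t; lia.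
have fkt : (fl k <= T - 1 - t)%N by rewrite /t; lia.
rewrite UE // U0E // ifT; last by rewrite /t; lia.
rewrite -xE; congr (_ - _); apply: eq_bigr => j _; rewrite coefXY_sum.
have TE : T = (t.+1 + (T - t.+1))%N by lia.
rewrite big_mkcond -(big_mkord xpredT (fun i => if act i j then
  coefXY (monXY (Q j i) (expo j i, 0)%N * rowp j) (x, k) else 0)).
rewrite (big_cat_nat (n := t.+1)) //= [X in _ + X]big_nat_cond [X in _ + X]big1 ?addr0; last first.
  move=> i hi0; case: ifP => // ai.
  apply/eqP/negPn/negP => /(term _ _ (ltn_ord j) ai)[_ _]; move: hi0; rewrite -/t; lia.
rewrite big_mkord; apply: eq_bigr => i _; have it := ltn_ord i.
have iT : (i < T)%N by lia.
have := Uact (ltn_ord j) iT; case: ifP => [|_ ->]; last by rewrite mul0r.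
rewrite /act => ai _; rewrite coefXY_monM /mon_dvd /= subn0 andbT GmE //; last by lia.
have -> : (expo j i <= x)%N = (fl k + (t - i) <= rdeg j + fl j)%N.
  by rewrite /expo xE; move: ai it tT fkt; apply: expo_le.
case: ifP => h; last by rewrite mulr0.
congr (_ * coefXY _ (_, _)); move: ai it tT fkt h; rewrite /expo xE.
exact: expo_sub.
Qed.

Lemma remainder_standard u : u \in supp remainder ->
  standard a b G u /\ (u.2 < J)%N.
Proof.
case: u => x k; rewrite mem_supp remainder_coef; case: ifP => [/andP[kJ xk] h|]; last by rewrite eqxx.
split=> //; apply: standard_below (baseP kJ) _; rewrite -/(rdeg k).
have tT : (T - 1 - fl k - x < T)%N by lia.
have := Uact kJ tT; case: ifP => [_ e|]; first by rewrite e eqxx in h.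
by rewrite /act; lia.
Qed.

Lemma remainder_eval i : remainder.[(P i).1, (P i).2] = fhat.[(P i).1, (P i).2].
Proof.
rewrite -!/(evalXY (P i) _) /remainder evalXYB evalXY_sum big1 ?subr0 // => j _.
rewrite evalXY_sum big1 // => t _; rewrite !evalXYM.
have [_ [hG _] _ _] := gb; have := hG _ (base_in (ltn_ord j)) i.
by rewrite /= -/(evalXY (P i) _) => ->; rewrite !mulr0.
Qed.

End Quotient.

End Staircase.

(** * Interpolation on the points of the curve *)

(** The size of the field, under a name of its own so that it has a single form. *)
Definition fq (F : finFieldType) : nat := #|F|.

Section Interpolation.
Context (F : finFieldType) (n a : nat) (xs ys cs : nat -> F).
Hypothesis xy_inj : forall i j, (i < n)%N -> (j < n)%N -> xs i = xs j -> ys i = ys j -> i = j.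
Local Notation q := (fq F).

(** The number of points before the j-th on the vertical line of al. *)
Definition cnt (al : F) j : nat := (\sum_(l < j) (xs l == al))%N.

Hypothesis cnt_le : forall al, (cnt al n <= a)%N.

(** The monic polynomial that vanishes at the points met so far. *)
Fixpoint gM (al : F) j : {poly F} :=
  if j is j'.+1 then
    if xs j' == al then gM al j' * ('X - (ys j')%:P) else gM al j'
  else 1.

(** Newton interpolation: the multiple of gM that is added corrects the value at the new
    point and keeps the earlier ones. *)
Fixpoint gP (al : F) j : {poly F} :=
  if j is j'.+1 then
    if xs j' == al
    then gP al j' + ((cs j' - (gP al j').[ys j']) / (gM al j').[ys j']) *: gM al j'
    else gP al j'
  else 0.

Lemma cntS al j : cnt al j.+1 = (cnt al j + (xs j == al))%N.
Proof. by rewrite /cnt big_ord_recr. Qed.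

Lemma cnt_leq al j : (cnt al j <= j)%N.
Proof. by elim: j => [|j IH]; [rewrite /cnt big_ord0|rewrite cntS; case: (xs j == al); lia]. Qed.

Lemma cnt_mono al i j : (i <= j)%N -> (cnt al i <= cnt al j)%N.
Proof.
by elim: j => [|j IH]; [case: i|rewrite leq_eqVlt => /orP[/eqP ->//|/IH h]; rewrite cntS; lia].
Qed.

Lemma cnt0P al j : (cnt al j == 0)%N = [forall l : 'I_j, xs l != al].
Proof.
apply/idP/forallP => [|h].
  by rewrite /cnt sum_nat_eq0 => /forallP h l; have := h l; case: (xs l == al).
by rewrite /cnt big1 // => l _; rewrite (negbTE (h l)).
Qed.

Lemma size_gM al j : (size (gM al j) <= (cnt al j).+1)%N.
Proof.
elim: j => [|j IH]; first by rewrite /cnt big_ord0 size_poly1.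
rewrite /= cntS; case: (xs j == al); last by rewrite addn0.
apply: leq_trans (size_polyMleq _ _) _; rewrite size_XsubC; lia.
Qed.

Lemma size_gP al j : (size (gP al j) <= cnt al j)%N.
Proof.
elim: j => [|j IH]; first by rewrite size_poly0.
rewrite /= cntS; case: (xs j == al); last by rewrite addn0.
apply: leq_trans (size_polyD _ _) _; rewrite geq_max; apply/andP; split; first by lia.
by apply: leq_trans (size_scale_leq _ _) _; rewrite addn1 size_gM.
Qed.

Lemma gM_root al j l : (l < j)%N -> xs l = al -> (gM al j).[ys l] = 0.
Proof.
elim: j => // j IH; rewrite ltnS leq_eqVlt => /orP[/eqP ->|lj] e /=.
  by rewrite e eqxx hornerM hornerXsubC subrr mulr0.
by case: ifP => _; rewrite ?hornerM IH ?mul0r.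
Qed.

Lemma gM_neq0 al j z : (forall l, (l < j)%N -> xs l = al -> ys l != z) ->
  (gM al j).[z] != 0.
Proof.
elim: j => [|j IH] h /=; first by rewrite hornerE oner_neq0.
have IH' := IH (fun l lj => h l (ltnW lj)).
case: (xs j =P al) => // e; rewrite hornerM mulf_neq0 // hornerXsubC subr_eq0 eq_sym.
exact: h.
Qed.

Lemma gM_new j : (j < n)%N -> (gM (xs j) j).[ys j] != 0.
Proof.
move=> jn; apply: gM_neq0 => l lj e; apply/eqP => e'.
by have := xy_inj (ltn_trans lj jn) jn e e'; lia.
Qed.

Lemma gP_eval al j l : (j <= n)%N -> (l < j)%N -> xs l = al -> (gP al j).[ys l] = cs l.
Proof.
elim: j => // j IH jn; rewrite ltnS leq_eqVlt => /orP[/eqP ->|lj] e /=.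
  rewrite e eqxx hornerD hornerZ divfK; first by rewrite addrC subrK.
  by rewrite -e; apply: gM_new.
case: ifP => _; last by apply: IH => //; lia.
by rewrite hornerD hornerZ (gM_root lj e) mulr0 addr0 IH //; lia.
Qed.

Definition first i : bool := (cnt (xs i) i == 0)%N.

(** Each vertical line that carries points has a unique first point. *)
Lemma first_exists i : (i < n)%N ->
  exists2 l0, (l0 < n)%N & forall l, first l && (xs l == xs i) = (l == l0).
Proof.
move=> iN; have ex : exists l, xs l == xs i by exists i.
case: (ex_minnP ex) => l0 /eqP e0 lmin; exists l0.
  by apply: leq_ltn_trans iN; apply: lmin.
have f0 : first l0.
  rewrite /first cnt0P; apply/forallP => l; apply/eqP => e.
  by have := lmin l; rewrite e e0 eqxx => /(_ isT); have := ltn_ord l; lia.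
move=> l; apply/andP/eqP => [[fl /eqP e]|->]; last by rewrite e0.
apply/eqP; rewrite eqn_leq lmin ?e // andbT leqNgt; apply/negP => h.
by move: fl; rewrite /first cnt0P => /forallP/(_ (Ordinal h)); rewrite /= e0 e eqxx.
Qed.

Lemma first_count : (\sum_(i < n) first i <= q)%N.
Proof.
have -> : (\sum_(i < n) first i = #|[set i : 'I_n | first i]|)%N.
  by rewrite -sum1_card [RHS]big_mkcond /=; apply: eq_bigr => i _; rewrite inE; case: (first i).
rewrite -(card_in_imset (f := fun i : 'I_n => xs i)); first exact: max_card.
move=> i j; rewrite !inE => fi fj e; apply: val_inj.
have [l0 _ h] := first_exists (ltn_ord j).
by move: (h i) (h j); rewrite fi fj e eqxx => /esym/eqP h1 /esym/eqP h2; apply: etrans h1 (esym h2).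
Qed.

(** The groups partition the points. *)
Lemma first_total : (\sum_(i < n) first i * cnt (xs i) n = n)%N.
Proof.
transitivity (\sum_(j < n) 1)%N; last by rewrite sum1_card card_ord.
transitivity (\sum_(i < n) \sum_(j < n) (first i && (xs i == xs j)))%N.
  apply: eq_bigr => i _; rewrite /cnt big_distrr; apply: eq_bigr => j _ /=.
  by rewrite mulnb eq_sym.
rewrite exchange_big; apply: eq_bigr => j _ /=.
have [l0 l0n h] := first_exists (ltn_ord j).
rewrite (bigD1 (Ordinal l0n)) //= h eqxx big1 // => l ll; rewrite h.
by apply/eqP; rewrite eqb0; apply: contra ll => /eqP e; apply/eqP/val_inj.
Qed.

(** The polynomial 1 - (X^q - al^q) / (X - al), which is 1 at al and 0 at every
    other element of the field. *)
Definition Lcoef (al : F) x : F :=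
  (x == 0%N)%:R - (if (x < q)%N then al ^+ (q - 1 - x) else 0).

(** At al the sum of the powers has q equal terms and vanishes; elsewhere it is
    (al^q - be^q) / (al - be) = 1. *)
Lemma Lcoef_eval al be : \sum_(x < q) Lcoef al x * be ^+ x = (al == be)%:R.
Proof.
have q0 : (0 < q)%N by apply: ltnW; apply: finNzRing_gt1.
rewrite (eq_bigr (fun x : 'I_q => ((x : nat) == 0%N)%:R * be ^+ x -
    al ^+ (q - 1 - x) * be ^+ x)); last first.
  by move=> x _; rewrite /Lcoef ltn_ord mulrBl.
rewrite sumrB (bigD1 (Ordinal q0)) //= mul1r expr0 big1 ?addr0; last first.
  by move=> x x0; rewrite (_ : ((x : nat) == 0%N) = false) ?mul0r //; apply/negbTE.
have [<-|ne] := eqVneq al be.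
  rewrite (eq_bigr (fun=> al ^+ (q - 1))) => [|x _].
    rewrite sumr_const card_ord -[_ *+ _]mulr_natr.
    suff -> : q%:R = 0 :> F by rewrite mulr0 subr0.
    have e : \sum_(x : F) x = \sum_(x : F) (x + 1).
      by rewrite (reindex_inj (@addIr _ 1)).
    move: e; rewrite big_split sumr_const /= => /eqP.
    by rewrite -subr_eq0 opprD addNKr oppr_eq0 => /eqP.
  by rewrite -exprD subnK //; have := ltn_ord x; lia.
apply/eqP; rewrite subr_eq0 eq_sym; apply/eqP.
have h := subrXX al be q; rewrite [X in X - _](expf_card al) [X in _ - X](expf_card be) in h.
have ne0 : al - be != 0 by rewrite subr_eq0.
apply: (mulfI ne0); rewrite mulr1 [in RHS]h; congr (_ * _).
by apply: eq_bigr => i _; congr (_ ^+ _ * _); rewrite subn1.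
Qed.

Definition fhat_ i : {poly {poly F}} :=
  \sum_(l < i | first l) \sum_(k < a) \sum_(x < q)
     monXY (Lcoef (xs l) x * (gP (xs l) n)`_k) (x : nat, k : nat).

Definition fco i x k : F := \sum_(l < i | first l) Lcoef (xs l) x * (gP (xs l) n)`_k.

Lemma fhat_coef i x k : coefXY (fhat_ i) (x, k) =
  if (x < q)%N && (k < a)%N then fco i x k else 0.
Proof.
rewrite /fhat_ /fco coefXY_sum.
case: ifP => [/andP[xq ka]|h]; last first.
  rewrite big1 // => l _; rewrite coefXY_sum big1 // => k' _.
  rewrite coefXY_sum big1 // => x' _; rewrite coefXY_mon; case: eqP => // -[ex ek].
  by move: h; rewrite ex ek !ltn_ord.
apply: eq_bigr => l _; rewrite coefXY_sum (bigD1 (Ordinal ka)) //= [X in _ + X]big1 ?addr0.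
  rewrite coefXY_sum (bigD1 (Ordinal xq)) //= big1 ?addr0.
    by rewrite coefXY_mon eqxx.
  move=> x' xx; rewrite coefXY_mon; case: eqP => // -[ex].
  by case/eqP: xx; apply: val_inj.
move=> k' kk; rewrite coefXY_sum big1 // => x' _; rewrite coefXY_mon.
by case: eqP => // -[_ ek]; case/eqP: kk; apply: val_inj.
Qed.

Lemma fco_S i x k :
  fco i.+1 x k = fco i x k + if first i then Lcoef (xs i) x * (gP (xs i) n)`_k else 0.
Proof. by rewrite /fco big_mkcond big_ord_recr -big_mkcond. Qed.

Lemma fhat_coef_col i x k :
  coefXY (fhat_ i) (x, k) = if (x < q)%N then fco i x k else 0.
Proof.
rewrite fhat_coef; case: (x < q)%N => //=; case: ltnP => // ak.
rewrite /fco big1 // => l _; rewrite nth_default ?mulr0 //.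
by apply: leq_trans (size_gP _ _) (leq_trans (cnt_le _) ak).
Qed.

Lemma fhat_eval i : (i < n)%N -> (fhat_ n).[xs i, ys i] = cs i.
Proof.
move=> iN; rewrite -[LHS]/(evalXY (xs i, ys i) _) /fhat_ evalXY_sum.
have [l0 l0n h] := first_exists iN.
have /andP[f0 /eqP e0] : first l0 && (xs l0 == xs i) by rewrite h.
have term l : evalXY (xs i, ys i) (\sum_(k < a) \sum_(x < q)
     monXY (Lcoef (xs l) x * (gP (xs l) n)`_k) (x : nat, k : nat)) =
     (xs l == xs i)%:R * (gP (xs l) n).[ys i].
  rewrite evalXY_sum -Lcoef_eval (@horner_coef_wide _ a); last first.
    exact: leq_trans (size_gP _ _) (cnt_le _).
  rewrite big_distrr; apply: eq_bigr => k _ /=.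
  rewrite evalXY_sum big_distrl; apply: eq_bigr => x _ /=.
  by rewrite /evalXY evalXY_mon /=; ring.
rewrite (bigD1 (Ordinal l0n)) //= term e0 eqxx mul1r gP_eval // big1 ?addr0 // => l /andP[fl ll].
rewrite term; have := h l; rewrite fl /= => ->.
rewrite (_ : ((l : nat) == l0) = false) ?mul0r //.
by apply/negbTE; apply: contra ll => /eqP e; apply/eqP/val_inj.
Qed.

End Interpolation.

(** * The interpolation program *)

Notation aDN := 8%N (only parsing).
Notation vgi := 62%N (only parsing).
Notation vgj := 63%N (only parsing).
Notation vgk := 64%N (only parsing).
Notation vgn := 65%N (only parsing).
Notation vgs := 66%N (only parsing).
Notation vgb := 67%N (only parsing).
Notation aPP := 13%N (only parsing).
Notation aMM := 14%N (only parsing).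
Notation fal := 24%N (only parsing).
Notation fpw := 25%N (only parsing).
Notation fpv := 26%N (only parsing).
Notation fmv := 27%N (only parsing).
Notation flam := 28%N (only parsing).
Notation fcar := 29%N (only parsing).
Notation ftmp := 30%N (only parsing).
Notation cq := (WGet 0 (WConst 0)) (only parsing).
Notation cn := (WGet 0 (WConst 4)) (only parsing).
Notation ca1 := (WAdd ca (WConst 1)) (only parsing).

Definition eval_cmd : cmd :=
  Seq (fasg fpw FOne)
 (Seq (fasg fpv FZero)
 (Seq (fasg fmv FZero)
 (For vgk ca1
   (Seq (fasg fpv (FAdd (Z fpv) (FMul (FGet aPP (X vgk)) (Z fpw))))
   (Seq (fasg fmv (FAdd (Z fmv) (FMul (FGet aMM (X vgk)) (Z fpw))))
        (fasg fpw (FMul (Z fpw) (FGet 2 (X vgj))))))))).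

(** One pass updates both polynomials of the Newton scheme: the product by Y - y needs
    the old coefficients shifted by one place, kept in a carry variable. *)
Definition update_cmd : cmd :=
  Seq (fasg flam (FDiv (FSub (FGet 3 (X vgj)) (Z fpv)) (Z fmv)))
 (Seq (fasg fcar FZero)
 (For vgk ca1
   (Seq (FSet aPP (X vgk) (FAdd (FGet aPP (X vgk)) (FMul (Z flam) (FGet aMM (X vgk)))))
   (Seq (fasg ftmp (FGet aMM (X vgk)))
   (Seq (FSet aMM (X vgk) (FSub (Z fcar) (FMul (FGet 2 (X vgj)) (Z ftmp))))
        (fasg fcar (Z ftmp))))))).

Definition assemble_cmd : cmd :=
  For vgk (X vgn)
   (Seq (wasg vgb (WAdd (WMul (X vgk) (X vST))
                        (WSub (WSub (X vT) (WConst 1)) (WDiv (WMul cb (X vgk)) ca))))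
   (Seq (FSet aU (X vgb) (FAdd (FGet aU (X vgb)) (FGet aPP (X vgk))))
   (Seq (fasg fpw FOne)
   (For vgs cq
     (Seq (FSet aU (WSub (X vgb) (WSub (WSub cq (WConst 1)) (X vgs)))
             (FSub (FGet aU (WSub (X vgb) (WSub (WSub cq (WConst 1)) (X vgs))))
                   (FMul (FGet aPP (X vgk)) (Z fpw))))
          (fasg fpw (FMul (Z fpw) (Z fal)))))))).

Definition group_cmd : cmd :=
  Seq (fasg fal (FGet 1 (X vgi)))
 (Seq (wasg vgn (WConst 0))
 (Seq (For vgk ca1 (Seq (FSet aPP (X vgk) FZero) (FSet aMM (X vgk) FZero)))
 (Seq (FSet aMM (WConst 0) FOne)
 (Seq (For vgj cn
        (If (TZero (FSub (FGet 1 (X vgj)) (Z fal)))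
          (Seq (WSet aDN (X vgj) (WConst 1))
          (Seq eval_cmd
          (Seq update_cmd (wasg vgn (WAdd (X vgn) (WConst 1))))))
          Skip))
      assemble_cmd)))).

(** A flag marks the points of the groups already treated, so that n steps are spent on
    each of the at most q groups, and one step on each other point. *)
Definition interp_cmd : cmd :=
  For vgi cn (If (TEq (WGet aDN (X vgi)) (WConst 0)) group_cmd Skip).

Section InterpolationSpec.
Context (F : finFieldType) (W V : nat).
Hypothesis V_ge : (250 <= V)%N.
Hypothesis W_ge : (V ^ wlim <= W)%N.
Implicit Types (s : store F).
Let wp := @wp F W V.
Local Notation q := (fq F).
Context (a b n J T ST : nat) (xs ys cs : nat -> F).
Hypothesis xy_inj : forall i j, (i < n)%N -> (j < n)%N -> xs i = xs j -> ys i = ys j -> i = j.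
Hypothesis cnt_le : forall al, (cnt xs al n <= a)%N.
Hypotheses (aV : (a < V)%N) (qV : (q < V)%N) (nV : (n <= V)%N) (aJ : (a <= J)%N).
Hypotheses (STE : ST = (2 * T)%N) (JV : (J * ST <= V)%N).
Local Notation flo k := (fl a b k).
Hypothesis floT : forall k, (k < J)%N -> (flo k + q <= T)%N.
Local Notation gP := (gP xs ys cs).
Local Notation gM := (gM xs ys).

Definition inp_ok s : Prop :=
  (wtab s 0 0 = q) * (wtab s 0 1 = a) * (wtab s 0 2 = b) * (wtab s 0 4 = n) *
  (wtab s vT 0 = T) * (wtab s vST 0 = ST) * (forall p, ftab s 1 p = xs p) *
  (forall p, ftab s 2 p = ys p) * (forall p, ftab s 3 p = cs p).

Lemma inp_frame ws fs s s' : frame ws fs s s' ->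
  ~~ has (mem ws) [:: 0%N; vT; vST] -> ~~ has (mem fs) [:: 1%N; 2; 3] -> inp_ok s -> inp_ok s'.
Proof.
move=> f /=; rewrite !negb_or => /and4P[h1 h2 h3 _] /and4P[k1 k2 k3 _] p.
by do ![split] => *; rewrite ?f.1 ?f.2 // p.
Qed.

Definition enc s tt (p : {poly F}) : Prop := forall k, (k < a.+1)%N -> ftab s tt k = p`_k.

Lemma eval_spec j p m s : inp_ok s -> wtab s vgj 0 = j -> enc s aPP p -> enc s aMM m ->
  (size p <= a.+1)%N -> (size m <= a.+1)%N ->
  forall Q, (forall d s', (d <= 100 * (a + 2))%N -> frame [:: vgk] [:: fpw; fpv; fmv] s s' ->
    ftab s' fpv 0 = p.[ys j] -> ftab s' fmv 0 = m.[ys j] -> Q d s') ->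
  wp eval_cmd s Q.
Proof.
move=> so ej ep em sp sm Q hQ.
fset so (1 : F) => //. fset so (0 : F) => //. fset so (0 : F) => //.
set s1 := setf _ _ _ _.
have f1 : frame [::] [:: fpw; fpv; fmv] s s1 by rewrite /s1; fr.
have so1 : inp_ok s1 by apply: inp_frame f1 _ _ so.
pose P k s2 := [/\ ftab s2 fpw 0 = ys j ^+ k, ftab s2 fpv 0 = \sum_(z < k) p`_z * ys j ^+ z &
  ftab s2 fmv 0 = \sum_(z < k) m`_z * ys j ^+ z].
have P0 : P 0%N s1 by rewrite /P !big_ord0 expr0 /s1; split; rd so.
clearbody s1.
apply: (@wp_for F W V V_ge W_ge vgk _ _ [:: vgk] [:: fpw; fpv; fmv] a.+1 (fun=> 40%N) P) => //=.
- by rewrite so1 addn1.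
- move=> k s2 ka f2 x2 [p1 p2 p3].
  have so2 : inp_ok s2 by apply: inp_frame f2 _ _ so1.
  have E : (wtab s2 vgk 0 = k) * (wtab s2 vgj 0 = j) * (ftab s2 aPP k = p`_k) *
      (ftab s2 aMM k = m`_k).
    by rewrite x2 f2.1 // f1.1 // ej !f2.2 // !f1.2 // ep // em.
  have E2 := (so2, E).
  fset E2 (\sum_(z < k.+1) p`_z * ys j ^+ z) => //.
    by rd E2; rewrite p1 p2 big_ord_recr.
  fset E2 (\sum_(z < k.+1) m`_z * ys j ^+ z) => //.
    by rd E2; rewrite p1 p3 big_ord_recr.
  flast E2 (ys j ^+ k.+1) => //; first by rd E2; rewrite p1 exprSr.
  by split; [by []|fr|rd E2|split; rd E2].
move=> d s2 hd f2 [p1 p2 p3]; apply: hQ.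
- by move: hd; rewrite sum_nat_const card_ord /=; lia.
- by frt f2; frt f1; fr.
- by rewrite p2 (horner_coef_wide _ sp).
- by rewrite p3 (horner_coef_wide _ sm).
Qed.

Lemma update_spec j p m s : inp_ok s -> wtab s vgj 0 = j -> enc s aPP p -> enc s aMM m ->
  ftab s fpv 0 = p.[ys j] -> ftab s fmv 0 = m.[ys j] -> m.[ys j] != 0 ->
  forall Q, (forall d s', (d <= 100 * (a + 2))%N ->
    frame [:: vgk] [:: flam; fcar; ftmp; aPP; aMM] s s' ->
    enc s' aPP (p + ((cs j - p.[ys j]) / m.[ys j]) *: m) ->
    enc s' aMM (m * ('X - (ys j)%:P)) -> Q d s') ->
  wp update_cmd s Q.
Proof.
move=> so ej ep em epv emv m0 Q hQ.
set la := (cs j - p.[ys j]) / m.[ys j].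
pose p' := p + la *: m; pose m' := m * ('X - (ys j)%:P).
have E := (so, ej, epv, emv).
fset E la; first by rd E.
fset E (0 : F) => //.
set s1 := setf _ _ _ _.
have f1 : frame [::] [:: flam; fcar] s s1 by rewrite /s1; fr.
have so1 : inp_ok s1 by apply: inp_frame f1 _ _ so.
pose P k s2 := [/\ forall z, (z < a.+1)%N -> ftab s2 aPP z = if (z < k)%N then p'`_z else p`_z,
   forall z, (z < a.+1)%N -> ftab s2 aMM z = if (z < k)%N then m'`_z else m`_z &
   ftab s2 fcar 0 = if k is k'.+1 then m`_k' else 0].
have P0 : P 0%N s1 by split=> [z za|z za|]; rewrite /s1; rd E; rewrite ?ep ?em.
have l1 : ftab s1 flam 0 = la by rewrite /s1; rd E.
clearbody s1.
apply: (@wp_for F W V V_ge W_ge vgk _ _ [:: vgk] [:: fcar; ftmp; aPP; aMM] a.+1 (fun=> 50%N) P) => //=.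
- by rewrite so1 addn1.
- move=> k s2 ka f2 x2 [p1 p2 p3].
  have so2 : inp_ok s2 by apply: inp_frame f2 _ _ so1.
  have E1 : (wtab s2 vgk 0 = k) * (wtab s2 vgj 0 = j) * (ftab s2 aPP k = p`_k) *
      (ftab s2 aMM k = m`_k) * (ftab s2 flam 0 = la).
    by rewrite x2 f2.1 // f1.1 // ej p1 // p2 // ltnn f2.2.
  have E2 := (so2, E1).
  apply: wp_seq; fput E2 k (p'`_k) => //; first by rd E2; rewrite coefD coefZ.
  fset E2 (m`_k) => //.
  apply: wp_seq; fput E2 k (m'`_k) => //.
    by rd E2; rewrite p3 /m' mulrBr coefB coefMX coefMC mulrC; case: (k).
  flast E2 (m`_k) => //.
  split; [by []|fr|by rd E2|split=> [z za|z za|]; rd E2 => //].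
    rewrite ltnS leq_eqVlt; case: eqP => [->|_] //=; exact: p1.
  rewrite ltnS leq_eqVlt; case: eqP => [->|_] //=; exact: p2.
move=> d s2 hd f2 [p1 p2 p3]; apply: hQ.
- by move: hd; rewrite sum_nat_const card_ord /=; lia.
- by frt f2; frt f1; fr.
- by move=> z za; rewrite p1 // za.
- by move=> z za; rewrite p2 // za.
Qed.

(** In column k the coefficient of X^x Y^k is at entry T - 1 - (x + floor(b k / a)), so
    that entries are met by decreasing time. *)
Definition colval (f : nat -> nat -> F) k t : F :=
  if (flo k <= T - 1 - t)%N then f (T - 1 - t - flo k)%N k else 0.

Lemma cell_bound k t : (k < J)%N -> (t < T)%N -> (k * ST + t <= V)%N.
Proof.
move=> kJ tT; apply: leq_trans JV; apply: (@leq_trans (k.+1 * ST)%N).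
  by rewrite mulSn STE; lia.
by rewrite leq_mul2r kJ orbT.
Qed.

Lemma cell_sub k t x : (x <= t)%N -> (k * ST + t - x = k * ST + (t - x))%N.
Proof. by move=> h; rewrite addnBA. Qed.

Lemma assemble_spec al (p : {poly F}) nu s : inp_ok s -> wtab s vgn 0 = nu ->
  ftab s fal 0 = al -> enc s aPP p -> (nu <= a)%N -> (size p <= nu)%N ->
  forall Q, (forall d s', (d <= (200 * (q + 2)) * nu.+1)%N ->
    frame [:: vgk; vgb; vgs] [:: aU; fpw] s s' ->
    (forall k t, (k < J)%N -> (t < T)%N -> U_ ST s' k t = U_ ST s k t +
       colval (fun x k => if (x < q)%N then Lcoef al x * p`_k else 0) k t) -> Q d s') ->
  wp assemble_cmd s Q.
Proof.
move=> so en eal ep nua sp Q hQ.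
have q0 : (0 < q)%N by apply: ltnW; apply: finNzRing_gt1.
pose g x k := if (x < q)%N then Lcoef al x * p`_k else 0.
pose P i s1 := forall k t, (k < J)%N -> (t < T)%N ->
  U_ ST s1 k t = U_ ST s k t + if (k < i)%N then colval g k t else 0.
apply: (@wp_for F W V V_ge W_ge vgk _ _ [:: vgk; vgb; vgs] [:: aU; fpw] nu
  (fun=> 100 + 70 * q.+1)%N P) => //=.
- by apply: leq_trans nua (ltnW aV).
- by move=> k t _ _; rewrite addr0.
- move=> i s1 inu f1 x1 P1.
  have ia : (i < a)%N by apply: leq_trans nua.
  have iJ : (i < J)%N by apply: leq_trans aJ.
  have Ti := floT iJ.
  have so1 : inp_ok s1 by apply: inp_frame f1 _ _ so.
  have E1 : (wtab s1 vgk 0 = i) * (ftab s1 fal 0 = al) * (ftab s1 aPP i = p`_i).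
    by rewrite x1 !f1.2 // eal ep //; apply: ltnW.
  have E := (so1, E1).
  have tT : (T - 1 - flo i < T)%N by lia.
  have tS : (T - 1 - flo i < ST)%N by lia.
  wset E (i * ST + (T - 1 - flo i))%N; first exact: cell_bound.
  apply: wp_seq; fput E (i * ST + (T - 1 - flo i))%N (U_ ST s1 i (T - 1 - flo i) + p`_i) => //.
    by rd E.
  fset E (1 : F) => //.
  set s2 := setf _ _ _ _.
  have f2 : frame [:: vgb] [:: aU; fpw] s1 s2 by rewrite /s2; fr.
  have so2 : inp_ok s2 by apply: inp_frame f2 _ _ so1.
  have E2 : (wtab s2 vgk 0 = i) * (wtab s2 vgb 0 = i * ST + (T - 1 - flo i))%N *
      (ftab s2 fal 0 = al) * (ftab s2 aPP i = p`_i).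
    by rewrite /s2; do ![split]; rd E.
  have U2 k t : (k < J)%N -> (t < T)%N -> U_ ST s2 k t = U_ ST s1 k t +
      if (k == i) && (t == T - 1 - flo i)%N then p`_i else 0.
    move=> kJ tT'; rewrite /s2 /U_; rd E.
    rewrite cell_eq //; last by lia.
    by case: andP => [[/eqP -> /eqP ->]|_]; rewrite ?addr0.
  have w2 : ftab s2 fpw 0 = 1 by rewrite /s2; rd E.
  clearbody s2.
  pose P2 z s3 := ftab s3 fpw 0 = al ^+ z /\ forall k t, (k < J)%N -> (t < T)%N ->
    U_ ST s3 k t = U_ ST s2 k t - if [&& k == i, (flo i <= T - 1 - t)%N,
         (T - 1 - t - flo i < q)%N & (q <= T - 1 - t - flo i + z)%N]
       then p`_i * al ^+ (q - 1 - (T - 1 - t - flo i)) else 0.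
  apply: (@wp_for F W V V_ge W_ge vgs _ _ [:: vgs] [:: aU; fpw] q (fun=> 40%N) P2) => //=.
  + by rewrite so2.
  + by apply: ltnW.
  + split=> // k t kJ tT'; rewrite ifF ?subr0 //.
    by apply/negbTE/negP => /and4P[_ _ h1 h2]; move: h1 h2; lia.
  + move=> z s3 zq f3 x3 [w3 P3].
    have so3 : inp_ok s3 by apply: inp_frame f3 _ _ so2.
    have E3 : (wtab s3 vgk 0 = i) * (wtab s3 vgb 0 = i * ST + (T - 1 - flo i))%N *
      (wtab s3 vgs 0 = z) * (ftab s3 fal 0 = al) * (ftab s3 aPP i = p`_i).
      by rewrite x3 !(f3.1 vgk) // !(f3.1 vgb) // !f3.2 // !E2.
    have E4 := (so3, E3).
    have le : (q - 1 - z <= T - 1 - flo i)%N by lia.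
    set t0 := (T - 1 - flo i - (q - 1 - z))%N.
    have t0T : (t0 < T)%N by rewrite /t0; lia.
    have t0S : (t0 < ST)%N by lia.
    apply: wp_seq; fput E4 (i * ST + t0)%N (U_ ST s3 i t0 - p`_i * al ^+ z) => //.
    * by rewrite cell_sub.
    * by rd E4; rewrite w3 cell_sub.
    flast E4 (al ^+ z.+1) => //; first by rd E4; rewrite w3 exprSr.
    split; [by []|fr|by rd E4|split; first by rd E4].
    move=> k t kJ tT'; rewrite /U_; rd E4.
    rewrite cell_eq //; last by lia.
    case: (boolP ((k == i) && (t == t0))) => [/andP[/eqP -> /eqP ->]|h].
      rewrite -!/(U_ _ _ _ _) P3 // ifF ?subr0; last first.
        by apply/negbTE/negP => /and4P[_ _ _]; rewrite /t0; lia.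
      have x0 : (T - 1 - t0 - flo i = q - 1 - z)%N by rewrite /t0; lia.
      rewrite eqxx x0 ifT; last by rewrite /t0 /=; lia.
      by congr (_ - _ * _ ^+ _); lia.
    rewrite -!/(U_ _ _ _ _) P3 //; congr (_ - _).
    case: (k =P i) h => [_ /= tt|_ _]; last by rewrite !andFb.
    by congr (if _ then _ else _); move: tt; rewrite /t0; lia.
  + move=> d s3 hd f3 [w3 P3]; split.
    * by move: hd; rewrite sum_nat_const card_ord /=; lia.
    * by frt f3; frt f2; fr.
    * by rewrite f3.1 // E2.
    move=> k t kJ tT'; rewrite P3 // U2 // P1 // -!addrA; congr (_ + _).
    have -> : (k < i.+1)%N = (k == i) || (k < i)%N by rewrite ltnS leq_eqVlt.
    case: (k =P i) => [->|_] /=; last by rewrite subr0 addr0.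
    rewrite ltnn add0r /colval /g; case: (leqP (flo i) (T - 1 - t)) => [h|h] /=; last first.
      by rewrite subr0 ifF //; apply/negbTE; apply/eqP => e; move: h; rewrite e; lia.
    rewrite /Lcoef -/(fq F); set x := (T - 1 - t - flo i)%N.
    have -> : (t == T - 1 - flo i)%N = (x == 0)%N by rewrite /x; lia.
    case: (ltnP x q) => xq /=; last first.
      by rewrite subr0 ifF //; apply/negbTE; move: xq; lia.
    rewrite leq_addl mulrBl [al ^+ _ * _]mulrC; congr (_ - _).
    by case: (x == 0)%N; rewrite ?mul1r ?mul0r.
- move=> d s1 hd f1 P1; apply: hQ => //.
    move: hd; rewrite sum_nat_const card_ord /= => hd.
    have h1 : (nu * (100 + 70 * q.+1) <= nu.+1 * (100 + 70 * q.+1))%N by rewrite leq_mul2r leqnSn orbT.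
    have h2 : (22 * nu.+1 + nu.+1 * (100 + 70 * q.+1) <= 200 * (q + 2) * nu.+1)%N.
      by rewrite [(nu.+1 * _)%N]mulnC -mulnDl leq_mul2r; apply/orP; right; lia.
    by move: hd h1 h2; clear; lia.
  move=> k t kJ tT; rewrite P1 //; congr (_ + _); case: (ltnP k nu) => // nuk.
  rewrite /colval /g (nth_default 0); last by apply: leq_trans nuk.
  by rewrite mulr0 !if_same.
Qed.

Notation wsG := [:: vgk; vgb; vgs; vgn; vgj; aDN] (only parsing).
Notation fsG := [:: aU; fpw; fpv; fmv; flam; fcar; ftmp; aPP; aMM; fal] (only parsing).

Definition group_cost nu : nat := (400 * (n + a + q + 3) + nu * (500 * (a + q + 3)))%N.

(** The points of the line are found by a scan, which also sets their flags. *)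
Lemma group_spec i s : inp_ok s -> wtab s vgi 0 = i ->
  forall Q, (forall d s', (d <= group_cost (cnt xs (xs i) n))%N -> frame wsG fsG s s' ->
    (forall l, (l < n)%N -> wtab s' aDN l = if xs l == xs i then 1%N else wtab s aDN l) ->
    (forall k t, (k < J)%N -> (t < T)%N -> U_ ST s' k t = U_ ST s k t +
       colval (fun x k => if (x < q)%N then Lcoef (xs i) x * (gP (xs i) n)`_k else 0) k t) ->
    Q d s') ->
  wp group_cmd s Q.
Proof.
move=> so ei Q hQ; set al := xs i.
have E := (so, ei); have V0 : (1 <= V)%N by lia.
fset E al => //; wset E 0%N => //.
set s1 := setw _ _ _ _.
have f1 : frame [:: vgn] [:: fal] s s1 by rewrite /s1; fr.
have so1 : inp_ok s1 by apply: inp_frame f1 _ _ so.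
have al1 : ftab s1 fal 0 = al by rewrite /s1; rd E.
have nu1 : wtab s1 vgn 0 = 0%N by rewrite /s1; rd E.
clearbody s1; apply: wp_seq.
pose P1 k s2 := forall z, (z < k)%N -> ftab s2 aPP z = 0 /\ ftab s2 aMM z = 0.
apply: (@wp_for F W V V_ge W_ge vgk _ _ [:: vgk] [:: aPP; aMM] a.+1 (fun=> 20%N) P1) => //=.
- by rewrite so1 addn1.
- move=> k s2 ka f2 x2 p2; apply: wp_seq; fput x2 k (0 : F) => //; fput x2 k (0 : F) => //.
  split; [by []|fr|by rd x2|].
  move=> z; rewrite ltnS leq_eqVlt; rd x2; case: (z =P k) => //= _; exact: p2.
move=> d2 s2 hd2 f2 p2.
have so2 : inp_ok s2 by apply: inp_frame f2 _ _ so1.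
apply: wp_seq; fput so2 0%N (1 : F) => //.
set s3 := setf _ _ _ _.
have f3 : frame [::] [:: aMM] s2 s3 by rewrite /s3; fr.
have so3 : inp_ok s3 by apply: inp_frame f3 _ _ so2.
have e3 : enc s3 aPP 0 /\ enc s3 aMM 1.
  split=> z za; rewrite /s3; rd so2; first by rewrite (p2 z za).1 coef0.
  by rewrite coef1; case: (z =P 0%N) => // _; rewrite (p2 z za).2.
have f13 : frame [:: vgk] [:: aPP; aMM] s1 s3 by frt f3; frt f2; fr.
clearbody s3.
apply: wp_seq.
pose P3 j s4 := [/\ enc s4 aPP (gP al j), enc s4 aMM (gM al j), wtab s4 vgn 0 = cnt xs al j &
  forall l, wtab s4 aDN l = if (l < j)%N && (xs l == al) then 1%N else wtab s aDN l].
have P30 : P3 0%N s3.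
  split; [exact: e3.1|exact: e3.2|by rewrite f13.1 // nu1 /cnt big_ord0|].
  by move=> l; rewrite f13.1 // f1.1.
apply: (@wp_for F W V V_ge W_ge vgj _ _ [:: vgj; vgk; vgn; aDN]
   [:: fpw; fpv; fmv; flam; fcar; ftmp; aPP; aMM] n
   (fun j => 40 + (xs j == al) * (300 * (a + 2)))%N P3) => //=.
- by rewrite so3.
- move=> j s4 jn f4 x4 [p4 m4 n4 d4].
  have so4 : inp_ok s4 by apply: inp_frame f4 _ _ so3.
  have al4 : ftab s4 fal 0 = al by rewrite f4.2 // f13.2.
  have E4 := (so4, x4, al4).
  apply: (wp_if V_ge W_ge) => //=; rewrite !E4 subr_eq0.
  case: (xs j =P al) => e; last first.
    apply: wp_skip; split; [by []|by fr|by []|split=> //=].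
    - by rewrite (introF eqP e).
    - by rewrite (introF eqP e).
    - by rewrite cntS (introF eqP e) addn0.
    - move=> l; rewrite d4; congr (if _ then _ else _).
      case: (l =P j) => [->|lj]; first by rewrite (introF eqP e) !andbF.
      by congr (_ && _); lia.
  apply: wp_seq; wput E4 j 1%N => //.
  set s5 := setw _ _ _ _.
  have f5 : frame [:: aDN] [::] s4 s5 by rewrite /s5; fr.
  have so5 : inp_ok s5 by apply: inp_frame f5 _ _ so4.
  have x5 : wtab s5 vgj 0 = j by rewrite f5.1.
  have p5 : enc s5 aPP (gP al j) by [].
  have m5 : enc s5 aMM (gM al j) by [].
  have d5 l : wtab s5 aDN l = if l == j then 1%N else wtab s4 aDN l by rewrite /s5; rd E4.
  clearbody s5.
  have jn' := ltnW jn.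
  have szm : (size (gM al j) <= a.+1)%N.
    apply: leq_trans (size_gM _ _ _ _) _; rewrite ltnS.
    by apply: leq_trans (cnt_mono _ _ jn') (cnt_le _).
  have szp : (size (gP al j) <= a.+1)%N.
    apply: leq_trans (size_gP _ _ _ _ _) _; apply: leqW.
    by apply: leq_trans (cnt_mono _ _ jn') (cnt_le _).
  apply: wp_seq; apply: (eval_spec so5 x5 p5 m5) => // d6 s6 hd6 f6 pv6 mv6.
  have so6 : inp_ok s6 by apply: inp_frame f6 _ _ so5.
  have x6 : wtab s6 vgj 0 = j by rewrite f6.1.
  have p6 : enc s6 aPP (gP al j) by move=> z za; rewrite f6.2 // p5.
  have m6 : enc s6 aMM (gM al j) by move=> z za; rewrite f6.2 // m5.
  have m0 : (gM al j).[ys j] != 0 by rewrite -e; apply: (@gM_new _ n) jn.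
  apply: wp_seq; apply: (update_spec so6 x6 p6 m6 pv6 mv6 m0) => d7 s7 hd7 f7 p7 m7.
  have n7 : wtab s7 vgn 0 = cnt xs al j by rewrite f7.1 // f6.1 // f5.1.
  wlast n7 (cnt xs al j).+1.
  + by rewrite addn1.
  + by apply: leq_trans nV; apply: leq_ltn_trans (cnt_leq _ _ _) jn.
  split.
  + by move: hd6 hd7; rewrite mul1n /=; clear; lia.
  + by apply: frame_setw => //; frt f7; frt f6; frt f5; fr.
  + by rd n7; rewrite f7.1.
  split; rewrite /= ?e ?eqxx //.
  + by rd n7; rewrite cntS e eqxx addn1.
  + move=> l; rd n7; rewrite f7.1 // f6.1 // d5 d4.
    case: (l =P j) => [->|lj]; first by rewrite e eqxx ltnSn.
    by congr (if _ && _ then _ else _); lia.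
move=> d4 s4 hd4 f4 [p4 m4 n4 dn4].
have so4 : inp_ok s4 by apply: inp_frame f4 _ _ so3.
have al4 : ftab s4 fal 0 = al by rewrite f4.2 // f13.2.
apply: (assemble_spec so4 n4 al4 p4 (cnt_le al) (size_gP _ _ _ _ _)).
move=> d5 s5 hd5 f5 U5; apply: hQ.
- rewrite /group_cost -/al.
  have : (\sum_(j < n) (40 + (xs j == al) * (300 * (a + 2))) = n * 40 + cnt xs al n * (300 * (a + 2)))%N.
    by rewrite big_split sum_nat_const card_ord /cnt big_distrl.
  move: hd4 hd5 hd2; rewrite sum_nat_const card_ord; move: (cnt xs al n) => z.
  clear; move=> h1 h2 h3 h4; rewrite h4 in h1.
  have e1 : (z * (500 * (a + q + 3)) = z * (300 * (a + 2)) + (200 * (q + 2)) * z + (z * (200 * a) + z * (300 * q) + z * 500))%N by lia.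
  have e2 : (200 * (q + 2) * z.+1 = 200 * (q + 2) * z + 200 * (q + 2))%N by rewrite mulnS addnC.
  lia.
- by frt f5; frt f4; frt f13; frt f1; fr.
- by move=> l ln; rewrite f5.1 // dn4 ln.
- by move=> k t kJ tT; rewrite U5 // /U_ f4.2 // f13.2 // f1.2.
Qed.

Lemma interp_spec s : inp_ok s -> (forall l, wtab s aDN l = 0%N) ->
  (forall k t, (k < J)%N -> (t < T)%N -> U_ ST s k t = 0) ->
  forall Q, (forall d s',
    (d <= 100 * n.+1 + q * (400 * (n + a + q + 3)) + n * (500 * (a + q + 3)))%N ->
    frame (vgi :: wsG) fsG s s' ->
    (forall k t, (k < J)%N -> (t < T)%N -> U_ ST s' k t =
       colval (fun x k => coefXY (fhat_ n a xs ys cs n) (x, k)) k t) -> Q d s') ->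
  wp interp_cmd s Q.
Proof.
move=> so dn0 u0 Q hQ.
pose P i s1 := (forall l, (l < n)%N -> wtab s1 aDN l = (cnt xs (xs l) i != 0%N)) /\
  forall k t, (k < J)%N -> (t < T)%N -> U_ ST s1 k t =
    colval (fun x k => if (x < q)%N then fco n xs ys cs i x k else 0) k t.
apply: (@wp_for F W V V_ge W_ge vgi _ _ (vgi :: wsG) fsG n
  (fun i => 50 + first xs i * group_cost (cnt xs (xs i) n))%N P) => //=.
- by rewrite so.
- split=> [l ln|k t kJ tT]; first by rewrite dn0 /cnt big_ord0.
  by rewrite u0 // /colval /fco big_ord0 !if_same.
- move=> i s1 iN f1 x1 [d1 u1].
  have so1 : inp_ok s1 by apply: inp_frame f1 _ _ so.
  apply: (wp_if V_ge W_ge) => //=; rewrite x1 d1 // eqb0 negbK -/(first xs i).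
  case fi : (first xs i); last first.
    apply: wp_skip; split; [by []|by fr|by []|split=> [l ln|k t kJ tT]].
      rewrite d1 // cntS; case: (xs i =P xs l) => [e|_]; last by rewrite addn0.
      by move: fi; rewrite /first -e addn1 => ->.
    rewrite u1 // /colval; case: ifP => // _; case: ifP => // _.
    by rewrite fco_S fi addr0.
  apply: (group_spec so1 x1) => d2 s2 hd2 f2 d2' u2; split.
  + by move: hd2; rewrite mul1n; clear; lia.
  + by frt f2; fr.
  + by rewrite f2.1.
  split=> [l ln|k t kJ tT].
    rewrite d2' // d1 // cntS eq_sym; case: (xs i == xs l); last by rewrite addn0.
    by rewrite addn1.
  rewrite u2 // u1 // /colval; case: ifP => [_|_]; last by rewrite addr0.
  by case: ifP => _; rewrite ?addr0 // fco_S fi.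
move=> d s1 hd f1 [_ u1]; apply: hQ => //.
- have e : (\sum_(i < n) (50 + first xs i * group_cost (cnt xs (xs i) n)) =
    n * 50 + (\sum_(i < n) first xs i) * (400 * (n + a + q + 3)) +
    (\sum_(i < n) first xs i * cnt xs (xs i) n) * (500 * (a + q + 3)))%N.
    rewrite big_split sum_nat_const card_ord -addnA; congr (_ + _)%N.
    rewrite !big_distrl -big_split; apply: eq_bigr => i _ /=.
    by rewrite /group_cost mulnDr; congr (_ + _)%N; apply: mulnA.
  rewrite e first_total in hd.
  have := first_count n xs; rewrite -(leq_pmul2r (m := 400 * (n + a + q + 3))); last by lia.
  by move: hd; move: (_ * (400 * _))%N (q * _)%N (n * (500 * _))%N; clear; lia.
- move=> k t kJ tT; rewrite u1 // /colval; case: ifP => // _.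
  by rewrite fhat_coef_col.
Qed.

End InterpolationSpec.

(** * Setting up, unpacking the basis, output *)

Notation vbe := 68%N (only parsing).
Notation vby := 69%N (only parsing).
Notation vue := 70%N (only parsing).
Notation vuj := 71%N (only parsing).
Notation vup := 72%N (only parsing).
Notation vuo := 73%N (only parsing).
Notation vus := 74%N (only parsing).
Notation vout := 75%N (only parsing).

Definition setup_cmd : cmd :=
  Seq (If (TZero (FAdd FOne FOne))
        (Seq (wasg vr (WConst 3))
        (Seq (fasg fz FOne) (fasg frinv (FDiv FOne (FAdd (FAdd FOne FOne) FOne)))))
        (Seq (wasg vr (WConst 2))
        (Seq (fasg fz FZero) (fasg frinv (FDiv FOne (FAdd FOne FOne))))))
 (Seq (wasg vJ (WSub (WMul (WConst 2) ca) (WConst 1)))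
 (Seq (wasg vT (WAdd (WAdd cq (WDiv (WMul cb (WSub (WMul (WConst 2) ca) (WConst 2))) ca))
                     (WConst 1)))
      (wasg vST (WMul (WConst 2) (X vT))))).

Definition lead_y (e : wexpr) : wexpr := WGet 5 (WGet 3 e).

Definition scan_cmd : cmd :=
  Seq (wasg vbe (WConst 0))
 (Seq (wasg vby (WConst 0))
 (For vue (WGet 0 (WConst 6))
   (If (TLt (X vuj) (lead_y (X vue))) Skip
   (If (TLt (lead_y (X vue)) (X vby)) Skip
     (Seq (wasg vbe (X vue)) (wasg vby (WAdd (lead_y (X vue)) (WConst 1)))))))).

(** The Y-exponent of a term after multiplication by the power of Y. *)
Definition term_y : wexpr := WAdd (WGet 5 (WAdd (X vuo) (X vup))) (X vus).

Definition row_cmd : cmd :=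
  Seq (wasg vuo (WGet 3 (X vbe)))
 (Seq (wasg vus (WSub (X vuj) (WGet 5 (X vuo))))
 (Seq (WSet aFD (X vuj) (WAdd (WGet 4 (X vuo)) (WDiv (WMul cb (X vuj)) ca)))
 (For vup (WSub (WGet 3 (WAdd (X vbe) (WConst 1))) (X vuo))
   (FSet aG (WAdd (WMul (WAdd (WMul (X vuj) (X vJ)) term_y) (X vST))
                  (WSub (WGet aFD (X vuj))
                        (WAdd (WDiv (WMul cb term_y) ca) (WGet 4 (WAdd (X vuo) (X vup))))))
            (FGet 4 (WAdd (X vuo) (X vup))))))).

Definition unpack_cmd : cmd := For vuj (X vJ) (Seq scan_cmd row_cmd).

Definition output_cmd : cmd :=
  Seq (wasg vout (WMul (X vJ) cq))
 (Seq (For vup (X vout)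
    (Seq (WSet 1 (X vup) (wmod (X vup) cq))
    (Seq (WSet 2 (X vup) (WDiv (X vup) cq))
         (FSet 0 (X vup) (FGet aU (WAdd (WMul (WGet 2 (X vup)) (X vST))
            (WSub (WSub (WSub (X vT) (WConst 1)) (WDiv (WMul cb (WGet 2 (X vup))) ca))
                  (WGet 1 (X vup)))))))))
  (WSet 0 (WConst 0) (X vout))).

(** The radix must be invertible in the field. *)
Definition radix (F : fieldType) : nat := if (1 + 1 == 0 :> F) then 3 else 2.

Lemma radix_unit (F : fieldType) : (radix F)%:R != 0 :> F.
Proof.
rewrite /radix; case: (1 + 1 =P 0 :> F) => [e|/eqP e]; last by rewrite mulr2n.
by rewrite mulrS mulr2n e addr0 oner_neq0.
Qed.

Section SetupSpec.
Context (F : finFieldType) (W V : nat).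
Hypothesis V_ge : (250 <= V)%N.
Hypothesis W_ge : (V ^ wlim <= W)%N.
Implicit Types (s : store F).
Let wp := @wp F W V.
Context (a b : nat).
Local Notation q := (fq F).
Local Notation J := (2 * a - 1)%N.
Local Notation T := (q + fl a b (2 * a - 2) + 1)%N.

Lemma setup_spec s : (wtab s 0 0 = q) -> wtab s 0 1 = a -> wtab s 0 2 = b ->
  (J <= V)%N -> (2 * T <= V)%N ->
  forall Q, (forall d s', (d <= 200)%N -> frame [:: vr; vJ; vT; vST] [:: fz; frinv] s s' ->
    wtab s' vr 0 = radix F -> 
    (radix F == 2)%N && (ftab s' fz 0 == 0) || (radix F == 3)%N && (ftab s' fz 0 == 1) ->
    ftab s' frinv 0 = (radix F)%:R^-1 ->
    wtab s' vJ 0 = J -> wtab s' vT 0 = T -> wtab s' vST 0 = (2 * T)%N -> Q d s') ->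
  wp setup_cmd s Q.
Proof.
move=> e0 e1 e2 JV TV Q hQ.
have V3 : (3 <= V)%N by lia.
have V2 : (2 <= V)%N by lia.
have TV' : (T <= V)%N by lia.
have E := (e0, e1, e2).
apply: wp_seq.
apply: (@wp_conseq _ _ _ _ _ (fun d s1 => [/\ (d <= 100)%N, frame [:: vr] [:: fz; frinv] s s1,
  wtab s1 vr 0 = radix F,
  (radix F == 2)%N && (ftab s1 fz 0 == 0) || (radix F == 3)%N && (ftab s1 fz 0 == 1) &
  ftab s1 frinv 0 = (radix F)%:R^-1])).
  have u := radix_unit F.
  apply: (wp_if V_ge W_ge) => //=; case: ifP => h.
    have rE : radix F = 3 by rewrite /radix h.
    rewrite rE in u *.
    wset E 3%N => //; fset E (1 : F) => //; flast E (3%:R^-1 : F).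
    - by split=> //=; move: u; rewrite mulrS mulr2n addrA.
    - by rd E; rewrite mul1r mulrS mulr2n addrA.
    by split; [by []|fr|by rd E|rd E; rewrite eqxx|by rd E].
  have rE : radix F = 2 by rewrite /radix h.
  rewrite rE in u *.
  wset E 2%N => //; fset E (0 : F) => //; flast E (2%:R^-1 : F).
  - by split=> //=; move: u; rewrite mulr2n.
  - by rd E; rewrite mul1r mulr2n.
  by split; [by []|fr|by rd E|rd E; rewrite eqxx|by rd E].
move=> d s1 _ [hd f1 r1 z1 i1].
have E1 : (wtab s1 0 0 = q) * (wtab s1 0 1 = a) * (wtab s1 0 2 = b) by rewrite !f1.1.
wset E1 (2 * a - 1)%N => //.
wset E1 (q + fl a b (2 * a - 2) + 1)%N => //.
wlast E1 (2 * (q + fl a b (2 * a - 2) + 1))%N => //.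
apply: hQ; try by rd E1.
- by move: hd; rewrite /=; clear; lia.
- by do ![apply: frame_setw => //]; frt f1; fr.
Qed.

End SetupSpec.

Arguments lmon : simpl never.

Section UnpackSpec.
Context (F : finFieldType) (W V : nat).
Hypothesis V_ge : (250 <= V)%N.
Hypothesis W_ge : (V ^ wlim <= W)%N.
Implicit Types (s : store F).
Let wp := @wp F W V.
Local Notation q := (fq F).
Context (a b n : nat) (H : {poly {poly F}}) (P : 'I_n -> F * F).
Context (G : seq {poly {poly F}}).
Hypothesis cab : Cab_poly a b H.
Hypothesis HP : forall i, H.[(P i).1, (P i).2] = 0.
Hypothesis gb : reduced_Groebner_basis a b (vanishing_ideal P) G.
Local Notation lm := (lmon a b).
Context (J T ST : nat).
Hypothesis JE : J = (2 * a - 1)%N.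
Hypotheses (JV : (J < V)%N) (TV : (T <= V)%N) (TS : (T <= ST)%N) (suppV : (q.+1 * a.+1 <= V)%N).
Hypothesis floT : forall k, (k < J)%N -> (fl a b k + q < T)%N.

(** The element with the highest leading Y-exponent up to j among the first e, and that
    exponent plus 1; a second component 0 means that there is none. *)
Fixpoint scan j e : nat * nat :=
  if e is e'.+1 then
    if ((lm G`_e').2 <= j)%N && ((scan j e').2 <= (lm G`_e').2)%N
    then (e', (lm G`_e').2.+1) else scan j e'
  else (0, 0)%N.

Lemma scanS j e : scan j e.+1 =
  if ((lm G`_e).2 <= j)%N && ((scan j e).2 <= (lm G`_e).2)%N
  then (e, (lm G`_e).2.+1) else scan j e.
Proof. by []. Qed.

Lemma scanP j e : 
  (forall e', (e' < e)%N -> ((lm G`_e').2 <= j)%N -> ((lm G`_e').2 < (scan j e).2)%N) /\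
  ((0 < (scan j e).2)%N -> [/\ ((scan j e).1 < e)%N, ((lm G`_(scan j e).1).2 <= j)%N &
     (scan j e).2 = (lm G`_(scan j e).1).2.+1]).
Proof.
elim: e => [|e [IH1 IH2]]; first by split.
rewrite !scanS; case: ifP => [/andP[h1 h2]|h] /=.
  split=> // e'; rewrite ltnS leq_eqVlt => /orP[/eqP ->//|h3 h4].
  exact: leq_trans (IH1 e' h3 h4) (leqW h2).
split=> [e'|/IH2[h1 h2 h3]]; last by split=> //; apply: ltnW.
rewrite ltnS leq_eqVlt => /orP[/eqP ->|h3 h4]; last exact: IH1.
by move=> h4; move: h; rewrite h4 /= => /negbT; rewrite -ltnNge.
Qed.

Definition baseof j : nat := (scan j (size G)).1.

Lemma baseof_is j : is_base a b G j (baseof j).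
Proof.
have [h1 h2] := scanP j (size G); have [g gG [_ g2]] := gb_right cab gb.
have gi : (index g G < size G)%N by rewrite index_mem.
have := h1 _ gi; rewrite nth_index // g2 => /(_ (leq0n _)) h0.
have [k1 k2 k3] := h2 h0; split=> // e' ee ej.
by have := h1 e' ee ej; rewrite k3 ltnS.
Qed.

Definition srt (g : {poly {poly F}}) : seq (nat * nat) := sort (fun u v => mon_le a b v u) (supp g).
(** The place where the terms of the e-th element begin. *)
Definition off e : nat := (\sum_(i < e) size (supp G`_i))%N.

(** The tables that hold the basis and the sizes. *)
Definition gb_ok s : Prop :=
  ((wtab s 0 1 = a) * (wtab s 0 2 = b) * (wtab s 0 6 = size G) * (wtab s vJ 0 = J) *
   (wtab s vST 0 = ST)) *
  (forall e, (e <= size G)%N -> wtab s 3 e = off e) *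
  (forall e p, (e < size G)%N -> (p < size (supp G`_e))%N ->
    (wtab s 4 (off e + p)%N = (nth (0, 0)%N (srt G`_e) p).1) *
    (wtab s 5 (off e + p)%N = (nth (0, 0)%N (srt G`_e) p).2) *
    (ftab s 4 (off e + p)%N = coefXY G`_e (nth (0, 0)%N (srt G`_e) p))).

Lemma gb_frame ws fs s s' : frame ws fs s s' ->
  ~~ has (mem ws) [:: 0%N; vJ; vST; 3%N; 4%N; 5%N] -> ~~ has (mem fs) [:: 4%N] ->
  gb_ok s -> gb_ok s'.
Proof.
move=> f /=; rewrite !negb_or => /and5P[h1 h2 h3 h4 /and3P[h5 h6 _]] /andP[k1 _] [[p1 p2] p3].
split; last by move=> e p eG pe; rewrite !f.1 // f.2 //; apply: p3.
split; last by move=> e eG; rewrite f.1 // p2.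
by do ![split]; rewrite f.1 // p1.
Qed.

Lemma lead_in e : (e < size G)%N -> (0 < size (supp G`_e))%N.
Proof.
move=> eG; have [[l _] _] := gb_lm cab gb (mem_nth 0 eG).
by case: (supp _) l.
Qed.

Lemma lead_nth g : lm g = nth (0, 0)%N (srt g) 0.
Proof. by rewrite nth0. Qed.

Lemma scan_spec j s : gb_ok s -> wtab s vuj 0 = j -> (j < J)%N ->
  forall Q, (forall d s', (d <= 100 * (a + 3))%N -> frame [:: vbe; vby; vue] [::] s s' ->
    wtab s' vbe 0 = baseof j -> Q d s') ->
  wp scan_cmd s Q.
Proof.
move=> so ej jJ Q hQ; have V0 : (0 < V)%N by lia.
have sG := gb_size cab HP gb.
wset ej 0%N => //; wset ej 0%N => //.
set s1 := setw _ _ _ _.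
have f1 : frame [:: vbe; vby] [::] s s1 by rewrite /s1; fr.
have so1 : gb_ok s1 by apply: gb_frame f1 _ _ so.
pose P1 e s2 := wtab s2 vbe 0 = (scan j e).1 /\ wtab s2 vby 0 = (scan j e).2.
have P10 : P1 0%N s1 by rewrite /s1; split; rd ej.
clearbody s1.
apply: (@wp_for F W V V_ge W_ge vue _ _ [:: vbe; vby; vue] [::] (size G) (fun=> 60%N) P1) => //=.
- by rewrite so1.
- by move: sG JE JV; lia.
- move=> e s2 eG f2 x2 [b2 y2].
  have so2 : gb_ok s2 by apply: gb_frame f2 _ _ so1.
  have ly : wtab s2 5 (wtab s2 3 e) = (lm G`_e).2.
    by rewrite so2 ?(ltnW eG) // -[off e]addn0 (so2.2 e 0%N) ?lead_in // -lead_nth.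
  have E : (wtab s2 vue 0 = e) * (wtab s2 vuj 0 = j) * (wtab s2 5 (wtab s2 3 e) = (lm G`_e).2) *
     (wtab s2 vby 0 = (scan j e).2).
    by rewrite x2 ly y2 f2.1 // f1.1 // ej.
  have yJ : ((lm G`_e).2 <= a)%N by case: (gb_lm_le cab HP gb (mem_nth 0 eG)).
  apply: (wp_if V_ge W_ge) => //=; rewrite !E.
  case: ltnP => h1.
    apply: wp_skip; split; [by []|by fr|by []|].
    by rewrite /P1 /= leqNgt h1.
  apply: (wp_if V_ge W_ge) => //=; rewrite !E.
  case: ltnP => h2.
    apply: wp_skip; split; [by []|by fr|by []|].
    by rewrite /P1 /= [X in _ && X]leqNgt h2 andbF.
  wset E e; first by move: sG JE JV; lia.
  wlast E (lm G`_e).2.+1; [by rewrite addn1|by move: JE JV; lia|].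
  split; [by []|fr|by rd E|].
  by rewrite /P1 /= h1 h2; split; rd E.
move=> d s2 hd f2 [b2 y2]; apply: hQ => //.
- by move: hd; rewrite sum_nat_const card_ord /=; move: sG; clear; lia.
- by frt f2; frt f1; fr.
Qed.

Local Notation rd_ := (rdeg a b G baseof).
Local Notation rw := (rowp a b G baseof).
Local Notation flo := (fl a b).

Definition row_entry j k d : F :=
  if (flo k + d <= rd_ j + flo j)%N
  then coefXY (rw j) (rd_ j + flo j - flo k - d, k)%N else 0.

Lemma srt_uniq g : uniq (srt g).
Proof.
rewrite sort_uniq /supp filter_uniq // allpairs_uniq ?iota_uniq //.
by move=> [x y] [x' y'].
Qed.

(** Distinct terms of the element go to distinct entries, so after p terms an entry is
    set exactly when its monomial is one of the first p. *)
Lemma row_spec j s : gb_ok s -> wtab s vuj 0 = j -> wtab s vbe 0 = baseof j -> (j < J)%N ->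
  (forall k d, (k < J)%N -> (d < ST)%N -> G_ J ST s j k d = 0) ->
  forall Q, (forall d s', (d <= 200 * (q.+1 * a.+1).+1)%N ->
    frame [:: vuo; vus; aFD; vup] [:: aG] s s' ->
    (forall k, wtab s' aFD k = if k == j then (rd_ j + flo j)%N else wtab s aFD k) ->
    (forall j' k d, (j' < J)%N -> (k < J)%N -> (d < ST)%N -> G_ J ST s' j' k d =
       if j' == j then row_entry j k d else G_ J ST s j' k d) -> Q d s') ->
  wp row_cmd s Q.
Proof.
move=> so ej eb jJ G0 Q hQ.
have [eG ey _] := baseof_is j; set e := baseof j in eG ey eb.
have bP : forall i, (i < J)%N -> is_base a b G i (baseof i) by move=> i _; apply: baseof_is.
have gG : G`_e \in G by rewrite mem_nth.
have E := (so, ej, eb).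
have offV : bounded V s -> (off e <= V)%N by move=> bs; rewrite -(so.1.2 e (ltnW eG)).
apply: wp_bounded => bs.
have lx : wtab s 4 (off e) = (lm G`_e).1 by rewrite -[off e]addn0 (so.2 e 0%N) ?lead_in // -lead_nth.
have ly : wtab s 5 (off e) = (lm G`_e).2 by rewrite -[off e]addn0 (so.2 e 0%N) ?lead_in // -lead_nth.
wset E (off e); [by rewrite ?so ?(ltnW eG)|exact: offV|].
wset E (rowshift a b G baseof j); [by rewrite ly|by rewrite /rowshift; move: JV jJ; lia|].
have rdq := rdeg_le cab HP gb bP jJ.
have fT := floT jJ; rewrite -/(fq F) in rdq.
have FV : (rd_ j + flo j < T)%N by move: fT rdq; lia.
apply: wp_seq; wput E j (rd_ j + flo j)%N.
- by rewrite lx.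
- by move: FV TV; lia.
set s1 := setw _ _ _ _.
have f1 : frame [:: vuo; vus; aFD] [::] s s1 by rewrite /s1; fr.
have so1 : gb_ok s1 by apply: gb_frame f1 _ _ so.
have E1 : (wtab s1 vuj 0 = j) * (wtab s1 vbe 0 = e) * (wtab s1 vuo 0 = off e) *
   (wtab s1 vus 0 = rowshift a b G baseof j) * (wtab s1 aFD j = rd_ j + flo j)%N.
  by rewrite /s1; do ![split]; rd E; rewrite ?eqxx.
have FD1 k : wtab s1 aFD k = if k == j then (rd_ j + flo j)%N else wtab s aFD k.
  by rewrite /s1; rd E.
have G1 j' k d : G_ J ST s1 j' k d = G_ J ST s j' k d by [].
clearbody s1.
set g := G`_e in gG lx ly; set S := srt g.
have sS : size S = size (supp g) by rewrite size_sort.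
have sq := supp_size cab HP gb gG; rewrite -/(fq F) in sq.
pose fd := (rd_ j + flo j)%N; pose sh := rowshift a b G baseof j.
pose P2 p s2 := forall j' k d, (j' < J)%N -> (k < J)%N -> (d < ST)%N -> G_ J ST s2 j' k d =
  if j' == j then
    if [&& flo k + d <= fd, sh <= k & index (fd - flo k - d, k - sh) S < p]%N
    then coefXY g (fd - flo k - d, k - sh)%N else 0
  else G_ J ST s j' k d.
eapply (@wp_for F W V V_ge W_ge vup _ _ [:: vup] [:: aG] (size (supp g)) (fun=> 90%N) P2) => //=.
- rewrite !E1 addn1 !so1 ?(ltnW eG) //.
  by rewrite /off big_ord_recr /= addKn.
- exact: leq_trans sq suppV.
- move=> j' k d j'J kJ dS; rewrite G1; case: eqP => // ->.
  by rewrite !andbF G0.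
- move=> p s2 pg f2 x2 p2.
  have so2 : gb_ok s2 by apply: gb_frame f2 _ _ so1.
  have E2 : (wtab s2 vup 0 = p) * (wtab s2 vuj 0 = j) * (wtab s2 vuo 0 = off e) *
    (wtab s2 vus 0 = sh) * (wtab s2 aFD j = fd) * (wtab s2 0 1 = a) * (wtab s2 0 2 = b) *
    (wtab s2 vJ 0 = J) * (wtab s2 vST 0 = ST).
    by rewrite x2 !so2 !(f2.1 vuj) // !(f2.1 vuo) // !(f2.1 vus) // !(f2.1 aFD) // !E1.
  have pS := so2.2 e p eG pg; rewrite -/g -/S in pS.
  set w := nth _ S p in pS.
  have wS : w \in S by rewrite mem_nth // sS.
  have wg : coefXY g w != 0 by move: wS; rewrite mem_sort mem_supp.
  set K := (w.2 + sh)%N.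
  have wr : coefXY (rw j) (w.1, K) != 0.
    by rewrite rowp_coef -/e -/g -/sh /K leq_addl addnK; case: (w) wg.
  have KJ : (K < J)%N := rowp_col cab HP gb JE bP jJ wr.
  have KT : (w.1 + flo K <= fd)%N := rowp_time cab gb JE bP jJ wr.
  set D := (fd - (flo K + w.1))%N.
  have DS : (D < ST)%N by move: FV TS; rewrite -/fd /D; lia.
  fput E2 ((j * J + K) * ST + D)%N (coefXY g w) => //.
  + by rewrite !pS.
  + by rd E2; rewrite pS.
  split; [by []|fr|by rd E2|].
  move=> j' k d j'J kJ dS; rewrite /G_; rd E2.
  rewrite cell_eq // cell_eq //.
  case: (boolP (_ && _)) => [/andP[/andP[/eqP -> /eqP ->] /eqP ->]|h].
    have e1 : (fd - flo K - D = w.1)%N by rewrite /D; move: KT; lia.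
    have e2 : (K - sh = w.2)%N by rewrite /K addnK.
    rewrite eqxx e1 e2 ifT; first by case: (w).
    rewrite -surjective_pairing index_uniq ?sS ?srt_uniq // ltnSn andbT.
    by rewrite [(sh <= K)%N]leq_addl andbT /D; move: KT; clear; lia.
  rewrite -/(G_ J ST s2 j' k d) p2 //; case: (j' =P j) h => //= _ h.
  case: (boolP (flo k + d <= fd)%N) => //= h1; case: (boolP (sh <= k)%N) => //= h2.
  congr (if _ then _ else _); rewrite ltnS [in RHS]leq_eqVlt.
  case: eqP => //= ei; case/negP: h; set u := (_, _) in ei.
  have uw : u = w by rewrite /w -ei nth_index // -index_mem ei sS.
  have u1 := congr1 fst uw; have u2 := congr1 snd uw; rewrite /u /= in u1 u2.
  have kK : k = K by rewrite /K -u2 subnK.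
  by rewrite -kK eqxx /=; rewrite /D -u1 -kK; move: h1; clear; lia.
move=> d s2 hd f2 p2; apply: hQ.
- move: hd; rewrite sum_nat_const card_ord /=; move: sq; clear; lia.
- by frt f2; frt f1; fr.
- by move=> k; rewrite f2.1 // FD1.
- move=> j' k d' j'J kJ dS; rewrite p2 //; case: eqP => // _.
  rewrite /row_entry -/fd; case: (boolP (flo k + d' <= fd)%N) => //= h1.
  rewrite rowp_coef -/e -/g -/sh; case: (sh <= k)%N => //=.
  rewrite -sS index_mem mem_sort mem_supp.
  by case: eqP => // ->.
Qed.

Lemma unpack_spec s : gb_ok s ->
  (forall j k d, (j < J)%N -> (k < J)%N -> (d < ST)%N -> G_ J ST s j k d = 0) ->
  forall Q, (forall d s', (d <= (400 * (q.+1 * a.+1 + a + 3)) * J.+1)%N ->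
    frame [:: vuj; vbe; vby; vue; vuo; vus; aFD; vup] [:: aG] s s' ->
    (forall k, (k < J)%N -> wtab s' aFD k = (rd_ k + flo k)%N) ->
    (forall j k d, (j < J)%N -> (k < J)%N -> (d < ST)%N -> G_ J ST s' j k d = row_entry j k d) ->
    Q d s') ->
  wp unpack_cmd s Q.
Proof.
move=> so G0 Q hQ.
pose P1 i s1 := (forall k, (k < i)%N -> wtab s1 aFD k = (rd_ k + flo k)%N) /\
  forall j k d, (j < J)%N -> (k < J)%N -> (d < ST)%N -> G_ J ST s1 j k d =
    if (j < i)%N then row_entry j k d else 0.
apply: (@wp_for F W V V_ge W_ge vuj _ _ [:: vuj; vbe; vby; vue; vuo; vus; aFD; vup] [:: aG] J
  (fun=> 300 * (q.+1 * a.+1 + a + 3))%N P1) => //=.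
- by rewrite so.
- exact: ltnW.
- move=> i s1 iJ f1 x1 [p1 p2].
  have so1 : gb_ok s1 by apply: gb_frame f1 _ _ so.
  apply: wp_seq; apply: (scan_spec so1 x1 iJ) => d2 s2 hd2 f2 b2.
  have so2 : gb_ok s2 by apply: gb_frame f2 _ _ so1.
  have x2 : wtab s2 vuj 0 = i by rewrite f2.1.
  have g2 j k d : G_ J ST s2 j k d = G_ J ST s1 j k d by rewrite /G_ f2.2.
  apply: (row_spec so2 x2 b2 iJ) => [k d kJ dS|d3 s3 hd3 f3 p3 p4].
    by rewrite g2 p2 // ltnn.
  split.
  + by move: hd2 hd3; clear; lia.
  + by frt f3; frt f2; fr.
  + by rewrite f3.1.
  split=> [k|j k d jJ kJ dS].
    by rewrite ltnS leq_eqVlt p3 f2.1 //; case: (k =P i) => [->//|_ /= ki]; apply: p1.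
  rewrite p4 // g2 p2 // ltnS [in RHS]leq_eqVlt; case: (j =P i) => [->|_] //=.
- move=> d s1 hd f1 [p1 p2]; apply: hQ => //.
    move: hd; rewrite sum_nat_const card_ord /= => hd; apply: leq_trans hd _.
    rewrite (_ : 400 * _ = 100 * (q.+1 * a.+1 + a + 3) + 300 * (q.+1 * a.+1 + a + 3))%N; last by lia.
    rewrite [X in (_ <= X)%N]mulnDl; apply: leq_add; first by rewrite leq_mul2r; apply/orP; right; lia.
    by rewrite mulnC leq_mul2l leqnSn orbT.
  by move=> j k d' jJ kJ dS; rewrite p2 // jJ.
Qed.

End UnpackSpec.
Section OutputSpec.
Context (F : finFieldType) (W V : nat).
Hypothesis V_ge : (250 <= V)%N.
Hypothesis W_ge : (V ^ wlim <= W)%N.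
Implicit Types (s : store F).
Let wp := @wp F W V.
Local Notation q := (fq F).
Context (a b J T ST : nat).

Definition out_ok s (u : nat -> nat -> F) : Prop :=
  wtab s 0 0 = (J * q)%N /\ forall p, (p < J * q)%N ->
    (wtab s 1 p = p %% q)%N * (wtab s 2 p = p %/ q)%N * (ftab s 0 p = u (p %% q) (p %/ q))%N.

Lemma out_ok_terms s u : out_ok s u ->
  out_terms s = [seq ((p %% q, p %/ q), u (p %% q) (p %/ q))%N | p <- iota 0 (J * q)].
Proof.
move=> [e0 e]; rewrite /out_terms e0; apply/eq_in_map => p.
by rewrite mem_iota add0n => pn; rewrite !e.
Qed.

Lemma out_ok_outputs s u (f : {poly {poly F}}) : out_ok s u ->
  (forall x k, coefXY f (x, k) = if (x < q)%N && (k < J)%N then u x k else 0) ->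
  outputs s f.
Proof.
move=> h fE; have q0 : (0 < q)%N by apply: ltnW; apply: finNzRing_gt1.
rewrite /outputs (out_ok_terms h); split.
  rewrite -map_comp map_inj_uniq ?iota_uniq // => x y [e1 e2].
  by rewrite (divn_eq x q) (divn_eq y q) e1 e2.
apply: coefXY_ext => -[x k]; rewrite fE big_map coefXY_sum.
under eq_bigr => p _ do rewrite coefXY_mon /=.
case: ifP => [/andP[xq kJ]|nh].
  have pin : (k * q + x < J * q)%N.
    by apply: (@leq_trans (k.+1 * q)); [rewrite mulSn addnC ltn_add2r|rewrite leq_mul2r kJ orbT].
  rewrite (bigD1_seq (k * q + x)%N) ?iota_uniq ?mem_iota //= modnMDl divnMDl //.
  rewrite modn_small // divn_small // addn0 eqxx big1 ?addr0 // => p pk.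
  case: eqP => // -[e1 e2]; case/eqP: pk.
  by rewrite (divn_eq p q) -e1 -e2.
rewrite big_seq big1 // => p; rewrite mem_iota add0n => pJ.
case: eqP => // -[e1 e2]; move: nh; rewrite e1 e2 ltn_mod q0 /=.
by rewrite ltn_divLR //; case/andP: pJ => _ ->.
Qed.

Lemma output_spec s : wtab s 0 0 = q -> wtab s 0 1 = a -> wtab s 0 2 = b ->
  wtab s vJ 0 = J -> wtab s vT 0 = T -> wtab s vST 0 = ST -> (J * q <= V)%N ->
  forall Q, (forall d s', (d <= 200 * (J * q).+1)%N ->
    out_ok s' (fun x k => U_ ST s k (T - 1 - fl a b k - x)) -> Q d s') ->
  wp output_cmd s Q.
Proof.
move=> e0 e1 e2 e3 e4 e5 JqV Q hQ.
have E := (e0, e1, e2, e3, e4, e5).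
wset E (J * q)%N => //.
set s1 := setw _ _ _ _.
have o1 : wtab s1 vout 0 = (J * q)%N by [].
have E1 : (wtab s1 0 0 = q) * (wtab s1 0 1 = a) * (wtab s1 0 2 = b) * (wtab s1 vJ 0 = J) *
  (wtab s1 vT 0 = T) * (wtab s1 vST 0 = ST).
  by rewrite /s1; do ![split]; rd E.
have U1 p : ftab s1 aU p = ftab s aU p by [].
clearbody s1; apply: wp_seq.
pose u x k := U_ ST s k (T - 1 - fl a b k - x).
pose P1 i s2 := forall p, (p < i)%N ->
    (wtab s2 1 p = p %% q)%N * (wtab s2 2 p = p %/ q)%N * (ftab s2 0 p = u (p %% q) (p %/ q))%N.
apply: (@wp_for F W V V_ge W_ge vup _ _ [:: vup; 1%N; 2%N] [:: 0%N] (J * q) (fun=> 100%N) P1) => //=.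
- move=> p s2 pn f2 x2 p2.
  have E2 : (wtab s2 0 0 = q) * (wtab s2 0 1 = a) * (wtab s2 0 2 = b) * (wtab s2 vJ 0 = J) *
    (wtab s2 vT 0 = T) * (wtab s2 vST 0 = ST) * (wtab s2 vup 0 = p).
    by rewrite x2 !f2.1 // !E1.
  have pV : (p <= V)%N by apply: leq_trans (ltnW pn) JqV.
  apply: wp_seq; wput E2 p (p %% q)%N => //.
    by apply: leq_trans (leq_mod _ _) pV.
  apply: wp_seq; wput E2 p (p %/ q)%N => //.
    by apply: leq_trans (leq_div _ _) pV.
  fput E2 p (u (p %% q) (p %/ q))%N => //.
    by rd E2; rewrite !eqxx /= /u /U_ f2.2 // U1.
  split; [by []|fr|by rd E2|].
  move=> p'; rewrite ltnS leq_eqVlt; rd E2; case: (p' =P p) => [->|_] //=.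
  by move=> h; have := p2 p' h.
move=> d s2 hd f2 p2.
have e : wtab s2 vout 0 = (J * q)%N by rewrite f2.1.
wput e 0%N (J * q)%N => //.
apply: hQ.
- by move: hd; rewrite sum_nat_const card_ord /=; clear; lia.
- split; first by rd e.
  by move=> p pn; rd e; have := p2 p pn.
Qed.

End OutputSpec.

(** * The whole program *)

Definition main_cmd : cmd :=
  Seq setup_cmd (Seq interp_cmd (Seq unpack_cmd (Seq division_cmd output_cmd))).

(** Shifting by less than a, the rows reach Y-exponents up to 2 a - 2. *)
Definition cols (a : nat) : nat := (2 * a - 1)%N.
(** Exceeds the time of every leading monomial of a row. *)
Definition times (q a b : nat) : nat := (q + fl a b (2 * a - 2) + 1)%N.

Definition main_cost (q a b n r : nat) : nat :=
  (200 + (100 * n.+1 + q * (400 * (n + a + q + 3)) + n * (500 * (a + q + 3)))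
   + 400 * (q.+1 * a.+1 + a + 3) * (cols a).+1
   + (30 * (times q a b).+1 +
      \sum_(c < times q a b) round_cost a (cols a) (times q a b) r c)
   + 200 * (cols a * q).+1)%N.

Section MainSpec.
Context (F : finFieldType) (W V : nat).
Hypothesis V_ge : (250 <= V)%N.
Hypothesis W_ge : (V ^ wlim <= W)%N.
Implicit Types (s : store F).
Let wp := @wp F W V.
Local Notation q := (fq F).
Context (a b n m : nat) (H : {poly {poly F}}) (P : 'I_n -> F * F).
Context (G : seq {poly {poly F}}) (c : 'rV[F]_n).
Hypothesis cab : Cab_poly a b H.
Hypothesis HP : forall i, H.[(P i).1, (P i).2] = 0.
Hypothesis P_inj : injective P.
Hypothesis gb : reduced_Groebner_basis a b (vanishing_ideal P) G.
Hypothesis cc : Cab_code a b m P c.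
Local Notation J := (cols a).
Local Notation T := (times q a b).
Local Notation r := (radix F).
Hypotheses (qV : (q < V)%N) (nV : (n <= V)%N).
Hypotheses (JTV : (J * (2 * T) <= V)%N) (suppV : (q.+1 * a.+1 <= V)%N).
Hypothesis S_le : forall L, (0 < L <= T)%N ->
  (r ^ (nuof r L + 2 * depth (nuof r L)) + r ^ (nuof r L + 2 * depth (nuof r L)) <= V)%N.

Let a_gt0 : (0 < a)%N. Proof. by case: cab => [[]]. Qed.
Let q_gt1 : (1 < q)%N. Proof. exact: finNzRing_gt1. Qed.

Lemma fl_mono k k' : (k <= k')%N -> (fl a b k <= fl a b k')%N.
Proof. by move=> h; rewrite /fl leq_div2r // leq_mul2l h orbT. Qed.

Lemma fl_times k : (k < J)%N -> (fl a b k + q < T)%N.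
Proof.
move=> kJ; have := @fl_mono k (2 * a - 2) ltac:(by move: kJ; rewrite /cols; lia).
rewrite /times; lia.
Qed.

(** What the program relies on in the initial store. *)
Definition loaded s : Prop :=
  [/\ (wtab s 0 0 = q) * (wtab s 0 1 = a) * (wtab s 0 2 = b) * (wtab s 0 4 = n) *
      (wtab s 0 6 = size G),
      forall i : 'I_n, (ftab s 1 i = (P i).1) * (ftab s 2 i = (P i).2) * (ftab s 3 i = c ord0 i),
      forall e, (e <= size G)%N -> wtab s 3 e = off G e,
      forall e p, (e < size G)%N -> (p < size (supp G`_e))%N ->
        (wtab s 4 (off G e + p)%N = (nth (0, 0)%N (srt a b G`_e) p).1) *
        (wtab s 5 (off G e + p)%N = (nth (0, 0)%N (srt a b G`_e) p).2) *
        (ftab s 4 (off G e + p)%N = coefXY G`_e (nth (0, 0)%N (srt a b G`_e) p)) &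
      (forall t i, (5 < t)%N -> wtab s t i = 0%N) /\ (forall t i, (4 < t)%N -> ftab s t i = 0)].

(** At X = al the equation of the curve is a polynomial in Y of degree a, as Y^a is its
    only monomial of Y-degree at least a. *)
Lemma column_points (al : F) : (\sum_(i < n) ((P i).1 == al) <= a)%N.
Proof.
have -> : (\sum_(i < n) ((P i).1 == al) = #|[set i : 'I_n | (P i).1 == al]|)%N.
  by rewrite -sum1_card [RHS]big_mkcond /=; apply: eq_bigr => i _; rewrite inE; case: (_ == _).
set S := [set i | _]; pose h : {poly F} := H.[al%:P].
have [[_ b0] _ [_ Ha] Hd _] := cab.
have hc j : h`_j = \sum_(i < size H) H`_i`_j * al ^+ i.
  rewrite /h horner_coef coef_sum; apply: eq_bigr => i _.
  by rewrite -polyC_exp coefMC.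
have Hz i j : (a * b < a * i + b * j)%N -> H`_i`_j = 0.
  move=> lt; apply/eqP/negPn/negP => ne; have := Hd (i, j); rewrite mem_supp => /(_ ne).
  by rewrite /wdeg /=; lia.
have ha : h`_a != 0.
  rewrite hc; move: Ha; rewrite mem_supp /coefXY /= => Ha.
  case E : (size H) => [|z]; first by move: Ha; rewrite (nth_default 0 (s := H) (n := 0%N)) ?E // coef0 eqxx.
  rewrite big_ord_recl expr0 mulr1 big1 ?addr0 // => i _.
  rewrite Hz ?mul0r //= /bump /=; move: a_gt0 b0; clear; nia.
have hs : (size h <= a.+1)%N.
  apply/leq_sizeP => j aj; rewrite hc big1 // => i _; rewrite Hz ?mul0r //.
  have : (b * a.+1 <= b * j)%N by rewrite leq_mul2l aj orbT.
  by rewrite mulnS; lia.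
have h0 : h != 0 by apply: contraNneq ha => ->; rewrite coef0.
have := max_poly_roots (rs := [seq (P i).2 | i <- enum S]) h0.
rewrite size_map -cardE => lt; rewrite -ltnS; apply: leq_trans hs; apply: lt.
  apply/allP => y /mapP[i]; rewrite mem_enum inE => /eqP e ->.
  by rewrite /root /h -e HP.
rewrite map_inj_in_uniq ?enum_uniq // => i j; rewrite !mem_enum !inE => /eqP e1 /eqP e2 e.
by apply: P_inj; rewrite [P i]surjective_pairing [P j]surjective_pairing e1 e2 e.
Qed.

Local Notation rd_ := (rdeg a b G (baseof a b G)).

Lemma row_lead k : (k < J)%N -> row_entry a b G k k 0 = 1.
Proof.
move=> kJ; rewrite /row_entry addn0 leq_addl addnK subn0.
exact: (rowp_lead cab gb (fun i _ => baseof_is cab gb i) kJ).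
Qed.

(** With equal times, the weights differ by the difference of the remainders of b k and
    b j modulo a, so the monomial order decides by these and then by the exponent of Y. *)
Lemma row_later j k : (j < J)%N -> (k < J)%N -> j != k -> row_entry a b G j k 0 != 0 ->
  later a b k j.
Proof.
move=> jJ kJ jk; rewrite /row_entry addn0 subn0; case: ifP => [h|]; last by rewrite eqxx.
move=> /(rowp_LM cab gb (erefl J) (fun i _ => baseof_is cab gb i) jJ).
rewrite /mon_le /wdeg /later /=.
have eb z : (b * z = a * fl a b z + (b * z) %% a)%N by rewrite /fl [(a * _)%N]mulnC -divn_eq.
move: (eb k) (eb j); move: (b * k)%N (b * j)%N => x y ek ej.
move: (x %% a)%N (y %% a)%N ek ej => x' y' ek ej.
rewrite ek ej mulnBr addnA subnK; last by rewrite leq_mul2l h orbT.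
rewrite mulnDr; move: jk; clear; lia.
Qed.

Lemma main_spec s : loaded s ->
  wp main_cmd s (fun d s' => (d <= main_cost q a b n r)%N /\
    exists f, [/\ outputs s' f, in_RR a b m f, standard_form a f,
      forall u, u \in supp f -> u \in Bhat a b m P &
      forall i, f.[(P i).1, (P i).2] = c ord0 i]).
Proof.
case=> l0 lp lo lt [zw zf].
have JE : J = (2 * a - 1)%N by [].
have T0 : (0 < T)%N by rewrite /times addn1.
have J0 : (0 < J)%N by rewrite /cols; lia.
have TJ : (2 * T <= J * (2 * T))%N by rewrite leq_pmull.
have TV2 : (2 * T <= V)%N by apply: leq_trans TJ JTV.
have TV : (T < V)%N by lia.
have JqV : (J * q <= V)%N.
  by apply: leq_trans JTV; rewrite leq_mul2l /times; apply/orP; right; lia.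
have JV : (J < V)%N.
  apply: leq_trans JqV; rewrite -[X in (X < _)%N]muln1 ltn_mul2l; lia.
have aJ : (a <= J)%N by rewrite /cols; lia.
have aV : (a < V)%N by lia.
have floT k : (k < J)%N -> (fl a b k + q <= T)%N by move=> h; apply: ltnW; apply: fl_times.
pose xs p := ftab s 1 p; pose ys p := ftab s 2 p; pose cs p := ftab s 3 p.
have xy_inj i j : (i < n)%N -> (j < n)%N -> xs i = xs j -> ys i = ys j -> i = j.
  move=> iN jN; rewrite /xs /ys.
  have [[-> ->] _] := lp (Ordinal iN); have [[-> ->] _] := lp (Ordinal jN) => e1 e2.
  suff : Ordinal iN = Ordinal jN by case.
  by apply: P_inj; rewrite [LHS]surjective_pairing [RHS]surjective_pairing e1 e2.
have cnt_le al : (cnt xs al n <= a)%N.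
  apply: leq_trans (column_points al); rewrite /cnt; apply: leq_sum => i _.
  by rewrite /xs lp.
apply: wp_seq; apply: (setup_spec V_ge W_ge (a := a) (b := b)); rewrite ?l0 //; first by apply: ltnW.
move=> d1 s1 hd1 f1 r1 z1 i1 eJ1 eT1 eS1.
have in1 : inp_ok a b n T (2 * T) xs ys cs s1.
  by do ![split] => *; rewrite ?eT1 ?eS1 ?f1.1 ?f1.2 // l0.
apply: wp_seq; apply: (interp_spec V_ge W_ge xy_inj cnt_le aV qV nV aJ (erefl _) JTV floT in1).
- by move=> l; rewrite f1.1 // zw.
- by move=> k t kJ tT; rewrite /U_ f1.2 // zf.
move=> d2 s2 hd2 f2 U2.
have gb2 : gb_ok a b G J (2 * T) s2.
  split; first split.
  - by do ![split]; rewrite f2.1 // ?eJ1 ?eS1 // f1.1 // l0.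
  - by move=> e eG; rewrite f2.1 // f1.1 // lo.
  - by move=> e p eG pe; rewrite !f2.1 // !f1.1 // f2.2 // f1.2 //; apply: lt.
apply: wp_seq; apply: (unpack_spec V_ge W_ge cab HP gb JE JV (ltnW TV) _ suppV fl_times gb2).
- by lia.
- by move=> j k d jJ kJ dT; rewrite /G_ f2.2 // f1.2 // zf.
move=> d3 s3 hd3 f3 FD3 G3.
have f13 : frame [:: 71; 68; 69; 70; 73; 74; 9; 72; 62; 64; 67; 66; 65; 63; 8]%N
   [:: 12; 10; 25; 26; 27; 28; 29; 30; 13; 14; 24]%N s1 s3 by frt f3; frt f2; fr.
have e3 : (wtab s3 0 0 = q) * (wtab s3 0 1 = a) * (wtab s3 0 2 = b) *
   (wtab s3 vT 0 = T) * (wtab s3 vJ 0 = J) * (wtab s3 vST 0 = 2 * T)%N.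
  by rewrite !f13.1 // ?eT1 ?eJ1 ?eS1 // !f1.1 // !l0.
have so3 : sizes_ok a b J T (2 * T) (fun k => rd_ k + fl a b k)%N s3.
  by do ![split]; rewrite ?e3.
have r23 : (r == 2)%N || (r == 3)%N by rewrite /radix; case: ifP.
apply: wp_seq.
apply: (division_spec V_ge W_ge a_gt0 (ltnW aV) (ltnW JV) (erefl _) TV r23 (radix_unit F) S_le so3).
- by rewrite f13.1.
- by rewrite f13.2.
- by rewrite f13.2.
- by move=> k t kJ tT; rewrite /Q_ f13.2 // f1.2 // zf.
- by move=> k kJ; rewrite G3 ?row_lead //; lia.
- by move=> j k jJ kJ jk; rewrite G3 //; [apply: row_later|lia].
move=> d4 s4 hd4 f4 [_ Ua4 U4].
apply: (output_spec V_ge W_ge (a := a) (b := b) (J := J) (T := T) (ST := (2 * T)%N));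
  rewrite ?f4.1 ?e3 //.
move=> d5 s5 hd5 o5; split.
  by rewrite /main_cost; move: hd1 hd2 hd3 hd4 hd5; clear; lia.
pose fh := fhat_ n a xs ys cs n.
have bP : forall j, (j < J)%N -> is_base a b G j (baseof a b G j).
  by move=> j _; apply: (baseof_is cab gb).
have H1 x k : coefXY fh (x, k) != 0 -> (k < J)%N /\ (x + fl a b k < T)%N.
  rewrite fhat_coef; case: ifP => [/andP[xq ka] _|]; last by rewrite eqxx.
  have kJ : (k < J)%N by apply: leq_trans aJ.
  by split=> //; have := fl_times kJ; lia.
have H2 k t : (k < J)%N -> (t < T)%N -> U_ (2 * T) s3 k t =
    if (fl a b k <= T - 1 - t)%N then coefXY fh (T - 1 - t - fl a b k, k)%N else 0.
  by move=> kJ tT; rewrite /U_ f3.2 // -/(U_ _ _ _ _) U2.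
have H3 j k d : (j < J)%N -> (k < J)%N -> (d < T)%N -> G_ J (2 * T) s3 j k d =
    if (fl a b k + d <= rd_ j + fl a b j)%N
    then coefXY (rowp a b G (baseof a b G) j) (rd_ j + fl a b j - fl a b k - d, k)%N else 0.
  by move=> jJ kJ dT; rewrite G3 //; lia.
have H4 k t : (k < J)%N -> (t < T)%N -> U_ (2 * T) s4 k t = U_ (2 * T) s3 k t -
    \sum_(j < J) \sum_(i < t.+1) Q_ (2 * T) s4 j i * G_ J (2 * T) s3 j k (t - i).
  by move=> kJ tT; rewrite U4 /known ?tT //; lia.
have H5 k t : (k < J)%N -> (t < T)%N -> if act a b G (baseof a b G) T t k
    then U_ (2 * T) s4 k t = 0 else Q_ (2 * T) s4 k t = 0.
  by move=> kJ tT; have := Ua4 k t kJ tT; rewrite /active /act addnC.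
pose f := remainder a b G J (baseof a b G) T fh (Q_ (2 * T) s4).
have fc := remainder_coef cab HP gb JE bP H1 H2 H3 H4 H5.
have fs := remainder_standard cab HP gb JE bP H1 H2 H3 H4 H5.
have fe i : f.[(P i).1, (P i).2] = c ord0 i.
  rewrite /f (remainder_eval gb bP).
  have := fhat_eval cs xy_inj cnt_le (ltn_ord i); rewrite /xs /ys /cs.
  by have [[-> ->] ->] := lp i.
have [h1 h2 h3] := normal_form_correct cab HP gb cc fe (fun u hu => (fs u hu).1).
exists f; split=> //; apply: (out_ok_outputs o5) => x k.
rewrite -/f in fc; case: ifP => [/andP[xq kJ]|nh].
  rewrite fc kJ ifT; last by have := fl_times kJ; lia.
  by [].
apply/eqP/negPn/negP => ne; have us : (x, k) \in supp f by rewrite mem_supp.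
have [su kJ] := fs _ us; have xq := standard_x cab gb su.
by move: nh; rewrite kJ andbT /fq /= in xq *; rewrite xq.
Qed.

End MainSpec.

(** * The input tables and the word size *)

Lemma nth_offsets x (s : seq nat) e : (e <= size s)%N ->
  nth 0%N (x :: scanl addn x s) e = (x + sumn (take e s))%N.
Proof.
elim: s x e => [|y s IH] x [|e] //= es; rewrite ?addn0 //.
by rewrite -/(scanl addn _ _) (IH (x + y)%N) ?addnA.
Qed.

Lemma nth_flatten_map (A B : Type) (x0 : A) (y0 : B) (f : A -> B) (ss : seq (seq A)) e p :
  (e < size ss)%N -> (p < size (nth [::] ss e))%N ->
  nth y0 (map f (flatten ss)) (sumn (take e (map size ss)) + p) = f (nth x0 (nth [::] ss e) p).
Proof.
elim: ss e => [|s ss IH] [|e] //= es ps; rewrite map_cat nth_cat size_map.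
  by rewrite add0n ps (nth_map x0).
by rewrite -addnA ltnNge leq_addr /= addKn; apply: IH.
Qed.

Lemma nth_le_all V (s : seq nat) i : (forall x, x \in s -> (x <= V)%N) -> (nth 0%N s i <= V)%N.
Proof.
move=> h; case: (ltnP i (size s)) => is_; first by apply: h; apply: mem_nth.
by rewrite nth_default.
Qed.

Section InputTables.
Context (I : cab_input).
Hypothesis vI : valid_input I.
Local Notation F := (fld I).
Local Notation q := (fq (fld I)).
Local Notation a := (pa I).
Local Notation b := (pb I).
Local Notation n := (len I).
Local Notation H := (curve I).
Local Notation P := (@pts I).
Local Notation G := (gb I).

Let cab : Cab_poly a b H. Proof. by case: vI => [[]]. Qed.
Let HP : forall i, H.[(P i).1, (P i).2] = 0. Proof. by case: vI => [_ []]. Qed.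
Let rgb : reduced_Groebner_basis a b (vanishing_ideal P) G. Proof. by case: vI. Qed.

Let tG := [seq terms a b g | g <- G].

Lemma terms_size (g : {poly {poly F}}) : size (terms a b g) = size (supp g).
Proof. by rewrite size_map size_sort. Qed.

Lemma sum_off e : (e <= size G)%N -> sumn (take e (map size tG)) = off G e.
Proof.
elim: e => [|e IH] eG; first by rewrite take0 /off big_ord0.
rewrite (take_nth 0%N) ?size_map // sumn_rcons IH ?(ltnW eG) // /off big_ord_recr /=.
by rewrite -map_comp (nth_map 0) //= terms_size.
Qed.

Lemma load_loaded : loaded a b P G (cw I) (load I).
Proof.
split.
- by do ![split] => //=; rewrite size_map.
- move=> i; have iN := ltn_ord i.
  by do ![split]; rewrite /load /= (nth_map i) ?size_enum_ord // nth_ord_enum.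
- move=> e eG; rewrite -sum_off // -[RHS]add0n -nth_offsets ?size_map //.
- move=> e p eG pe; rewrite -sum_off ?(ltnW eG) //.
  have eT : (e < size tG)%N by rewrite size_map.
  have te : nth [::] tG e = terms a b G`_e by rewrite (nth_map 0).
  have pt : (p < size (nth [::] tG e))%N by rewrite te terms_size.
  pose x0 : nat * nat * F := ((0, 0)%N, 0).
  have tp : nth x0 (terms a b G`_e) p =
      (nth (0, 0)%N (srt a b G`_e) p, coefXY G`_e (nth (0, 0)%N (srt a b G`_e) p)).
    by rewrite (nth_map (0, 0)%N) // size_sort.
  have h (B : Type) (y0 : B) f := @nth_flatten_map _ B x0 y0 f _ _ _ eT pt.
  by do ![split]; rewrite /load /= h te tp.
- split=> t i ht; rewrite /load /= (nth_default [::]) ?nth_default //.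
Qed.

Lemma supp_curve u : u \in supp H -> (u.1 <= b)%N /\ (u.2 <= a)%N.
Proof.
have [[a0 b0] _ _ h _] := cab; move=> /h; rewrite /wdeg => w; split.
  by rewrite -(leq_pmul2l a0); apply: leq_trans w; apply: leq_addr.
by rewrite -(leq_pmul2l b0) [(b * a)%N]mulnC; apply: leq_trans w; apply: leq_addl.
Qed.

Lemma size_curve : (size (supp H) <= b.+1 * a.+1)%N.
Proof.
have -> : (b.+1 * a.+1 = size [seq (i, j) | i <- iota 0 b.+1, j <- iota 0 a.+1])%N.
  by rewrite size_allpairs !size_iota.
apply: uniq_leq_size.
  rewrite /supp filter_uniq // allpairs_uniq ?iota_uniq //.
  by move=> [x y] [x' y'].
move=> [i j] /supp_curve [/= h1 h2].
by apply: (@allpairs_f _ _ _ (fun x y : nat => (x, y)) (iota 0 b.+1) (iota 0 a.+1));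
  rewrite mem_iota add0n ltnS.
Qed.

Lemma off_le e : (e <= size G)%N -> (off G e <= a.+1 * (q.+1 * a.+1))%N.
Proof.
move=> eG; apply: (@leq_trans (\sum_(i < e) q.+1 * a.+1)%N).
  apply: leq_sum => i _; apply: (supp_size cab HP rgb); apply: mem_nth.
  exact: leq_trans (ltn_ord i) eG.
rewrite sum_nat_const card_ord leq_mul2r; apply/orP; right.
exact: leq_trans eG (gb_size cab HP rgb).
Qed.

(** The exponents are bounded by the staircase of the basis and by the triangle that
    contains the support of the curve. *)
Lemma load_bounded V : (q <= V)%N -> (deg I <= V)%N -> (n <= V)%N ->
  (b.+1 * a.+1 <= V)%N -> (a.+1 * (q.+1 * a.+1) <= V)%N -> bounded V (load I).
Proof.
move=> qV mV nV sV oV t i.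
have aV : (a.+1 <= V)%N by apply: leq_trans oV; rewrite leq_pmulr.
have bV : (b.+1 <= V)%N by apply: leq_trans sV; rewrite leq_pmulr.
have tGP (x : nat * nat * F) : x \in flatten tG -> (x.1.1 <= V)%N /\ (x.1.2 <= V)%N.
  case/flattenP => s /mapP[g gG ->] /mapP[u]; rewrite mem_sort => ug -> /=.
  by have [] := gb_supp_le cab HP rgb gG ug; rewrite -/(fq F); move: qV aV; clear; lia.
rewrite /load /=.
case: t => [|[|[|[|[|[|t]]]]]] /=; last by rewrite (nth_default [::]) ?nth_nil.
- apply: nth_le_all => x; rewrite !inE.
  have sG := gb_size cab HP rgb; have sH := size_curve.
  rewrite terms_size size_map.
  by do 6?[case/orP]; move=> /eqP ->; first [exact: qV|exact: mV|exact: nV|exact: leq_trans sG aV|move: sG sH sV aV bV; clear; lia].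
- apply: nth_le_all => x /mapP[y /mapP[u]]; rewrite mem_sort => uH -> -> /=.
  by have [h _] := supp_curve uH; apply: leq_trans h (ltnW bV).
- apply: nth_le_all => x /mapP[y /mapP[u]]; rewrite mem_sort => uH -> -> /=.
  by have [_ h] := supp_curve uH; apply: leq_trans h (ltnW aV).
- case: (leqP i (size G)) => iG.
    rewrite nth_offsets ?size_map // add0n sum_off //.
    exact: leq_trans (off_le iG) oV.
  by rewrite nth_default //= size_scanl !size_map.
- by apply: nth_le_all => x /mapP[y /tGP[h _] ->].
- by apply: nth_le_all => x /mapP[y /tGP[_ h] ->].
Qed.

End InputTables.

(** The array of a product is polynomially larger than the product, which the word size
    accommodates. *)
Lemma size_le_bound (r L : nat) : (r == 2)%N || (r == 3)%N -> (0 < L)%N ->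
  (r ^ (nuof r L + 2 * depth (nuof r L)) + r ^ (nuof r L + 2 * depth (nuof r L)) <=
   32 * (741 * L) ^ 5)%N.
Proof.
move=> r23 L0; have r3 : (r <= 3)%N by case/orP: r23 => /eqP ->.
have r1 : (1 < r)%N by case/orP: r23 => /eqP ->.
have nu0 : (0 < nuof r L)%N by apply: leq_trans (nuof_ge5 r23 L).
have h1 := depth_bound r3 nu0.
(* 3 (4 L + 243) <= 741 L. *)
have h2 : (r ^ nuof r L <= 741 * L)%N.
  by apply: leq_trans (nuof_size r23 L) _; move: L0; clear; lia.
have h3 : (nuof r L <= 741 * L)%N by apply: leq_trans h2; apply: ltnW; apply: ltn_expl.
have h4 : (nuof r L ^ 4 <= (741 * L) ^ 4)%N by rewrite leq_exp2r.
have h5 : (r ^ nuof r L * (16 * nuof r L ^ 4) <= 16 * (741 * L) ^ 5)%N.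
  rewrite mulnCA leq_mul2l /= expnS; exact: leq_mul.
have := leq_trans h1 h5; move: (r ^ _)%N ((741 * L) ^ 5)%N; clear; lia.
Qed.

(** * The cost, and the theorem *)

Lemma fl_le a b : (0 < a)%N -> (fl a b (2 * a - 2) <= 2 * b)%N.
Proof.
move=> a0; rewrite /fl; apply: (@leq_trans ((b * (2 * a)) %/ a)%N).
  by apply: leq_div2r; rewrite leq_mul2l leq_subr orbT.
by rewrite mulnA mulnK // mulnC.
Qed.

Section Cost.
Context (q a b n r : nat).
Hypothesis r23 : (r == 2)%N || (r == 3)%N.
Hypotheses (a_gt0 : (0 < a)%N) (ab : (a < b)%N) (q_gt1 : (1 < q)%N) (qn : (q <= n)%N).
Hypothesis nq : (n <= q * q)%N.
Hypothesis abn : a = 1%N \/ (a * b <= 12 * n)%N.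
Local Notation Y := (q * n)%N.
Local Notation T := (times q a b).
Local Notation L := (logsize T r).

Let nY : (n <= Y)%N. Proof. by rewrite leq_pmull //; apply: ltnW. Qed.
Let n0 : (0 < n)%N. Proof. by apply: leq_trans qn; apply: ltnW. Qed.
Let Y0 : (0 < Y)%N. Proof. by apply: leq_trans nY. Qed.
Let qY : (q <= Y)%N. Proof. by rewrite leq_pmulr. Qed.
Let qqY : (q * q <= Y)%N. Proof. by rewrite leq_mul2l qn orbT. Qed.

Lemma aa_le : (a * a <= 12 * n)%N.
Proof.
case: abn => [->|h]; first by rewrite mul1n; move: n0; clear; lia.
by apply: leq_trans h; rewrite leq_mul2l (ltnW ab) orbT.
Qed.

Let a_aa : (a <= a * a)%N. Proof. by rewrite leq_pmulr. Qed.

(** By n <= q^2, since the points lie in a plane with q^2 points. *)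
Lemma a_le : (a <= 4 * q)%N.
Proof.
rewrite leqNgt; apply/negP => h; have := ltn_mul h h; have := aa_le; move: nq.
have -> : (4 * q * (4 * q) = 16 * (q * q))%N by rewrite mulnACA.
by move: (a * a)%N (q * q)%N => x y; clear; lia.
Qed.

Lemma aq_le : (a * q <= 12 * Y)%N.
Proof.
rewrite mulnCA [(q * _)%N]mulnC leq_mul2r; apply/orP; right.
exact: leq_trans a_aa aa_le.
Qed.

Lemma aaq_le : (a * a * q <= 12 * Y)%N.
Proof. by rewrite mulnCA [(q * _)%N]mulnC leq_mul2r aa_le orbT. Qed.

(** For a = 1 there is a single column of length q + 1.  Otherwise T is at most
    q + 2 b + 1, and a^2 b = a (a b) = O(q n). *)
Lemma aaT_le : (a * a * T <= 120 * Y)%N.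
Proof.
have h0 := aaq_le; have h1 := aa_le; have h2 := a_le.
rewrite /times !mulnDr muln1; case: abn => [a1|h].
  have -> : fl a b (2 * a - 2) = 0%N by rewrite a1 /fl muln0.
  by rewrite muln0; move: h0 h1 nY; clear; lia.
have h3 := fl_le b a_gt0.
have h4 : (a * a * fl a b (2 * a - 2) <= 96 * Y)%N.
  apply: (@leq_trans (a * a * (2 * b))%N); first by rewrite leq_mul2l h3 orbT.
  have -> : (a * a * (2 * b) = 2 * (a * (a * b)))%N by ring.
  have -> : (96 * Y = 2 * (4 * q * (12 * n)))%N by ring.
  by rewrite leq_mul2l /=; apply: leq_mul.
by move: h0 h1 h4 nY; clear; lia.
Qed.

Let T0 : (0 < T)%N. Proof. by rewrite /times addn1. Qed.

Lemma T_le : (T <= 120 * Y)%N.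
Proof. by apply: leq_trans aaT_le; rewrite leq_pmull // muln_gt0 a_gt0. Qed.

Lemma logsize_le : (L <= 19 * lg Y)%N.
Proof.
have r2 : (2 <= r)%N by case/orP: r23 => /eqP ->.
have nu0 : (0 < nuof r T)%N by apply: leq_trans (nuof_ge5 r23 T).
have h1 : (2 ^ nuof r T <= 2 ^ 17 * Y)%N.
  apply: (@leq_trans (r ^ nuof r T)); first by rewrite leq_exp2r.
  apply: leq_trans (nuof_size r23 T) _.
  apply: (@leq_trans (741 * T)); first by move: T0; clear; lia.
  (* 741 <= 2 ^ 10 and 120 <= 2 ^ 7. *)
  rewrite (expnD 2 10 7) -mulnA; apply: leq_mul => //.
  by apply: leq_trans T_le _; rewrite leq_mul2r; apply/orP; right.
have h2 : (Y < 2 ^ (trunc_log 2 Y).+1)%N by apply: trunc_log_ltn.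
have h3 : (2 ^ nuof r T < 2 ^ (17 + (trunc_log 2 Y).+1))%N.
  by apply: leq_ltn_trans h1 _; rewrite expnD ltn_pmul2l // expn_gt0.
rewrite ltn_exp2l // in h3; rewrite /logsize /lg.
by move: h3; move: (trunc_log 2 Y) (nuof r T) => x y; clear; lia.
Qed.

Definition cost_const : nat := (100 * 1000 + 1080 * 2000 + 1440 * block_const)%N.

Lemma interp_part : (q * (400 * (n + a + q + 3)) <= 68 * 100 * Y)%N.
Proof.
have h3 := aq_le.
have -> : (q * (400 * (n + a + q + 3)) = 400 * (Y + a * q + q * q + 3 * q))%N by ring.
by move: h3 qY qqY; move: (a * q)%N (q * q)%N Y => x y z; clear; lia.
Qed.

Lemma newton_part : (n * (500 * (a + q + 3)) <= 40 * 100 * Y)%N.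
Proof.
have h : (n * a <= n * (4 * q))%N by rewrite leq_mul2l a_le orbT.
have e : (n * (4 * q) = 4 * Y)%N by ring.
have -> : (n * (500 * (a + q + 3)) = 500 * (n * a + Y + 3 * n))%N by ring.
by move: h nY; rewrite e; move: (n * a)%N Y => x y; clear; lia.
Qed.

Lemma unpack_part : (400 * (q.+1 * a.+1 + a + 3) * (cols a).+1 <= 768 * 100 * Y)%N.
Proof.
have -> : (cols a).+1 = (2 * a)%N by rewrite /cols; move: a_gt0; clear; lia.
have e1 : (q.+1 * a.+1 <= 4 * (a * q))%N.
  have -> : (4 * (a * q) = (2 * q) * (2 * a))%N by ring.
  by apply: leq_mul; [move: q_gt1|move: a_gt0]; clear; lia.
have e2 : (a <= a * q)%N by rewrite leq_pmulr // ltnW.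
apply: (@leq_trans (400 * (8 * (a * q)) * (2 * a))%N).
  rewrite leq_mul2r leq_mul2l /=; apply/orP; right.
  by move: e1 e2 a_gt0; move: (q.+1 * a.+1)%N (a * q)%N => x y; clear; lia.
have -> : (400 * (8 * (a * q)) * (2 * a) = 64 * 100 * (a * a * q))%N by ring.
by move: aaq_le; move: (a * a * q)%N Y => x y; clear; lia.
Qed.

Lemma output_part : (200 * (cols a * q).+1 <= 48 * 100 * Y)%N.
Proof.
have e : (cols a * q + q = 2 * (a * q))%N.
  have e' : (cols a + 1 = 2 * a)%N by rewrite /cols; move: a_gt0; clear; lia.
  by rewrite mulnA -e' mulnDl mul1n.
by move: aq_le e q_gt1; move: (a * q)%N (cols a * q)%N Y => x y z; clear; lia.
Qed.

Lemma rounds_part k bc : (\sum_(c < T)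
    (k * ((a + cols a + 1) ^ 2 * L) + cols a * cols a * (bc * (2 ^ logn 2 c.+1 * L ^ 6))) <=
    1080 * (k * (Y * L ^ 7)) + 1440 * (bc * (Y * L ^ 7)))%N.
Proof.
have h4 := aaT_le; have L1 : (1 <= L)%N by [].
have LL7 : (L <= L ^ 7)%N by rewrite -[X in (X <= _)%N]expn1 leq_pexp2l.
rewrite big_split /=; apply: leq_add.
  rewrite sum_nat_const card_ord.
  have e : (a + cols a + 1 = 3 * a)%N by rewrite /cols; move: a_gt0; clear; lia.
  rewrite e; have -> : (T * (k * ((3 * a) ^ 2 * L)) = 9 * k * (a * a * T * L))%N by ring.
  have -> : (1080 * (k * (Y * L ^ 7)) = 9 * k * (120 * Y * L ^ 7))%N by ring.
  by rewrite leq_mul2l; apply/orP; right; apply: leq_mul.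
have cz : (cols a <= 2 * a)%N by rewrite /cols leq_subr.
rewrite -big_distrr -big_distrr -big_distrl /=.
have v := sum_v2 T.
have tl : ((trunc_log 2 T).+1 <= 3 * L)%N.
  have := log_le r23 (e := trunc_log 2 T) (T := T) ltac:(by apply: trunc_logP).
  by move: L1; move: (trunc_log 2 T) L => x y; clear; lia.
apply: (@leq_trans (2 * a * (2 * a) * (bc * (T * (3 * L) * L ^ 6))))%N.
  apply: leq_mul; first by apply: leq_mul.
  rewrite leq_mul2l; apply/orP; right; rewrite leq_mul2r; apply/orP; right.
  by apply: leq_trans v _; rewrite leq_mul2l tl orbT.
have -> : (2 * a * (2 * a) * (bc * (T * (3 * L) * L ^ 6)) =
     12 * bc * (a * a * T * L ^ 7))%N by ring.
have -> : (1440 * (bc * (Y * L ^ 7)) = 12 * bc * (120 * Y * L ^ 7))%N by ring.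
by rewrite leq_mul2l; apply/orP; right; rewrite leq_mul2r h4 orbT.
Qed.

Lemma sum_parts k bc c1 c2 c3 c4 c5 z y t m : 
  (c1 <= 68 * 100 * y -> c2 <= 40 * 100 * y -> c3 <= 768 * 100 * y ->
   c4 <= 1080 * (k * z) + 1440 * (bc * z) -> c5 <= 48 * 100 * y -> t <= 120 * y ->
   0 < y -> m <= y -> 0 < m -> 0 < t -> y <= z ->
   200 + (100 * m.+1 + c1 + c2) + c3 + (30 * t.+1 + c4) + c5 <=
   (100 * 1000 + 1080 * k + 1440 * bc) * z)%N.
Proof. clear; lia. Qed.

Lemma main_cost_le : (main_cost q a b n r <= cost_const * (Y * L ^ 7))%N.
Proof.
have p0 : (Y <= Y * L ^ 7)%N by rewrite leq_pmulr // expn_gt0.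
exact: (sum_parts interp_part newton_part unpack_part (rounds_part 2000 block_const)
  output_part T_le Y0 nY n0 T0 p0).
Qed.

End Cost.

Lemma scaled_le k x c l y : (x <= c * l)%N -> (k * (y * x) <= k * c * (y * l))%N.
Proof. by move=> h; rewrite -mulnA [(c * (y * l))%N]mulnCA !leq_mul2l h !orbT. Qed.

Section Instance.
Context (I : cab_input).
Hypothesis vI : valid_input I.
Local Notation q := (fq (fld I)).
Local Notation a := (pa I).
Local Notation b := (pb I).
Local Notation n := (len I).
Local Notation N := (#|fld I| + pa I + pb I + deg I + len I)%N.
Local Notation V := (N ^ 40)%N.

Let a_gt0 : (0 < a)%N. Proof. by case: vI => [[[[]]]]. Qed.
Let ab : (a < b)%N. Proof. by case: vI => [[]]. Qed.
Let q_gt1 : (1 < q)%N. Proof. exact: finNzRing_gt1. Qed.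

Lemma points_le : (n <= q * q)%N.
Proof.
have [_ [inj _] _ _ _] := vI.
by have := leq_card _ inj; rewrite card_ord card_prod.
Qed.

(** The power 40 covers the largest table, which is that of a product of length T. *)
Lemma run_exists : exists t s, exec (word_bound (40 * wlim) I) main_cmd (load I) t s /\
  ((t <= main_cost q a b n (radix (fld I)))%N /\
   exists f, [/\ outputs s f, in_RR a b (deg I) f, standard_form a f,
      forall u, u \in supp f -> u \in Bhat a b (deg I) (@pts I) &
      forall i, f.[(@pts I i).1, (@pts I i).2] = cw I ord0 i]).
Proof.
have [[cab _] [inj HP] _ gb cc] := vI.
have [z zE] : exists z, z = N by exists N.
have qN : (q.+1 <= z)%N by rewrite zE /fq; move: #|_| a_gt0 => x; clear; lia.
have aN : (a.+1 <= z)%N by rewrite zE; move: #|_| a_gt0 ab => x; clear; lia.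
have bN : (b.+1 <= z)%N by rewrite zE; move: #|_| a_gt0 => x; clear; lia.
have mN : (deg I <= z)%N by rewrite zE; move: #|_| => x; clear; lia.
have nN : (n <= z)%N by rewrite zE; move: #|_| => x; clear; lia.
have z5 : (5 <= z)%N.
  rewrite zE; have : (1 < #|fld I|)%N := q_gt1; move: #|_| a_gt0 ab => x; clear; lia.
rewrite /word_bound -zE; have z0 : (0 < z)%N by move: z5; clear; lia.
have [V VE] : exists V, V = (z ^ 40)%N by exists (z ^ 40)%N.
have mono i : (i <= 40)%N -> (z ^ i <= V)%N by move=> h; rewrite VE leq_pexp2l.
have pz i : (5 ^ i <= z ^ i)%N by case: i => // i; rewrite leq_exp2r.
have V4 : (625 <= V)%N by apply: leq_trans (pz 4%N) (mono 4%N isT).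
have V1 : (z < V)%N.
  by apply: leq_trans (mono 2%N isT); rewrite -mulnn -[X in (X < _)%N]muln1 ltn_mul2l z0; move: z5; clear; lia.
have V2 x y : (x <= z)%N -> (y <= z)%N -> (x * y <= V)%N.
  by move=> h1 h2; apply: leq_trans (mono 2%N isT); rewrite -mulnn leq_mul.
have Tz : (times q a b <= 3 * z)%N.
  rewrite /times; have := fl_le b a_gt0; move: (fl _ _ _) qN bN => x; clear; lia.
have V_ge : (250 <= V)%N by move: V4; clear; lia.
have W_ge : (V ^ wlim <= z ^ (40 * wlim))%N by rewrite VE expnM.
have qV : (q < V)%N by move: V1 qN; clear; lia.
have nV : (n <= V)%N by move: V1 nN; clear; lia.
have JTV : (cols a * (2 * times q a b) <= V)%N.
  apply: leq_trans (mono 5%N isT); rewrite (expnD z 2 3); apply: leq_mul.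
    rewrite -mulnn; apply: (@leq_trans (2 * z)%N); last by rewrite leq_mul2r; move: z5; clear; lia.
    by rewrite /cols; move: aN; clear; lia.
  apply: (@leq_trans (6 * z)%N); first by move: Tz; clear; lia.
  rewrite expnSr leq_mul2r; apply/orP; right.
  by apply: leq_trans (pz 2%N).
have S_le L : (0 < L <= times q a b)%N ->
    (radix (fld I) ^ (nuof (radix (fld I)) L + 2 * depth (nuof (radix (fld I)) L)) +
     radix (fld I) ^ (nuof (radix (fld I)) L + 2 * depth (nuof (radix (fld I)) L)) <= V)%N.
  move=> /andP[L0 LT]; have r23 : (radix (fld I) == 2)%N || (radix (fld I) == 3)%N.
    by rewrite /radix; case: ifP.
  (* 32 <= z ^ 3, and 741 L <= 741 (3 z) <= z ^ 6. *)
  apply: leq_trans (size_le_bound r23 L0) _; apply: leq_trans (mono 33%N isT).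
  rewrite (expnD z 3 30) (expnM z 6 5); apply: leq_mul; first exact: leq_trans (pz 3%N).
  rewrite leq_exp2r // expnSr; apply: (@leq_trans (741 * (3 * z))%N).
    by rewrite leq_mul2l; apply/orP; right; apply: leq_trans LT Tz.
  rewrite mulnA leq_mul2r; apply/orP; right; exact: leq_trans (pz 5%N).
have bl : bounded V (load I).
  apply: load_bounded => //.
  - exact: ltnW.
  - by apply: leq_trans mN (ltnW V1).
  - exact: V2.
  - by apply: leq_trans (mono 3%N isT); rewrite expnS -mulnn; do 2?apply: leq_mul.
have [t [s [e _ h]]] := main_spec V_ge W_ge cab HP inj gb cc qV nV JTV (V2 _ _ qN aN) S_le
  (load_loaded I) bl.
by exists t, s.
Qed.

Hypotheses (qn : (#|fld I| <= len I)%N) (gn : (genus a b <= n)%N).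

(** For a > 1, twice a - 1 and twice b - 1 are at least a and b, and (a - 1) (b - 1) is
    twice the genus, up to rounding. *)
Lemma genus_area : a = 1%N \/ (a * b <= 12 * n)%N.
Proof.
case: (ltnP 1 a) => a1; last by left; move: a_gt0 a1; clear; lia.
right; have n0 : (0 < n)%N by apply: leq_trans qn; apply: ltnW q_gt1.
have h1 : (a.-1 * b.-1 <= 2 * n + 1)%N.
  move: gn; rewrite /genus; move: (_ * _)%N => x; rewrite -{2}(odd_double_half x) -mul2n.
  by move=> h; case: (odd x); move: h; clear; lia.
have h2 : (a * b <= 4 * (a.-1 * b.-1))%N.
  have -> : (4 * (a.-1 * b.-1) = (2 * a.-1) * (2 * b.-1))%N by ring.
  by apply: leq_mul; move: a1 ab; clear; lia.
by move: h1 h2 n0; move: (a * b)%N (_ * _)%N => x y; clear; lia.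
Qed.

Lemma run_cost : (main_cost q a b n (radix (fld I)) <=
  cost_const * 19 ^ 7 * (q * n * lg (q * n) ^ 7))%N.
Proof.
have r23 : (radix (fld I) == 2)%N || (radix (fld I) == 3)%N by rewrite /radix; case: ifP.
have ga := genus_area; have pl := points_le.
apply: leq_trans (main_cost_le r23 a_gt0 ab q_gt1 qn pl ga) _.
have h := logsize_le r23 a_gt0 ab q_gt1 qn pl ga.
have h7 : (logsize (times q a b) (radix (fld I)) ^ 7 <= 19 ^ 7 * lg (q * n) ^ 7)%N.
  by rewrite -expnMn leq_exp2r.
exact: scaled_le h7.
Qed.

End Instance.

Theorem mainTheorem11 :
  let D (I : cab_input) : Prop :=
    [/\ valid_input I, (#|fld I| <= len I)%N
      & (genus (pa I) (pb I) <= len I)%N] in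
  (exists (prog : cmd) (k : nat) (T : cab_input -> nat),
     (forall I : cab_input, valid_input I ->
        exists (s : store (fld I)) (f : {poly {poly fld I}}),
          [/\ exec (word_bound k I) prog (load I) (T I) s /\ outputs s f,
              in_RR (pa I) (pb I) (deg I) f,
              standard_form (pa I) f,
              forall u, u \in supp f -> u \in Bhat (pa I) (pb I) (deg I) (@pts I)
            & forall i : 'I_(len I), f.[(@pts I i).1, (@pts I i).2] = cw I ord0 i])
     /\ softO D (fun I => (#|fld I| * len I)%N) T) /\
  (forall T : cab_input -> nat,
     softO D (fun I => (#|fld I| * len I)%N) T ->
     softO D (fun I => (len I ^ 2)%N) T).
Proof.
move=> D; split; last first.
  move=> T [C [d h]]; exists C, d => I DI; apply: leq_trans (h I DI) _.
  have [_ qn _] := DI; rewrite leq_mul2l; apply/orP; right.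
  have h2 : (#|fld I| * len I <= len I ^ 2)%N by rewrite -mulnn leq_mul2r qn orbT.
  apply: leq_mul => //; case: (d) => // d'; rewrite leq_exp2r // /lg.
  by rewrite geq_max leq_maxl leq_max leq_trunc_log ?orbT.
have ex I : exists t, valid_input I -> exists s,
    exec (word_bound (40 * wlim) I) main_cmd (load I) t s /\
    ((t <= main_cost (fq (fld I)) (pa I) (pb I) (len I) (radix (fld I)))%N /\
    exists f, [/\ outputs s f, in_RR (pa I) (pb I) (deg I) f, standard_form (pa I) f,
      forall u, u \in supp f -> u \in Bhat (pa I) (pb I) (deg I) (@pts I) &
      forall i, f.[(@pts I i).1, (@pts I i).2] = cw I ord0 i]).
  case: (excluded_middle_informative (valid_input I)) => [vI|nv]; last by exists 0%N.
  by have [t [s h]] := run_exists vI; exists t => _; exists s.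
pose T I := proj1_sig (constructive_indefinite_description _ (ex I)).
have TP I := proj2_sig (constructive_indefinite_description _ (ex I)).
exists main_cmd, (40 * wlim)%N, T; split.
  move=> I vI; have [s [e [_ [f [h1 h2 h3 h4 h5]]]]] := TP I vI.
  by exists s, f; split.
exists (cost_const * 19 ^ 7)%N, 7%N => I [vI qn gn].
have [s [_ [ht _]]] := TP I vI.
exact: leq_trans ht (run_cost vI qn gn).
Qed.
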